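(* Let $\alpha\in(0,2)$ and let $q^{(\alpha)}_t(x,y)$, $x,y\in\mathbb{R}$, $t>0$, denote the transition density of the one-dimensional symmetric $\alpha$-stable process. The kernel $$q^{(\alpha),*}_t(x,y)=\frac{y}{x}\left(q^{(\alpha)}_t(x,y)-q^{(\alpha)}_t(x,-y)\right),\qquad x,y\ge 0,\ t>0,$$ (a density in $y$ with respect to Lebesgue measure on $[0,\infty)$, with the value at $x=0$ understood as the limit as $x\downarrow 0$) defines a conservative Feller semigroup on $[0,\infty)$, whose associated Markov process $Y=(Y_t,t\ge 0)$ is self-similar with index $\alpha$. Moreover, $Y$ is equal in law to the radial part of a three-dimensional isotropic $\alpha$-stable process; that is, for a three-dimensional isotropic $\alpha$-stable process $X$ started from $z\in\mathbb{R}^3$, the process $(|X_t|,t\ge 0)$ has the same law as $Y$ started from $|z|$.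
   Context: For $d\in\mathbb{N}$ and $\alpha\in(0,2)$, the isotropic $\alpha$-stable process in $\mathbb{R}^d$ (called symmetric $\alpha$-stable when $d=1$) is the Lévy process $X=(X_t,t\ge0)$ with $\mathtt{E}_0[\exp(\mathrm{i}\,\theta\cdot X_t)]=\exp(-|\theta|^\alpha t)$ for all $\theta\in\mathbb{R}^d$, $t\ge0$, where $\mathtt{E}_x$ denotes expectation when the process starts from $x$. It has a transition density; for $d=1$ this is written $q^{(\alpha)}_t(x,y)$. Conservative means that the process has infinite lifetime (the kernel integrates to $1$ in $y$ over $[0,\infty)$). A Markov process $Y$ on $[0,\infty)$ with laws $(P_x)_{x\ge0}$ is self-similar with index $\alpha$ if for all $c>0$ and $x\ge 0$, the process $(cY_{c^{-\alpha}t},t\ge0)$ under $P_x$ is equal in law to $Y$ under $P_{cx}$. *)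

(* Defs.v *)
From HB Require Import structures.
From mathcomp Require Import all_boot all_order all_algebra.
From mathcomp Require Import all_classical all_reals all_analysis.

Set Implicit Arguments.
Unset Strict Implicit.
Unset Printing Implicit Defensive.

Import Order.TTheory GRing.Theory Num.Theory.
Import numFieldNormedType.Exports.

Local Open Scope classical_set_scope.
Local Open Scope ring_scope.

(* The library norm on matrices is the sup norm, hence [enorm]. *)
Definition dotv (R : realType) (n : nat) (u v : 'rV[R]_n) : R :=
  \sum_(i < n) u 0 i * v 0 i.

Definition enorm (R : realType) (n : nat) (v : 'rV[R]_n) : R :=
  Num.sqrt (dotv v v).

(* The product sigma-algebra on R^n, i.e. the Borel sets. *)
Definition borel_rV (R : realType) (n : nat) : set (set 'rV[R]_n) :=
  g_sigma_preimage (fun (i : 'I_n) (v : 'rV[R]_n) => v 0 i).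

(* A process is a map X : R -> T -> E; only the times t >= 0 are relevant. *)

Definition cadlag (R : realType) (n : nat) (x : R -> 'rV[R]_n) : Prop :=
  (forall t : R, 0 <= t -> x s @[s --> t^'+] --> x t) /\
  (forall t : R, 0 < t -> cvg (x s @[s --> t^'-])).

Definition levy_process (R : realType) (d : measure_display)
    (T : measurableType d) (P : probability T R) (n : nat)
    (z : 'rV[R]_n) (X : R -> T -> 'rV[R]_n) : Prop :=
  [/\ (forall (t : R) (i : 'I_n), 0 <= t ->
         measurable_fun setT (fun w => X t w 0 i)),
      P [set w | X 0 w = z] = 1%E,
      (forall (m : nat) (t : nat -> R) (A : nat -> set 'rV[R]_n),
         0 <= t 0%N -> (forall k, t k <= t k.+1) ->
         (forall k, borel_rV (A k)) ->
         P [set w | forall k, (k < m)%N -> A k (X (t k.+1) w - X (t k) w)] =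
         (\prod_(k < m) P [set w | A k (X (t k.+1) w - X (t k) w)%R])%E),
      (forall (s t : R) (A : set 'rV[R]_n), 0 <= s -> 0 <= t -> borel_rV A ->
         P [set w | A (X (s + t) w - X s w)] =
         P [set w | A (X t w - X 0 w)]) &
      {ae P, forall w, cadlag (fun t => X t w)}].

(* The complex identity E_z[exp(i theta.(X_t - z))] = exp(- |theta|^alpha t)
   is written as its real and imaginary parts. *)
Definition isotropic_stable (R : realType) (alpha : R) (d : measure_display)
    (T : measurableType d) (P : probability T R) (n : nat)
    (z : 'rV[R]_n) (X : R -> T -> 'rV[R]_n) : Prop :=
  levy_process P z X /\
  forall (t : R) (theta : 'rV[R]_n), 0 <= t ->
    (\int[P]_w (cos (dotv theta (X t w - z)%R))%:E
       = (expR (- (enorm theta `^ alpha * t))%R)%:E)%E /\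
    (\int[P]_w (sin (dotv theta (X t w - z)%R))%:E = 0)%E.

(* For a Lévy process X started from 0, its law when started from x is that
   of x + X.  A density is only determined almost everywhere; continuity in y
   selects the version for which pointwise values are meaningful. *)
Definition transition_density (R : realType) (d : measure_display)
    (T : measurableType d) (P : probability T R) (X : R -> T -> 'rV[R]_1)
    (q : R -> R -> R -> R) : Prop :=
  forall t x : R, 0 < t ->
    [/\ continuous (q t x),
        (forall y : R, 0 <= q t x y) &
        forall A : set R, measurable A ->
          P [set w | A (x + X t w 0 0)] =
          (\int[lebesgue_measure]_(y in A) (q t x y)%:E)%E].

Definition qstar_pos (R : realType) (q : R -> R -> R -> R) (t x y : R) : R :=
  y / x * (q t x y - q t x (- y)).

Definition qstar (R : realType) (q : R -> R -> R -> R) (t x y : R) : R :=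
  if x == 0 then lim (qstar_pos q t x' y @[x' --> (0 : R)^'+])
  else qstar_pos q t x y.

(* Functions on [0, +oo[ are represented by functions on R whose values on
   negative reals are ignored. *)

Definition C0_halfline (R : realType) (f : R -> R) : Prop :=
  {within `[0, +oo[, continuous f} /\ f x @[x --> +oo] --> (0 : R).

Definition feller_semigroup (R : realType) (S : R -> (R -> R) -> R -> R) :
    Prop :=
  [/\ (forall (t : R) (f : R -> R), 0 <= t ->
         C0_halfline f -> C0_halfline (S t f)),
      (forall (t a : R) (f g : R -> R) (x : R), 0 <= t -> 0 <= x ->
         C0_halfline f -> C0_halfline g ->
         S t (fun y => a * f y + g y) x = a * S t f x + S t g x),
      (forall (t : R) (f : R -> R), 0 <= t -> C0_halfline f ->
         (forall x : R, 0 <= x -> 0 <= f x <= 1) ->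
         forall x : R, 0 <= x -> 0 <= S t f x <= 1),
      (forall (f : R -> R) (x : R), 0 <= x -> C0_halfline f -> S 0 f x = f x) /\
      (forall (s t : R) (f : R -> R) (x : R), 0 <= s -> 0 <= t ->
         0 <= x -> C0_halfline f -> S (s + t) f x = S s (S t f) x) &
      (forall f : R -> R, C0_halfline f -> forall e : R, 0 < e ->
         \forall t \near (0 : R)^'+,
           forall x : R, 0 <= x -> `|S t f x - f x| < e)].

Definition density_semigroup (R : realType) (p : R -> R -> R -> R)
    (t : R) (f : R -> R) (x : R) : R :=
  if t == 0 then f x
  else \int[lebesgue_measure]_(y in (`[0%R, +oo[ : set R)) (f y * p t x y).

Definition conservative_density (R : realType) (p : R -> R -> R -> R) : Prop :=
  forall t x : R, 0 < t -> 0 <= x ->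
    [/\ measurable_fun (`[0, +oo[ : set R) (p t x),
        (forall y : R, 0 <= y -> 0 <= p t x y) &
        (\int[lebesgue_measure]_(y in (`[0%R, +oo[ : set R)) (p t x y)%:E
           = 1)%E].

Definition natural_filtration (R : realType) (d : measure_display)
    (T : measurableType d) (Y : R -> T -> R) (s : R) : set (set T) :=
  <<s [set A | exists (u : R) (B : set R),
        [/\ 0 <= u <= s, measurable B & A = Y u @^-1` B]] >>.

(* Markov property: E_x[f(Y_(s+t)) | F_s] = (S_t f)(Y_s) for bounded Borel f. *)
Definition markov_process (R : realType) (S : R -> (R -> R) -> R -> R)
    (d : measure_display) (T : measurableType d) (P : R -> probability T R)
    (Y : R -> T -> R) : Prop :=
  [/\ (forall (t : R) w, 0 <= t -> 0 <= Y t w),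
      (forall t : R, 0 <= t -> measurable_fun setT (Y t)),
      (forall x : R, 0 <= x -> P x [set w | Y 0 w = x] = 1%E) &
      (forall (x s t : R) (f : R -> R) (A : set T),
         0 <= x -> 0 <= s -> 0 <= t ->
         measurable_fun setT f -> (exists M : R, forall y, `|f y| <= M) ->
         natural_filtration Y s A ->
         (\int[P x]_(w in A) (f (Y (s + t) w))%:E =
          \int[P x]_(w in A) (S t f (Y s w))%:E)%E)].

(* The sigma-algebra on paths generated by the coordinates at times t >= 0. *)
Definition path_sigma_algebra (R : realType) : set (set (R -> R)) :=
  <<s [set C | exists (t : R) (B : set R),
        [/\ 0 <= t, measurable B & C = [set p | B (p t)]]] >>.

Definition eq_in_law (R : realType)
    (d1 : measure_display) (T1 : measurableType d1) (P1 : probability T1 R)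
    (Y1 : R -> T1 -> R)
    (d2 : measure_display) (T2 : measurableType d2) (P2 : probability T2 R)
    (Y2 : R -> T2 -> R) : Prop :=
  forall C : set (R -> R), path_sigma_algebra C ->
    P1 [set w | C (fun t => Y1 t w)] = P2 [set w | C (fun t => Y2 t w)].

Definition self_similar (R : realType) (alpha : R) (d : measure_display)
    (T : measurableType d) (P : R -> probability T R) (Y : R -> T -> R) :
    Prop :=
  forall c x : R, 0 < c -> 0 <= x ->
    eq_in_law (P x) (fun t w => c * Y (c `^ (- alpha) * t) w)
              (P (c * x)) Y.

(* Main.v *)
Require Import Defs.
From HB Require Import structures.
From mathcomp Require Import all_boot all_order all_algebra.
From mathcomp Require Import all_classical all_reals all_analysis.
From mathcomp Require Import measurable_realfun ring lra.

(** The proof rests on the radial form of the Fourier transform in dimension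
    three.  Write cf(th) = exp(- t |th|^alpha) and sinc u = sin u / u.

    Fourier inversion gives q_t(x, y) = p_t(y - x), where p_t(v) is 1 / (2 pi)
    times the integral of cos(th v) cf(th) ([transition_densityE]).  Since
    cos(a - b) - cos(a + b) = 2 sin a sin b, the kernel of the theorem is
      K_t(x, y) = pi^-1 y^2 int th^2 sinc(th x) sinc(th y) cf(th) dth
    ([qstarE]), which makes sense at x = 0.  As sinc(th |x|) is the average over
    the unit sphere of R^3 of the characters of frequency th, K_t is the
    transition density of the radial part of a three-dimensional process.

    The stable law is reached from Gaussians: l |-> exp(- t l^b), 0 < b < 1, is
    obtained from decreasing exponentials by nonnegative combinations and
    bounded limits ([exp_mix_stable], by the binomial series), so linear
    identities and inequalities in cf need only be checked for Gaussians in th.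
    In this way p_t is unimodal ([stable_pdf_unimodal]), hence K_t >= 0.

    The kernel acts explicitly on Gaussians: the integral of exp(- s y^2)
    against K_t(x, .) is the integral of sinc(th x) cf(th) against a probability
    density in th ([integral_gauss_radial_kernel]).  Letting s tend to 0 gives
    total mass one.  Combinations of Gaussians are dense in C_0([0, oo[), by
    Weierstrass' theorem in the variable exp(- y^2) ([gauss_span_dense]), so
    invariance of C_0 and strong continuity follow from the case of Gaussians;
    so does the semigroup property, because sinc(r .) is an eigenfunction of K_t
    with eigenvalue exp(- t |r|^alpha) ([radial_kernel_eigen], [radial_feller]).

    A Markov process with a given semigroup and starting point has a unique law
    on paths ([markov_eq_in_law]).  The rescaled process c Y_(c^-alpha t) has
    the semigroup of Y by the scaling of K_t ([semigroup_scale]).  For a stable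
    process X in R^3, an increment is independent of the past and can be
    integrated out with the past frozen ([freezing]); for an increment D over
    time t, E f(|x + D|) is the integral of f against K_t(|x|, .), because this
    holds when f is a Gaussian and Gaussians separate measures on the half-line
    ([expectation_radial]).  So |X| is Markov with the same semigroup. *)

Set Implicit Arguments.
Unset Strict Implicit.
Unset Printing Implicit Defensive.

Import Order.TTheory GRing.Theory Num.Theory.
Import numFieldNormedType.Exports.

Local Open Scope classical_set_scope.
Local Open Scope ring_scope.

(** * Integration tools *)

Lemma integrable_dom d (T : measurableType d) (R : realType)
    (mu : {measure set T -> \bar R}) (D : set T) (f g : T -> R) :
  measurable D -> measurable_fun D f ->
  mu.-integrable D (EFin \o g) -> (forall x, D x -> `|f x| <= g x) ->
  mu.-integrable D (EFin \o f).
Proof.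
move=> mD mf ig fg; apply: (le_integrable mD _ _ ig).
  exact/measurable_EFinP.
by move=> x Dx /=; rewrite lee_fin (le_trans (fg _ Dx))// ler_norm.
Qed.

Lemma integrable_finite d (T : measurableType d) (R : realType)
    (mu : {finite_measure set T -> \bar R}) (D : set T) (f : T -> R) (C : R) :
  measurable D -> measurable_fun D f -> (forall x, D x -> `|f x| <= C) ->
  mu.-integrable D (EFin \o f).
Proof.
move=> mD mf fC; apply: (@integrable_dom _ _ _ _ _ _ (cst C)) => //.
exact: finite_measure_integrable_cst.
Qed.

Lemma Rintegral_dct d (T : measurableType d) (R : realType)
    (mu : {measure set T -> \bar R}) (D : set T)
    (f_ : nat -> T -> R) (f g : T -> R) :
  measurable D ->
  (forall n, measurable_fun D (f_ n)) ->
  (forall x, D x -> f_ n x @[n --> \oo] --> f x) ->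
  mu.-integrable D (EFin \o g) ->
  (forall n x, D x -> `|f_ n x| <= g x) ->
  \int[mu]_(x in D) f_ n x @[n --> \oo] --> \int[mu]_(x in D) f x.
Proof.
move=> mD mf_ f_f ig fg.
have mf : measurable_fun D (EFin \o f).
  apply: (emeasurable_fun_cvg (fun n => EFin \o f_ n)) => //.
  - by move=> n; exact/measurable_EFinP.
  - by move=> x Dx; apply/cvg_EFin; [exact: nearW|exact: f_f].
have [] := @dominated_convergence _ T R mu D mD (fun n => EFin \o f_ n)
  (EFin \o f) (EFin \o g) _ mf _ ig _.
- by move=> n; exact/measurable_EFinP.
- by apply: aeW => x Dx; apply/cvg_EFin; [exact: nearW|exact: f_f].
- by apply: aeW => x n Dx; rewrite lee_fin; exact: fg.
move=> iF _ cF; apply: fine_cvg; rewrite fineK; first exact: cF.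
exact: integrable_fin_num iF.
Qed.

(** The product majorant makes every section integrable, so the exchange holds
    with no exceptional null set. *)
Lemma Rintegral_fubini d1 d2 (T1 : measurableType d1) (T2 : measurableType d2)
    (R : realType) (m1 : {sigma_finite_measure set T1 -> \bar R})
    (m2 : {sigma_finite_measure set T2 -> \bar R}) (D1 : set T1) (D2 : set T2)
    (f : T1 -> T2 -> R) (g : T1 -> R) (h : T2 -> R) :
  measurable D1 -> measurable D2 ->
  measurable_fun setT (fun z : T1 * T2 => f z.1 z.2) ->
  m1.-integrable D1 (EFin \o g) -> m2.-integrable D2 (EFin \o h) ->
  (forall x y, D1 x -> D2 y -> `|f x y| <= g x * h y) ->
  m1.-integrable D1 (EFin \o (fun x => \int[m2]_(y in D2) f x y)) /\
  \int[m1]_(x in D1) \int[m2]_(y in D2) f x y =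
  \int[m2]_(y in D2) \int[m1]_(x in D1) f x y.
Proof.
move=> mD1 mD2 mf ig ih fgh.
pose F (z : T1 * T2) : R := \1_D1 z.1 * \1_D2 z.2 * f z.1 z.2.
pose g' x : R := \1_D1 x * `|g x|.
pose h' y : R := \1_D2 y * `|h y|.
have mD1' : measurable_fun setT (fun z : T1 * T2 => \1_D1 z.1 : R).
  by apply: measurableT_comp => //; exact: measurable_indic.
have mD2' : measurable_fun setT (fun z : T1 * T2 => \1_D2 z.2 : R).
  by apply: measurableT_comp => //; exact: measurable_indic.
have mF : measurable_fun setT F by do 2 apply: measurable_funM => //.
have restr d (T : measurableType d) (D : set T) (u : T -> R) :
    (fun x => \1_D x * u x) = u \_ D.
  apply/funext => x; rewrite patchE indicE.
  by case: ifP; rewrite ?mul1r ?mul0r.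
have ig' : m1.-integrable setT (EFin \o g').
  rewrite /g' restr -restrict_EFin; apply: (integrable_mkcond _ mD1).1.
  exact: integrable_norm ig.
have ih' : m2.-integrable setT (EFin \o h').
  rewrite /h' restr -restrict_EFin; apply: (integrable_mkcond _ mD2).1.
  exact: integrable_norm ih.
have FE x y : F (x, y) = \1_D1 x * (\1_D2 y * f x y) by rewrite /F/= mulrA.
have Fgh x y : `|F (x, y)| <= g' x * h' y.
  rewrite /F/g'/h'/= !indicE.
  case: (boolP (x \in D1)) => xD1; last by rewrite !mul0r normr0.
  case: (boolP (y \in D2)) => yD2; last by rewrite !(mul0r,mulr0) normr0.
  rewrite !mul1r (le_trans (fgh _ _ (set_mem xD1) (set_mem yD2)))//.
  by rewrite -normrM ler_norm.
have g'0 x : 0 <= g' x by rewrite /g' mulr_ge0.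
have h'0 y : 0 <= h' y by rewrite /h' mulr_ge0.
have zl x : (\int[m2]_y ((g' x)%:E * (h' y)%:E) =
             (g' x)%:E * \int[m2]_y (h' y)%:E)%E.
  apply: ge0_integralZl_EFin => //; last exact: measurable_int ih'.
  by move=> y _; rewrite lee_fin.
have iF : (m1 \x m2)%E.-integrable setT (EFin \o F).
  apply/integrable12ltyP; first exact/measurable_EFinP.
  apply: (@le_lt_trans _ _ (\int[m1]_x \int[m2]_y ((g' x)%:E * (h' y)%:E))%E).
    apply: ge0_le_integral => //.
    - by move=> x _; apply: integral_ge0.
    - apply: (measurable_fun_fubini_tonelli_F
        (fun z => abse ((EFin \o F) z))) => //.
      by apply: measurableT_comp => //; apply: measurableT_comp.
    - apply: (eq_measurable_fun _ (fun x _ => esym (zl x))) => //.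
      by apply: emeasurable_funM => //; exact: measurable_int ig'.
    - move=> x _; apply: ge0_le_integral => //.
      + apply: measurableT_comp => //; apply/measurable_EFinP.
        exact: measurableT_comp mF (measurable_pair1 _).
      + by apply: emeasurable_funM => //; exact: measurable_int ih'.
      + by move=> y _; rewrite -EFinM lee_fin.
  under eq_integral do rewrite zl.
  have fh : (\int[m2]_y (h' y)%:E)%E \is a fin_num.
    exact: (integrable_fin_num measurableT ih').
  rewrite -(fineK fh) ge0_integralZr//; first last.
  - by rewrite lee_fin fine_ge0// integral_ge0// => y _; rewrite lee_fin.
  - by move=> x _; rewrite lee_fin.
  - exact: measurable_int ig'.
  rewrite -(fineK (integrable_fin_num measurableT ig')) -EFinM.
  exact: ltry.
have E1 : (fun x => \1_D1 x * \int[m2]_(y in D2) f x y) =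
          fine \o fubini_F m2 (EFin \o F).
  apply/funext => x; rewrite /fubini_F /= Rintegral_mkcond -restr.
  rewrite /Rintegral.
  case: (boolP (x \in D1)) => xD1; rewrite indicE ?xD1 ?(negbTE xD1).
    rewrite mul1r; congr fine; apply: eq_integral => y _.
    by rewrite FE (indicE _ D1) xD1 mul1r.
  rewrite mul0r integral0_eq//= => y _.
  by rewrite FE (indicE _ D1) (negbTE xD1) mul0r.
have E2 : (fun y => \1_D2 y * \int[m1]_(x in D1) f x y) =
          fine \o fubini_G m1 (EFin \o F).
  apply/funext => y; rewrite /fubini_G /= Rintegral_mkcond -restr.
  rewrite /Rintegral.
  case: (boolP (y \in D2)) => yD2; rewrite indicE ?yD2 ?(negbTE yD2).
    rewrite mul1r; congr fine; apply: eq_integral => x _.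
    by rewrite FE mulrCA (indicE _ D2) yD2 mul1r.
  rewrite mul0r integral0_eq//= => x _.
  by rewrite FE mulrCA (indicE _ D2) (negbTE yD2) mul0r.
have iF1 := integrable_fubini_F iF.
have fin1 x : fubini_F m2 (EFin \o F) x \is a fin_num.
  apply: (integrable_fin_num measurableT).
  apply: (@integrable_dom _ _ _ m2 setT (fun y => F (x, y))
     (fun y => g' x * h' y)) => //.
    exact: measurableT_comp mF (measurable_pair1 _).
  exact: (integrableZl measurableT (g' x) ih').
have fin2 y : fubini_G m1 (EFin \o F) y \is a fin_num.
  apply: (integrable_fin_num measurableT).
  apply: (@integrable_dom _ _ _ m1 setT (fun x => F (x, y))
     (fun x => g' x * h' y)) => //.
    exact: measurableT_comp mF (measurable_pair2 _).
  exact: (integrableZr measurableT (h' y) ig').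
split.
  apply: (integrable_mkcond _ mD1).2; rewrite restrict_EFin -restr E1.
  by move: iF1; apply: (eq_integrable measurableT) => //= x _ /=; rewrite fineK.
rewrite Rintegral_mkcond -restr E1 [RHS]Rintegral_mkcond -restr E2.
rewrite /Rintegral; congr fine.
transitivity (\int[m1]_x fubini_F m2 (EFin \o F) x)%E.
  by apply: eq_integral => x _ /=; rewrite fineK.
rewrite integral12_prod_meas1// -integral21_prod_meas1//.
by apply: eq_integral => x _ /=; rewrite fineK.
Qed.

Lemma cvg0_bound (R : realType) (u v : nat -> R) :
  (forall n, `|u n| <= v n) -> v n @[n --> \oo] --> (0 : R) ->
  u n @[n --> \oo] --> (0 : R).
Proof.
move=> uv v0; apply/norm_cvg0P.
apply: (@squeeze_cvgr _ _ _ _ (cst 0) v) => //.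
  by apply: nearW => n; rewrite normr_ge0 uv.
exact: cvg_cst.
Qed.

Lemma cvg_seq_continuous (R : realType) (h : R -> R) (u : nat -> R) (a : R) :
  {for a, continuous h} -> u n @[n --> \oo] --> a ->
  h (u n) @[n --> \oo] --> h a.
Proof. by move=> hc hu; exact: cvg_comp hu hc. Qed.

Notation pushm mf m :=
  (measure_function_pushforward__canonical__measure_function_Measure m mf)
  (only parsing).

Section lebesgue_invariance.
Variable R : realType.
Local Notation mu := (@lebesgue_measure R).

Let affine (c a : R) (x : measurableTypeR R) : measurableTypeR R := c * x + a.

Let measurable_affine c a : measurable_fun setT (affine c a).
Proof. by apply: measurable_funD => //; exact: measurable_funM. Qed.

Let lebesgue_affine (c a : R) (c0 : 0 < c) (A : set (measurableTypeR R)) :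
  measurable A ->
  mu A = mscale (PosNum c0)%:num%:nng (pushm (measurable_affine c a) mu) A.
Proof.
move=> mA; apply: lebesgue_measure_unique => // _ [[u v]] _ <-.
rewrite -[RHS]/(c%:E * mu (affine c a @^-1` [set` `]u, v]]))%E.
rewrite [X in (_ * mu X)%E](_ : _ = [set` `](u - a) / c, (v - a) / c]]); last first.
  apply/seteqP; split=> x /=; rewrite /affine !in_itv/= => /andP[ux xv].
    by rewrite ltr_pdivrMr// ler_pdivlMr// mulrC ltrBlDr lerBrDr ux.
  by move: ux xv; rewrite ltr_pdivrMr// ler_pdivlMr// mulrC ltrBlDr lerBrDr
    => -> ->.
rewrite !lebesgue_measure_itv/= !lte_fin ltr_pM2r ?invr_gt0// ltrD2r.
case: ifP => uv; last by rewrite mule0.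
by rewrite -!EFinB -EFinM; congr EFin; field; rewrite gt_eqF.
Qed.

(** Transport of integrals along x |-> c x + a, from the uniqueness of Lebesgue
    measure among measures giving intervals their length. *)
Lemma integral_affine (c a : R) (f : R -> R) : 0 < c ->
  mu.-integrable setT (EFin \o f) ->
  mu.-integrable setT (EFin \o (fun x => f (c * x + a))) /\
  \int[mu]_x f x = c * \int[mu]_x f (c * x + a).
Proof.
move=> c0 iF; have mf := measurable_int _ iF.
have E (g : R -> \bar R) : measurable_fun setT g -> (forall x, 0 <= g x)%E ->
   (\int[mu]_x g x = c%:E * \int[mu]_x g (c * x + a)%R)%E.
  move=> mg g0.
  rewrite (eq_measure_integral
    (mscale (PosNum c0)%:num%:nng (pushm (measurable_affine c a) mu))).
    rewrite ge0_integral_mscale//=.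
    congr (_ * _)%E.
    by rewrite (ge0_integral_pushforward (measurable_affine c a)).
  by move=> A mA _; exact: lebesgue_affine.
have maff : measurable_fun setT (fun x : R => c * x + a).
  exact: measurable_affine.
have iFa : mu.-integrable setT (EFin \o (fun x => f (c * x + a))).
  apply/integrableP; split.
    exact: (measurableT_comp mf maff).
  move/integrableP : iF => [_]; rewrite E//; last first.
    by apply: measurableT_comp.
  apply: contraTT; rewrite -!leNgt !leye_eq => /eqP ->.
  by rewrite gt0_muley// lte_fin.
split => //.
rewrite /Rintegral.
have ifp := integrable_funepos measurableT iF.
have ifn := integrable_funeneg measurableT iF.
rewrite integralE E//; last exact: measurable_int ifp.
rewrite (E (funeneg _))//; last exact: measurable_int ifn.
rewrite [in RHS]integralE.
have iap := integrable_funepos measurableT iFa.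
have ian := integrable_funeneg measurableT iFa.
set P := (\int[mu]_x (EFin \o (fun x => f (c * x + a)%R))^\+ x)%E.
set N := (\int[mu]_x (EFin \o (fun x => f (c * x + a)%R))^\- x)%E.
rewrite [X in (_ * X - _)%E](_ : _ = P); last first.
  by apply: eq_integral => x _; rewrite !funeposE.
rewrite [X in (_ - _ * X)%E](_ : _ = N); last first.
  by apply: eq_integral => x _; rewrite !funenegE.
have Pf : P \is a fin_num := integrable_fin_num measurableT iap.
have Nf : N \is a fin_num := integrable_fin_num measurableT ian.
rewrite -[X in _ = c * fine X]/(P - N)%E.
by rewrite -(fineK Pf) -(fineK Nf) -!EFinM -!EFinB /= mulrBr.
Qed.

Lemma integral_reflect (f : R -> R) :
  mu.-integrable setT (EFin \o f) ->
  mu.-integrable setT (EFin \o (fun x => f (- x))) /\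
  \int[mu]_x f x = \int[mu]_x f (- x).
Proof.
move=> iF; have mf := measurable_int _ iF.
have mN : measurable_fun setT (-%R : R -> measurableTypeR R) by [].
have E (g : R -> \bar R) : measurable_fun setT g -> (forall x, 0 <= g x)%E ->
   (\int[mu]_x g x = \int[mu]_x g (- x)%R)%E.
  move=> mg g0.
  rewrite (eq_measure_integral (pushm mN mu)).
    by rewrite ge0_integral_pushforward.
  by move=> A mA _; exact/esym/lebesgue_measureN.
have iFa : mu.-integrable setT (EFin \o (fun x => f (- x))).
  apply/integrableP; split.
    exact: (measurableT_comp mf mN).
  move/integrableP : iF => [_]; rewrite E//.
  by apply: measurableT_comp.
split => //.
rewrite /Rintegral; congr fine.
have ifp := integrable_funepos measurableT iF.
have ifn := integrable_funeneg measurableT iF.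
rewrite integralE E//; last exact: measurable_int ifp.
rewrite (E (funeneg _))//; last exact: measurable_int ifn.
rewrite [in RHS]integralE; congr (_ - _)%E; apply: eq_integral => x _.
  by rewrite !funeposE.
by rewrite !funenegE.
Qed.

End lebesgue_invariance.

Section density.
Context d (T : measurableType d) (R : realType).
Variables (mu : {sigma_finite_measure set T -> \bar R}) (p : T -> R).
Hypothesis p0 : forall x, 0 <= p x.
Hypothesis ip : mu.-integrable setT (EFin \o p).

(** The two proofs are arguments of the definition so that the measure and
    finiteness structures can be attached to it. *)
Definition density_measure (_ : mu.-integrable setT (EFin \o p))
  (_ : forall x, 0 <= p x) (A : set T) : \bar R :=
  (\int[mu]_(x in A) (p x)%:E)%E.

Local Notation nu := (density_measure ip p0).

Let nu0 : nu set0 = 0%E.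
Proof. by rewrite /density_measure integral_set0. Qed.

Let nu_ge0 A : (0 <= nu A)%E.
Proof. by apply: integral_ge0 => x _; rewrite lee_fin. Qed.

Let nu_sigma_additive : semi_sigma_additive nu.
Proof.
move=> /= A mA tA mUA.
rewrite /density_measure integral_bigcup//=; last first.
  by apply: (integrableS _ _ (subsetT _)).
apply: is_cvg_ereal_nneg_natsum_cond => n _ _.
by apply: integral_ge0 => /= x ?; rewrite lee_fin.
Qed.

HB.instance Definition _ := isMeasure.Build _ _ _ nu
  nu0 nu_ge0 nu_sigma_additive.

Let nu_fin : fin_num_fun nu.
Proof.
move=> A mA; apply: (integrable_fin_num mA).
exact: (integrableS measurableT mA (subsetT _)).
Qed.

HB.instance Definition _ := Measure_isFinite.Build _ _ _ nu nu_fin.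

(** The density is the Radon-Nikodym derivative of the measure it defines. *)
Lemma integral_density_measure (f : T -> R) : nu.-integrable setT (EFin \o f) ->
  \int[nu]_x f x = \int[mu]_x (f x * p x).
Proof.
move=> iF; rewrite /Rintegral; congr fine.
have dom : nu `<< mu.
  apply/null_content_dominatesP => A mA A0.
  apply: null_set_integral => //.
  by apply: measurable_int; exact: (integrableS measurableT mA (subsetT _) ip).
rewrite -(Radon_Nikodym_change_of_variables dom)//=.
apply: ae_eq_integral => //.
- by apply: emeasurable_funM => //; exact: measurable_int iF.
- apply/measurable_EFinP; apply: measurable_funM.
    exact/measurable_EFinP/(measurable_int _ iF).
  exact/measurable_EFinP/(measurable_int _ ip).
- have : ae_eq mu setT (Radon_Nikodym (charge_of_finite_measure nu) mu)
      (EFin \o p); last first.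
    by apply: filterS => x /= h _; rewrite h// EFinM.
  rewrite Radon_NikodymE//=.
  case: cid => /= h [h1 h2 h3].
  apply: integral_ae_eq => //=.
    exact: measurable_int ip.
  by move=> E E01 mE; rewrite -h3.
Qed.

End density.

Section law.
Context d (T : measurableType d) d' (U : measurableType d') (R : realType).
Variables (P : probability T R) (X : T -> U).

(** [distribution] takes a bundled measurable function; here the bundling is
    done from a proof of measurability. *)
Definition law (mX : measurable_fun setT X) : probability U R :=
  distribution P
    (HB.pack_for {mfun T >-> U} X (@isMeasurableFun.Build _ _ _ _ X mX)).

Lemma Rintegral_law mX (h : U -> R) (C : R) :
  measurable_fun setT h -> (forall u, `|h u| <= C) ->
  \int[law mX]_u h u = \int[P]_w h (X w).
Proof.
move=> mh hC; rewrite /Rintegral; congr fine.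
have mEh : measurable_fun setT (EFin \o h) by exact/measurable_EFinP.
have iX : P.-integrable (X @^-1` setT) ((EFin \o h) \o X).
  rewrite preimage_setT; apply: (@integrable_finite _ _ R P setT (h \o X) C) => //.
    by apply: measurableT_comp.
  by move=> w _; exact: hC.
have := integral_pushforward mX mEh iX measurableT.
by rewrite preimage_setT.
Qed.

End law.

(** * Cardinal sine and Gaussian integrals *)

Section sinc.
Variable R : realType.
Implicit Types u v : R.

(** The value at 0 is the continuous one; sinc (r |y|) is the average of the
    characters of frequency r over the unit sphere of R^3. *)
Definition sinc u : R := if u == 0 then 1 else sin u / u.

Lemma mul_sinc u : u * sinc u = sin u.
Proof.
by rewrite /sinc; case: eqVneq => [->|u0]; rewrite ?mul0r ?sin0// mulrC divfK.
Qed.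

Lemma sinc0 : sinc 0 = 1.
Proof. by rewrite /sinc eqxx. Qed.

Lemma sincN u : sinc (- u) = sinc u.
Proof. by rewrite /sinc oppr_eq0 sinN invrN mulrNN. Qed.

Lemma sin_le_norm u : `|sin u| <= `|u|.
Proof.
have H v : 0 <= v -> `|sin v| <= v.
  move=> v0; have [|c _] := @MVT_segment R sin cos 0 v v0.
    by apply: continuous_subspaceT; exact: continuous_sin.
  rewrite sin0 !subr0 => ->; rewrite normrM (ger0_norm v0).
  by rewrite ler_piMl// cos_max.
have [u0|u0] := leP 0 u; first by rewrite (ger0_norm u0) H.
by rewrite (ltr0_norm u0) -normrN -sinN H// oppr_ge0 ltW.
Qed.

Lemma sinc_le1 u : `|sinc u| <= 1.
Proof.
rewrite /sinc; case: eqVneq => [_|u0]; first by rewrite normr1.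
by rewrite normrM normfV ler_pdivrMr ?normr_gt0// mul1r sin_le_norm.
Qed.

Lemma continuous_sinc : continuous sinc.
Proof.
move=> x; have [->|x0] := eqVneq x 0.
  apply/continuous_withinNx; rewrite sinc0.
  have [ds ds1] := is_derive_sin (0 : R).
  have /cvg_ex[/= l hl] := ds.
  have <- : l = 1 by rewrite -(@cos0 R) -ds1; apply/esym/cvg_lim.
  move: hl; under eq_fun do rewrite addr0 sin0 subr0 [_ *: 1]mulr1.
  apply: cvg_trans; apply: near_eq_cvg; near=> h.
  rewrite /sinc ifF; first by rewrite mulrC.
  by apply/negbTE; near: h; exact: nbhs_dnbhs_neq.
rewrite /continuous_at.
have -> : sinc x = sin x * x^-1 by rewrite /sinc (negbTE x0).
apply: (@cvg_trans _ ((fun u => sin u * u^-1) @ x)).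
  apply: near_eq_cvg; near=> u; rewrite /sinc ifF//.
  by apply/negbTE; near: u; apply: (cvgr_neq0 _ (f := id)) x0; exact: cvg_id.
have h : u^-1 @[u --> x] --> x^-1 by apply: cvgV => //; exact: cvg_id.
exact: (cvgM (@continuous_sin R x) h).
Unshelve. all: by end_near. Qed.

End sinc.

Section improper_ftc.
Variable R : realType.
Local Notation mu := (@lebesgue_measure R).

(** An integrable derivative of a function vanishing at both infinities has
    zero integral: this is integration by parts on the line. *)
Lemma integral_derivative_eq0 (F f : R -> R) :
  (forall x : R, is_derive x 1 F (f x)) -> continuous f ->
  mu.-integrable setT (EFin \o f) ->
  F n%:R @[n --> \oo] --> (0 : R) -> F (- n%:R) @[n --> \oo] --> (0 : R) ->
  \int[mu]_x f x = 0.
Proof.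
move=> dF cf iF Fp Fn.
have contF : continuous F.
  move=> x; apply: differentiable_continuous.
  by apply/derivable1_diffP; exact: (@ex_derive _ _ _ _ _ _ _ (dF x)).
pose f_ (n : nat) := (f \_ `[- n.+1%:R, n.+1%:R]).
have mf : measurable_fun setT f by exact: continuous_measurable_fun.
have L : \int[mu]_x f_ n x @[n --> \oo] --> \int[mu]_x f x.
  apply: (@Rintegral_dct _ _ R mu setT f_ f (fun x => `|f x|)) => //.
  - move=> n; apply/measurable_restrict => //.
    by apply: measurable_funS mf.
  - move=> x _; apply: (cvg_near_cst).
    near=> n; rewrite /f_ patchE ifT//; rewrite inE/= in_itv/= -ler_norml.
    near: n; apply: filterS (nbhs_infty_ger `|x|) => n /le_trans; apply.
    by rewrite ler_nat.
  - by have := integrable_norm iF.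
  - by move=> n x _; rewrite /f_ patchE; case: ifP => // _; rewrite normr0.
have E n : \int[mu]_x f_ n x = F n.+1%:R - F (- n.+1%:R).
  rewrite -Rintegral_mkcond /Rintegral (@continuous_FTC2 _ f F)//.
  - by rewrite gtrN.
  - exact: continuous_subspaceT.
  - split.
    + by move=> x _; exact: (@ex_derive _ _ _ _ _ _ _ (dF x)).
    + by apply: cvg_at_right_filter; exact: contF.
    + by apply: cvg_at_left_filter; exact: contF.
  - by move=> x _; rewrite derive1E; exact: (@derive_val _ _ _ _ _ _ _ (dF x)).
have L0 : \int[mu]_x f_ n x @[n --> \oo] --> (0 : R).
  rewrite (funext E) -[X in _ --> X](@subr0 R 0).
  by apply: cvgB; [move: Fp|move: Fn]; rewrite -cvg_shiftS.
by apply: (cvg_unique _ L L0).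
Unshelve. all: by end_near. Qed.

End improper_ftc.

Section gaussian.
Variable R : realType.
Local Notation mu := (@lebesgue_measure R).
Implicit Types a u x : R.

Definition gauss a x : R := expR (- (a * x ^+ 2)).

Lemma gauss_gt0 a x : 0 < gauss a x. Proof. exact: expR_gt0. Qed.

Lemma gauss_ge0 a x : 0 <= gauss a x. Proof. exact: expR_ge0. Qed.

Lemma gauss_le1 a x : 0 <= a -> gauss a x <= 1.
Proof. by move=> a0; rewrite /gauss expR_le1 oppr_le0 mulr_ge0// sqr_ge0. Qed.

Lemma gauss0 a : gauss a 0 = 1.
Proof. by rewrite /gauss expr0n/= mulr0 oppr0 expR0. Qed.

Lemma gaussN a x : gauss a (- x) = gauss a x.
Proof. by rewrite /gauss sqrrN. Qed.

Lemma gaussD a b x : gauss (a + b) x = gauss a x * gauss b x.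
Proof. by rewrite /gauss mulrDl opprD expRD. Qed.

Lemma is_derive_gauss a x : is_derive x 1 (gauss a) (- (2 * a * x) * gauss a x).
Proof.
have -> : gauss a = expR \o (fun y => - (a * y ^+ 2)) by [].
have h : is_derive x 1 (fun y : R => - (a * y ^+ 2)) (- (2 * a * x)).
  apply: is_derive_eq; rewrite /GRing.scale/= !mulr1.
  by ring.
rewrite mulrC; exact: is_derive1_comp.
Qed.

Lemma continuous_gauss a : continuous (gauss a).
Proof.
move=> x; apply: differentiable_continuous; apply/derivable1_diffP.
exact: (@ex_derive _ _ _ _ _ _ _ (is_derive_gauss a x)).
Qed.

Lemma measurable_gauss a : measurable_fun setT (gauss a).
Proof. exact: continuous_measurable_fun (@continuous_gauss a). Qed.

Definition gaussZ a : R := \int[mu]_x gauss a x.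

Lemma integrable_gauss a : 0 < a -> mu.-integrable setT (EFin \o gauss a) /\
  gaussZ a = Num.sqrt pi / Num.sqrt a.
Proof.
move=> a0; have sa0 : 0 < Num.sqrt a by rewrite sqrtr_gt0.
have [i1 e1] := integral_affine 0 sa0 (@integrableT_gauss R).
have E : gauss a = fun x => gauss_fun (Num.sqrt a * x + 0).
  by apply/funext => x; rewrite /gauss /gauss_fun addr0 exprMn sqr_sqrtr ?ltW.
split; first by rewrite E.
move: e1; rewrite [X in X = _]/Rintegral (@integralT_gauss R) /= => ->.
by rewrite /gaussZ -E mulrC mulKf// gt_eqF.
Qed.

Lemma gaussZ_gt0 a : 0 < a -> 0 < gaussZ a.
Proof.
move=> a0; have [_ ->] := integrable_gauss a0.
by rewrite divr_gt0// sqrtr_gt0// pi_gt0.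
Qed.

(** The Fourier transform of [gauss a] is [gaussZ a * gauss (4 * a)^-1], so this
    is the constant of Fourier inversion. *)
Lemma gaussZ_dual a : 0 < a -> gaussZ a * gaussZ (4 * a)^-1 = 2 * pi.
Proof.
move=> a0; have a40 : 0 < 4 * a by rewrite mulr_gt0.
have ai0 : 0 < (4 * a)^-1 by rewrite invr_gt0.
have [_ ->] := integrable_gauss a0; have [_ ->] := integrable_gauss ai0.
rewrite sqrtrV ?ltW// sqrtrM// invrK.
have -> : Num.sqrt (4 : R) = 2.
  by rewrite (_ : 4 = 2 ^+ 2) ?sqrtr_sqr ?ger0_norm// -natrX.
have sa0 : Num.sqrt a != 0 by rewrite gt_eqF// sqrtr_gt0.
have := @sqr_sqrtr R pi (pi_ge0 R); rewrite expr2.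
by move=> E; rewrite -[in RHS]E; field.
Qed.

Lemma gauss_pow_le a x : 0 < a -> (1 + x ^+ 2) * gauss a x <=
  (1 + 2 / a) * gauss (a / 2) x.
Proof.
move=> a0; have -> : gauss a x = gauss (a / 2) x * gauss (a / 2) x.
  by rewrite -gaussD -splitr.
rewrite mulrA; apply: ler_wpM2r; first exact: gauss_ge0.
rewrite mulrDl mul1r lerD//; first by rewrite gauss_le1// divr_ge0// ltW.
set v := a / 2 * x ^+ 2.
have -> : x ^+ 2 = 2 / a * v by rewrite /v; field; rewrite gt_eqF.
suff vg : v * gauss (a / 2) x <= 1.
  rewrite -[leRHS]mulr1 -[leLHS](mulrA (2 / a)).
  by rewrite ler_wpM2l// divr_ge0// ltW.
rewrite /gauss -/v expRN ler_pdivrMr ?expR_gt0// mul1r.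
by apply: le_trans (expR_ge1Dx v); rewrite lerDr.
Qed.

(** Half of the exponent absorbs a quadratic factor. *)
Lemma integrable_poly_gauss a C (f : R -> R) : 0 < a ->
  measurable_fun setT f -> (forall x, `|f x| <= C * (1 + x ^+ 2)) ->
  mu.-integrable setT (EFin \o (fun x => f x * gauss a x)).
Proof.
move=> a0 mf fC; have a20 : 0 < a / 2 by rewrite divr_gt0.
have [ia _] := integrable_gauss a20.
have C0 : 0 <= C.
  have := fC 0; rewrite expr0n/= addr0 mulr1; apply: le_trans; exact: normr_ge0.
apply: (@integrable_dom _ _ R mu setT _
  (fun x => C * (1 + 2 / a) * gauss (a / 2) x)) => //.
- apply: measurable_funM => //; exact: measurable_gauss.
- exact: (integrableZl measurableT (C * (1 + 2 / a)) ia).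
move=> x _; rewrite normrM (ger0_norm (gauss_ge0 _ _)).
rewrite (le_trans (ler_wpM2r (gauss_ge0 _ _) (fC x)))//.
by rewrite -!mulrA ler_wpM2l// gauss_pow_le.
Qed.

Lemma cvg_mul_gauss a : 0 < a ->
  (n%:R * gauss a n%:R) @[n --> \oo] --> (0 : R).
Proof.
move=> a0.
have B n : `|n%:R * gauss a n%:R| <= a^-1 * n.+1%:R^-1 * 2 :> R.
  rewrite ger0_norm ?mulr_ge0 ?gauss_ge0//.
  case: n => [|n].
    by rewrite mul0r !mulr_ge0// ?invr_ge0// ltW.
  rewrite /gauss expRN ler_pdivrMr ?expR_gt0//.
  apply: (le_trans _ (ler_wpM2l _ (expR_ge1Dx _))); last first.
    by rewrite !mulr_ge0// ?invr_ge0// ltW.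
  rewrite mulrDr mulr1 -[leLHS]add0r lerD//.
    by rewrite !mulr_ge0// ?invr_ge0// ltW.
  rewrite [leRHS](_ : _ = n.+1%:R * (2 * n.+1%:R / n.+2%:R)); last first.
    field; rewrite (gt_eqF a0)/= gt_eqF//; have := ler0n R n; lra.
  rewrite ler_peMr// ler_pdivlMr// mul1r -natrM ler_nat.
  by rewrite mul2n -addnn addSn -addSnnS leq_addr.
apply: (cvg0_bound B).
have h : a^-1 * n.+1%:R^-1 * 2 @[n --> \oo] --> (a^-1 * 0 * 2 : R).
  exact: cvgMr_tmp (cvgMl_tmp (@cvg_harmonic R)).
by rewrite mulr0 mul0r in h.
Qed.

End gaussian.

Section gaussian_fourier.
Variable R : realType.
Local Notation mu := (@lebesgue_measure R).
Implicit Types a u x : R.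

Let cont_cosM u : continuous (fun x : R => cos (u * x)).
Proof.
move=> x; apply: (@continuous_comp _ _ _ (fun x => u * x) (@cos R)).
  by apply: mulrl_continuous.
exact: continuous_cos.
Qed.

Let cont_sinM u : continuous (fun x : R => sin (u * x)).
Proof.
move=> x; apply: (@continuous_comp _ _ _ (fun x => u * x) (@sin R)).
  by apply: mulrl_continuous.
exact: continuous_sin.
Qed.

Lemma sqr_norm_bound x : `|x| <= 1 + x ^+ 2.
Proof.
rewrite -(real_normK (num_real x)); have := normr_ge0 x.
by move: `|x| => y y0; have := sqr_ge0 (y - 1); nra.
Qed.

Lemma integrable_cos_gauss a u : 0 < a ->
  mu.-integrable setT (EFin \o (fun x => cos (u * x) * gauss a x)).
Proof.
move=> a0; apply: (@integrable_poly_gauss R a 1) => //.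
  exact: continuous_measurable_fun (@cont_cosM u).
by move=> x; rewrite mul1r (le_trans (cos_max _))// lerDl sqr_ge0.
Qed.

Lemma integrable_sin_gauss a u : 0 < a ->
  mu.-integrable setT (EFin \o (fun x => x * sin (u * x) * gauss a x)).
Proof.
move=> a0; apply: (@integrable_poly_gauss R a 1) => //.
  by apply: measurable_funM => //; exact: continuous_measurable_fun (@cont_sinM u).
move=> x; rewrite mul1r normrM; apply: le_trans (sqr_norm_bound x).
by rewrite ler_piMr// sin_max.
Qed.

Definition fourier_gauss a u : R := \int[mu]_x (cos (u * x) * gauss a x).

(** Integrating the derivative of sin (u x) exp(- a x^2) over the line trades
    the factor x for a multiple of the cosine transform. *)
Let fourier_sin a u : 0 < a ->
  \int[mu]_x (x * sin (u * x) * gauss a x) = u / (2 * a) * fourier_gauss a u.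
Proof.
move=> a0.
have ic := integrable_cos_gauss u a0; have is_ := integrable_sin_gauss u a0.
have dF (x : R) : is_derive x 1 (fun x => sin (u * x) * gauss a x)
    (u * (cos (u * x) * gauss a x) - 2 * a * (x * sin (u * x) * gauss a x)).
  have h1 : is_derive x 1 (fun x => sin (u * x)) (cos (u * x) * u).
    apply: (@is_derive1_comp _ _ (fun x => u * x)).
    by apply: is_derive_eq; rewrite /GRing.scale/= mulr1.
  have h2 := is_derive_gauss a x.
  by apply: is_derive_eq; rewrite /GRing.scale/=; ring.
have := integral_derivative_eq0 dF.
rewrite RintegralB//; last 2 first.
- exact: (integrableZl measurableT u ic).
- exact: (integrableZl measurableT (2 * a) is_).
rewrite !RintegralZl// => E.
suff /eqP : u * fourier_gauss a u -
    2 * a * \int[mu]_x (x * sin (u * x) * gauss a x) = 0.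
  rewrite subr_eq0 => /eqP E'; rewrite mulrAC E'.
  by field; rewrite gt_eqF.
apply: E.
- move=> x; apply: cvgB; apply: cvgMl_tmp; apply: cvgM.
  + exact: cont_cosM.
  + exact: continuous_gauss.
  + by apply: cvgM; [exact: cvg_id|exact: cont_sinM].
  + exact: continuous_gauss.
- exact: (integrableB measurableT (integrableZl measurableT u ic)
    (integrableZl measurableT (2 * a) is_)).
- apply: (@cvg0_bound _ _ (fun n => `|u| * (n%:R * gauss a n%:R))).
    move=> n; rewrite normrM mulrA (ger0_norm (gauss_ge0 _ _)).
    by rewrite ler_wpM2r ?gauss_ge0// (le_trans (sin_le_norm _))// normrM normr_nat.
  by rewrite -[X in _ --> X](@mulr0 R `|u|); apply: cvgMl_tmp; exact: cvg_mul_gauss.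
- apply: (@cvg0_bound _ _ (fun n => `|u| * (n%:R * gauss a n%:R))).
    move=> n; rewrite gaussN normrM mulrA (ger0_norm (gauss_ge0 _ _)).
    rewrite ler_wpM2r ?gauss_ge0// (le_trans (sin_le_norm _))// normrM.
    by rewrite normrN normr_nat.
  by rewrite -[X in _ --> X](@mulr0 R `|u|); apply: cvgMl_tmp; exact: cvg_mul_gauss.
Qed.

(** Differentiation under the integral and [fourier_sin] give a first-order
    linear equation for the cosine transform. *)
Let is_derive_fourier a u : 0 < a ->
  is_derive u 1 (fourier_gauss a) (- (u / (2 * a) * fourier_gauss a u)).
Proof.
move=> a0.
pose f (v x : R) := cos (v * x) * gauss a x.
have dfv (v x : R) : is_derive v 1 (f ^~ x) (- (x * sin (v * x) * gauss a x)).
  have h1 : is_derive v 1 (fun v => cos (v * x)) (- sin (v * x) * x).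
    apply: (@is_derive1_comp _ _ (fun v => v * x)).
    by apply: is_derive_eq; rewrite /GRing.scale/=; ring.
  rewrite /f; apply: is_derive_eq; rewrite /GRing.scale/=; ring.
have d1 (v x : R) : partial1of2 f v x = - (x * sin (v * x) * gauss a x).
  by rewrite partial1of2E; exact: (@derive_val _ _ _ _ _ _ _ (dfv v x)).
pose G x := (1 + x ^+ 2) * gauss a x.
have iG : mu.-integrable setT (EFin \o G).
  apply: (@integrable_poly_gauss R a 1) => //.
    by apply: measurable_funD => //; exact: measurable_funX.
  by move=> x; rewrite mul1r ger0_norm// addr_ge0// sqr_ge0.
have uI : `]u - 1, u + 1[%classic u.
  by rewrite /= in_itv/= ltrBlDr !ltrDl ltr01.
have h := @cvg_differentiation_under_integral R _ _ mu f setT measurableT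
  u (u - 1) (u + 1) uI _ _ G _ iG _.
have -> : - (u / (2 * a) * fourier_gauss a u) =
    \int[mu]_(y in setT) partial1of2 f u y.
  have -> : \int[mu]_(y in setT) partial1of2 f u y =
      \int[mu]_y (-1 * (y * sin (u * y) * gauss a y)).
    by apply: eq_Rintegral => y _; rewrite d1 mulN1r.
  rewrite -fourier_sin// RintegralZl ?mulN1r//; exact: integrable_sin_gauss.
have {}h : h^-1 *: (fourier_gauss a (h *: 1 + u) - fourier_gauss a u)
     @[h --> 0^'] --> \int[mu]_(y in setT) partial1of2 f u y.
  under eq_fun do rewrite [_ *: 1]mulr1.
  apply: h.
  - by move=> x _; exact: integrable_cos_gauss.
  - by move=> x y _ _; exact: (@ex_derive _ _ _ _ _ _ _ (dfv x y)).
  - by move=> y; rewrite mulr_ge0 ?gauss_ge0// addr_ge0// sqr_ge0.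
  - move=> x y _ _; rewrite d1 normrN normrM (ger0_norm (gauss_ge0 _ _)).
    rewrite ler_wpM2r ?gauss_ge0// normrM; apply: le_trans (sqr_norm_bound y).
    by rewrite ler_piMr// sin_max.
apply: DeriveDef; last by apply: cvg_lim h.
by apply/cvg_ex; eexists; exact: h.
Qed.

(** The quotient by the expected Gaussian has zero derivative. *)
Lemma fourier_gaussE a u : 0 < a ->
  fourier_gauss a u = gaussZ a * gauss (4 * a)^-1 u.
Proof.
move=> a0.
pose H v := fourier_gauss a v * gauss (- (4 * a)^-1) v.
have dH (v : R) : is_derive v 1 H 0.
  have h1 := is_derive_fourier v a0.
  have h2 := is_derive_gauss (- (4 * a)^-1) v.
  apply: is_derive_eq; rewrite /GRing.scale/=.
  by field; rewrite gt_eqF.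
have := is_derive_0_is_cst u 0 dH; rewrite /H gauss0 mulr1.
have -> : fourier_gauss a 0 = gaussZ a.
  by apply: eq_Rintegral => x _; rewrite mul0r cos0 mul1r.
move=> <-; rewrite -mulrA -gaussD addNr.
by rewrite /gauss mul0r oppr0 expR0 mulr1.
Qed.

Lemma fourier_gauss_sin a u : 0 < a ->
  \int[mu]_x (x * sin (u * x) * gauss a x) =
  u / (2 * a) * gaussZ a * gauss (4 * a)^-1 u.
Proof. by move=> a0; rewrite fourier_sin// fourier_gaussE// mulrA. Qed.

(** The three-dimensional Fourier transform of a Gaussian in polar coordinates:
    x^2 is the area of the sphere of radius x, up to a constant, and sinc the
    average of a character over it. *)
Lemma fourier_gauss_sinc a u : 0 < a ->
  \int[mu]_x (x ^+ 2 * sinc (x * u) * gauss a x) =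
  gaussZ a / (2 * a) * gauss (4 * a)^-1 u.
Proof.
move=> a0; have [->|u0] := eqVneq u 0.
  (* at u = 0 the second moment comes from the derivative of x exp(- a x^2) *)
  have [ig _] := integrable_gauss a0.
  have i2 : mu.-integrable setT (EFin \o (fun x => x ^+ 2 * gauss a x)).
    apply: (@integrable_poly_gauss R a 1) => //.
    by move=> x; rewrite mul1r ger0_norm ?sqr_ge0// lerDr.
  have dF (x : R) : is_derive x 1 (fun x => x * gauss a x)
     (gauss a x - 2 * a * (x ^+ 2 * gauss a x)).
    have h2 := is_derive_gauss a x.
    by apply: is_derive_eq; rewrite /GRing.scale/=; ring.
  have := integral_derivative_eq0 dF.
  rewrite RintegralB//; last exact: (integrableZl measurableT (2 * a) i2).
  rewrite RintegralZl// gauss0 mulr1 => E.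
  have /eqP : gaussZ a - 2 * a * \int[mu]_x (x ^+ 2 * gauss a x) = 0.
    apply: E.
    - move=> x; apply: cvgB; first exact: continuous_gauss.
      apply: cvgMl_tmp; apply: cvgM; last exact: continuous_gauss.
      exact: exprn_continuous.
    - exact: (integrableB measurableT ig (integrableZl measurableT (2 * a) i2)).
    - exact: cvg_mul_gauss.
    - under eq_fun do rewrite gaussN mulNr.
      by have h := cvgN (cvg_mul_gauss a0); rewrite oppr0 in h; exact: h.
  rewrite subr_eq0 => /eqP ->.
  under eq_Rintegral do rewrite mulr0 sinc0 mulr1.
  by field; rewrite gt_eqF.
have -> : \int[mu]_x (x ^+ 2 * sinc (x * u) * gauss a x) =
   \int[mu]_x (u^-1 * (x * sin (u * x) * gauss a x)).
  apply: eq_Rintegral => x _; rewrite (mulrC u x) -(mul_sinc (x * u)).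
  by field.
rewrite RintegralZl//; last exact: integrable_sin_gauss.
by rewrite fourier_gauss_sin//; field; rewrite u0 gt_eqF.
Qed.

End gaussian_fourier.

(** * Mixtures of exponentials *)

Section binomial_series.
Variables (R : realType) (b : R).
Hypothesis b01 : 0 < b < 1.

Let b0 : 0 < b. Proof. by case/andP: b01. Qed.
Let b1 : b < 1. Proof. by case/andP: b01. Qed.

(** The Taylor coefficients at zero of (1 - x) ^ b. *)
Fixpoint binom_coeff k : R :=
  if k is k'.+1 then binom_coeff k' * ((k'%:R - b) / k'.+1%:R) else 1.

Lemma binom_coeffS_le0 k : binom_coeff k.+1 <= 0.
Proof.
elim: k => [|k IH].
  by rewrite /= mul1r sub0r divr1 oppr_le0 ltW.
rewrite [binom_coeff _]/= mulr_le0_ge0// divr_ge0// subr_ge0.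
by rewrite (le_trans (ltW b1))// ler1n.
Qed.

Let a := binom_coeff.
Let d := pseries_diffs a.

Let dE k : d k = (k%:R - b) * a k.
Proof. by rewrite /d /pseries_diffs /a /=; field; rewrite gt_eqF. Qed.

(** The coefficients of the derived series are bounded because each ratio
    (k + 1 - b) / (k + 1) is in [0, 1]. *)
Let d_le1 k : `|d k| <= 1.
Proof.
elim: k => [|k IH].
  by rewrite dE sub0r /a /= mulr1 normrN (ger0_norm (ltW b0)) ltW.
have -> : d k.+1 = d k * ((k.+1%:R - b) / k.+1%:R).
  by rewrite dE /d /pseries_diffs; field; rewrite gt_eqF.
rewrite normrM mulr_ile1// ger0_norm ?ler_pdivrMr ?mul1r//.
  by rewrite gerBl ltW.
rewrite divr_ge0// subr_ge0.
by rewrite (le_trans (ltW b1))// ler1n.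
Qed.

Let a_le1 k : `|a k| <= 1.
Proof.
case: k => [|k]; first by rewrite normr1.
have := d_le1 k; rewrite /d /pseries_diffs normrM normr_nat.
apply: le_trans; rewrite ler_peMl// ler1n//.
Qed.

(** Abel's criterion: domination by a geometric series at a larger radius. *)
Let bounded_pseries (c : nat -> R) (C r K : R) : 0 < r -> 0 <= K -> K < r ->
  r < 1 -> (forall k, `|c k| * K ^+ k <= C * r ^+ k) -> cvgn (pseries c K).
Proof.
move=> r0 K0 Kr r1 cK; apply: normed_cvg.
apply: (@series_le_cvg _ _ (fun k => C * r ^+ k)).
- by move=> k; exact: normr_ge0.
- by move=> k; apply: le_trans (cK k); rewrite mulr_ge0// exprn_ge0.
- by move=> k /=; rewrite normrM (ger0_norm (exprn_ge0 _ K0)).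
- by apply: is_cvg_geometric_series; rewrite ger0_norm// ltW.
Qed.

Let cvg_bounded (c : nat -> R) K : 0 <= K < 1 -> (forall k, `|c k| <= 1) ->
  cvgn (pseries c K).
Proof.
move=> /andP[K0 K1] c1; pose r := (1 + K) / 2.
apply: (@bounded_pseries c 1 r K) => //; rewrite /r; try lra.
move=> k; rewrite ler_pM// ?exprn_ge0// lerXn2r// ?nnegrE//; lra.
Qed.

Let cvg_linear (c : nat -> R) K : 0 <= K < 1 ->
  (forall k, `|c k| <= k.+1%:R) -> cvgn (pseries c K).
Proof.
move=> /andP[K0 K1] c1; pose r := (1 + K) / 2.
have r0 : 0 < r by rewrite /r; lra.
pose h := r^-1 - 1.
have h0 : 0 < h by rewrite subr_gt0 invf_gt1// /r; lra.
have Kr2 : K <= r * r by rewrite /r; nra.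
apply: (@bounded_pseries c (1 + h^-1) r K) => //; rewrite ?/r; try lra.
rewrite -/r => k.
have B : k.+1%:R <= (1 + h^-1) * r ^- k.
  have -> : r ^- k = (1 + h) ^+ k by rewrite /h addrC subrK exprVn.
  apply: (@le_trans _ _ ((1 + h^-1) * (1 + h *+ k))); last first.
    rewrite ler_wpM2l//; first by rewrite addr_ge0// invr_ge0 ltW.
    elim: k => [|k IH]; first by rewrite mulr0n addr0 expr0.
    rewrite exprS; apply: (@le_trans _ _ ((1 + h) * (1 + h *+ k))); last first.
      by rewrite ler_wpM2l// addr_ge0// ltW.
    rewrite mulrS; have : 0 <= h *+ k by rewrite mulrn_wge0// ltW.
    by move=> hk; nra.
  rewrite mulrDl mul1r mulrDr mulr1 -(mulr_natr h) mulrA mulVf ?gt_eqF// mul1r.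
  rewrite -natr1; have : 0 <= h^-1 by rewrite invr_ge0 ltW.
  have : 0 <= h * k%:R by rewrite mulr_ge0// ltW.
  lra.
apply: (@le_trans _ _ ((1 + h^-1) * r ^- k * (r * r) ^+ k)).
  rewrite ler_pM ?exprn_ge0//; first exact: le_trans (c1 k) B.
  by rewrite lerXn2r// nnegrE mulr_ge0// ltW.
suff -> : (1 + h^-1) * r ^- k * (r * r) ^+ k = (1 + h^-1) * r ^+ k by [].
have -> : (r * r) ^+ k = r ^+ k * r ^+ k by exact: exprMn.
have : r ^+ k != 0 by rewrite gt_eqF// exprn_gt0.
by move: (1 + h^-1) (r ^+ k) => C s s0; field.
Qed.

Let dd_bound k : `|pseries_diffs d k| <= k.+1%:R.
Proof. by rewrite /pseries_diffs normrM normr_nat ler_piMr. Qed.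

Let F (x : R) : R := limn (pseries a x).

(** The recurrence on the coefficients reads (1 - x) F' = - b F. *)
Let is_derive_F (x : R) : 0 <= x < 1 ->
  is_derive x 1 F (limn (pseries d x)) /\
  (1 - x) * limn (pseries d x) = - b * F x.
Proof.
move=> /andP[x0 x1]; pose K := (1 + x) / 2.
have K01 : 0 <= K < 1 by rewrite /K; apply/andP; split; lra.
have xK : `|x| < `|K|.
  by rewrite !ger0_norm// /K; lra.
split.
  apply: (@pseries_snd_diffs _ a K) => //.
  - exact: cvg_bounded.
  - exact: cvg_bounded.
  - exact: cvg_linear.
have x01 : 0 <= x < 1 by rewrite x0.
have cd : cvgn (pseries d x) by exact: cvg_bounded.
have ca : cvgn (pseries a x) by exact: cvg_bounded.
have /= h := pseries_diffs_equiv cd.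
have hx : series (fun i => x * (i%:R * a i * x ^+ i.-1)) @ \oo -->
    x * limn (pseries d x).
  apply: cvg_trans (cvgMl_tmp (a := x) h).
  by apply: near_eq_cvg; apply: nearW => n; rewrite /series/= mulr_sumr.
have hb : series (fun i => b * (a i * x ^+ i)) @ \oo --> b * F x.
  apply: cvg_trans (cvgMl_tmp (a := b) ca).
  by apply: near_eq_cvg; apply: nearW => n; rewrite /series/= mulr_sumr.
have hd := cvgB hx hb.
have E0 : pseries d x = series (fun i => x * (i%:R * a i * x ^+ i.-1)) -
    series (fun i => b * (a i * x ^+ i)).
  apply/funext => n; rewrite /pseries /series/= fctE -sumrB.
  apply: eq_bigr => -[|i] _; rewrite dE /=.
    by rewrite !mul0r mulr0; ring.
  by rewrite exprS; ring.
have E : limn (pseries d x) = x * limn (pseries d x) - b * F x.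
  by rewrite -(cvg_lim _ (hd _))// -E0.
rewrite mulrBl mul1r [X in X - _]E; ring.
Qed.

(** The sum F of the series satisfies the differential equation of (1 - x)^b, so
    F * (1 - x)^(- b) is constant. *)
Lemma binomial_series (x : R) : 0 <= x < 1 ->
  pseries binom_coeff x @ \oo --> (1 - x) `^ b.
Proof.
move=> x01; have /andP[x0 x1] := x01.
suff <- : F x = (1 - x) `^ b by exact: cvg_bounded.
pose D y := F y * (1 - y) `^ (- b).
have dD (y : R) : 0 <= y < 1 -> is_derive y 1 D 0.
  move=> y01; have [dF E] := is_derive_F y01.
  have y10 : 0 < 1 - y by case/andP: y01 => _; rewrite subr_gt0.
  have d1 : is_derive y 1 (fun y : R => 1 - y) (- 1).
    by apply: is_derive_eq; rewrite ?add0r ?sub0r ?scaler0; ring.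
  have d2 : is_derive y 1 (fun y => (1 - y) `^ (- b))
      (- b * (1 - y) `^ (- b - 1) * - 1).
    apply: (@is_derive1_comp _ (fun z => z `^ (- b))).
    exact: is_derive1_powR.
  apply: is_derive_eq; rewrite /GRing.scale/=.
  have -> : (1 - y) `^ (- b) = (1 - y) * (1 - y) `^ (- b - 1).
    rewrite -[X in _ = X * _](powRr1 (ltW y10)) -powRD ?subrKC//.
    by rewrite (gt_eqF y10) implybT.
  transitivity ((1 - y) `^ (- b - 1) * ((1 - y) * limn (pseries d y) + b * F y)).
    by ring.
  by rewrite E; ring.
have D0 : D 0 = 1.
  rewrite /D subr0 powR1 mulr1 /F.
  have E n : pseries a 0 n.+1 = 1.
    rewrite /pseries /series /= big_nat_recl//= expr0 mulr1 big1 ?addr0// => i _.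
    by rewrite exprS mul0r mulr0.
  apply: cvg_lim => //; rewrite -cvg_shiftS (funext E); exact: cvg_cst.
have : D x = 1.
  move: x0; rewrite le_eqVlt => /predU1P[<-//|x0].
  have [| |c _] := @MVT_segment R D (fun=> 0) 0 x (ltW x0).
  - move=> y; rewrite in_itv/= => /andP[y0 yx]; apply: dD.
    by rewrite ltW//= (lt_trans yx).
  - apply: derivable_within_continuous => y; rewrite in_itv/= => /andP[y0 yx].
    have := dD y; rewrite y0 (le_lt_trans yx)// => /(_ isT) h.
    exact: (@ex_derive _ _ _ _ _ _ _ h).
  by rewrite mul0r => /eqP; rewrite subr_eq0 => /eqP ->.
rewrite /D powRN => /(congr1 (fun z => z * (1 - x) `^ b)).
by rewrite mul1r mulfVK// gt_eqF// powR_gt0// subr_gt0.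
Qed.

End binomial_series.

Section exp_mix.
Variable R : realType.
Implicit Types (f g : R -> R) (s t C : R).

(** Functions on [0, +oo[ obtained from decreasing exponentials by nonnegative
    combinations and bounded pointwise limits; by Bernstein's theorem these are,
    up to the value at 0, the bounded completely monotone functions.  Linear
    identities and inequalities valid for Gaussians pass by induction to
    exp(- t |.|^alpha), evaluated at l = |th|^2. *)
Inductive exp_mix : (R -> R) -> Prop :=
| exp_mix_exp s : 0 <= s -> exp_mix (fun l => expR (- (s * l)))
| exp_mix_zero : exp_mix (fun=> 0)
| exp_mix_comb s f g : 0 <= s -> exp_mix f -> exp_mix g ->
    exp_mix (fun l => s * f l + g l)
| exp_mix_lim (f_ : nat -> R -> R) f C : (forall n, exp_mix (f_ n)) ->
    (forall n l, 0 <= l -> `|f_ n l| <= C) ->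
    (forall l, 0 <= l -> f_ n l @[n --> \oo] --> f l) -> exp_mix f.

Lemma exp_mix_bounded f : exp_mix f ->
  exists C, forall l, 0 <= l -> `|f l| <= C.
Proof.
elim=> {f} [s s0||s f g s0 _ [C fC] _ [D gD]|f_ f C _ _ fC f_f].
- exists 1 => l l0; rewrite ger0_norm ?expR_ge0// expR_le1 oppr_le0.
  by rewrite mulr_ge0.
- by exists 0 => l _; rewrite normr0.
- exists (s * C + D) => l l0; rewrite (le_trans (ler_normD _ _))//.
  by rewrite lerD ?gD// normrM ger0_norm// ler_wpM2l// fC.
- exists C => l l0.
  have c : `|f_ n l| @[n --> \oo] --> `|f l| by apply: cvg_norm; exact: f_f.
  rewrite -(cvg_lim _ c)//.
  apply: limr_le; first by apply/cvg_ex; eexists; exact: c.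
  by apply: nearW => n; exact: fC.
Qed.

(** Products of exponentials are exponentials; combinations and limits follow by
    a double induction. *)
Lemma exp_mix_mul f g : exp_mix f -> exp_mix g -> exp_mix (fun l => f l * g l).
Proof.
move=> mf mg; elim: mf => {f} [s s0||s f1 f2 s0 _ m1 _ m2|f_ f C mf_ m fC f_f].
- elim: mg => {g} [t t0||t g1 g2 t0 _ m1 _ m2|g_ g D mg_ m gD g_g].
  + rewrite (_ : (fun l => _) = (fun l => expR (- ((s + t) * l)))).
      by apply: exp_mix_exp; exact: addr_ge0.
    by apply/funext => l; rewrite mulrDl opprD expRD.
  + by under eq_fun do rewrite mulr0; exact: exp_mix_zero.
  + under eq_fun do rewrite mulrDr mulrCA.
    exact: exp_mix_comb.
  + apply: (@exp_mix_lim (fun n l => expR (- (s * l)) * g_ n l) _ D) => //.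
    * move=> n l l0; rewrite normrM; apply: le_trans (gD n l l0).
      rewrite ler_piMl// ger0_norm ?expR_ge0// expR_le1 oppr_le0.
      by rewrite mulr_ge0.
    * by move=> l l0; apply: cvgMl_tmp; exact: g_g.
- by under eq_fun do rewrite mul0r; exact: exp_mix_zero.
- by under eq_fun do rewrite mulrDl -mulrA; exact: exp_mix_comb.
- have [D gD] := exp_mix_bounded mg.
  apply: (@exp_mix_lim (fun n l => f_ n l * g l) _ (C * D)) => //.
  + by move=> n l l0; rewrite normrM ler_pM// ?fC// gD.
  + by move=> l l0; apply: cvgMr_tmp; exact: f_f.
Qed.

Lemma exp_mix_cst s : 0 <= s -> exp_mix (fun=> s).
Proof.
move=> s0; rewrite (_ : (fun=> s) = (fun l => s * expR (- (0 * l)) + 0)).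
  apply: exp_mix_comb => //; last exact: exp_mix_zero.
  exact: exp_mix_exp.
by apply/funext => l; rewrite mul0r oppr0 expR0 mulr1 addr0.
Qed.

Lemma exp_mix_pow f k : exp_mix f -> exp_mix (fun l => f l ^+ k).
Proof.
move=> mf; elim: k => [|k IH].
  by under eq_fun do rewrite expr0; exact: exp_mix_cst.
by under eq_fun do rewrite exprS; exact: exp_mix_mul.
Qed.

Lemma exp_mix_sum (c : nat -> R) (f_ : nat -> R -> R) n :
  (forall k, 0 <= c k) -> (forall k, exp_mix (f_ k)) ->
  exp_mix (fun l => \sum_(0 <= k < n) c k * f_ k l).
Proof.
move=> c0 mf; elim: n => [|n IH].
  by under eq_fun do rewrite big_nil; exact: exp_mix_zero.
under eq_fun do rewrite big_nat_recr//= addrC.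
exact: exp_mix_comb.
Qed.

(** The partial sums of the exponential series have nonnegative coefficients. *)
Lemma exp_mix_expR f : exp_mix f -> exp_mix (fun l => expR (f l)).
Proof.
move=> mf; have [C fC] := exp_mix_bounded mf.
apply: (@exp_mix_lim (fun n l => series (exp_coeff (f l)) n) _ (expR C)).
- move=> n; rewrite (_ : (fun l => _) =
    (fun l => \sum_(0 <= k < n) (k`!%:R)^-1 * (f l) ^+ k)).
    by apply: exp_mix_sum => k; [rewrite invr_ge0|exact: exp_mix_pow].
  by apply/funext => l; rewrite /series/=; apply: eq_bigr => k _; rewrite mulrC.
- move=> n l l0; rewrite /series/= (le_trans (ler_norm_sum _ _ _))//.
  apply: (@le_trans _ _ (series (exp_coeff C) n)).
    apply: ler_sum => k _; rewrite /exp_coeff/= normrM normfV normr_nat.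
    rewrite ler_wpM2r ?invr_ge0// normrX lerXn2r ?nnegrE ?fC//.
    exact: le_trans (fC _ l0).
  apply: nondecreasing_cvgn_le; last exact: is_cvg_series_exp_coeff.
  apply: nondecreasing_series => k _ _; apply: exp_coeff_ge0.
  exact: le_trans (fC _ l0).
- by move=> l l0; exact: is_cvg_series_exp_coeff.
Qed.

Section stable.
Variable b : R.
Hypothesis b01 : 0 < b < 1.

Let c k := - binom_coeff b k.+1.

Let c_ge0 k : 0 <= c k.
Proof. by rewrite oppr_ge0 binom_coeffS_le0. Qed.

Let cvg_c (x : R) : 0 <= x < 1 ->
  \sum_(0 <= k < n) c k * x ^+ k.+1 @[n --> \oo] --> 1 - (1 - x) `^ b.
Proof.
move=> x01; have := binomial_series b01 x01.
rewrite -cvg_shiftS /= => h.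
rewrite (_ : (fun n => _) = (fun n => 1 - pseries (binom_coeff b) x n.+1)).
  by apply: cvgB; [exact: cvg_cst|exact: h].
apply/funext => n; rewrite /pseries/series/= big_nat_recl//= expr0 mulr1.
rewrite opprD addNKr -sumrN; apply: eq_bigr => k _.
by rewrite mulNr.
Qed.

(** exp(- t l^b) is completely monotone: expand (1 - x)^b in x = exp(- l / n),
    where all coefficients but the constant one are nonpositive.  The shift of
    l by 1/n keeps x away from the singular point 1, and n^b (1 - x)^b tends to
    l^b. *)
Lemma exp_mix_stable t : 0 <= t -> exp_mix (fun l => expR (- (t * l `^ b))).
Proof.
move=> t0; have [b0 b1] := andP b01.
pose x n (l : R) := expR (- (n.+1%:R^-1 * (l + n.+1%:R^-1))).
have n0 n : 0 < n.+1%:R^-1 :> R by rewrite invr_gt0.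
have x01 n l : 0 <= l -> 0 <= x n l < 1.
  move=> l0; rewrite expR_ge0/= expR_lt1 oppr_lt0 mulr_gt0//.
  by rewrite ltr_wpDl.
have mx n : exp_mix (x n).
  rewrite (_ : x n = fun l => expR (- (n.+1%:R^-1 ^+ 2)) *
     expR (- (n.+1%:R^-1 * l)) + 0).
    apply: exp_mix_comb; [exact: expR_ge0| |exact: exp_mix_zero].
    by apply: exp_mix_exp; exact: ltW.
  apply/funext => l; rewrite addr0 -expRD /x mulrDr opprD addrC.
  by rewrite expr2.
pose T n := t * n.+1%:R `^ b.
have T0 n : 0 <= T n by rewrite mulr_ge0// powR_ge0.
have m1 n : exp_mix (fun l => expR (- (T n * (1 - x n l) `^ b))).
  have -> : (fun l => expR (- (T n * (1 - x n l) `^ b))) =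
     (fun l => expR (- T n) * expR (T n * (1 - (1 - x n l) `^ b))).
    by apply/funext => l; rewrite -expRD; congr expR; ring.
  apply: exp_mix_mul; first by apply: exp_mix_cst; exact: expR_ge0.
  apply: exp_mix_expR.
  apply: exp_mix_mul; first exact: exp_mix_cst.
  apply: (@exp_mix_lim (fun m l => \sum_(0 <= k < m) c k * x n l ^+ k.+1) _ 1).
  - by move=> m; apply: exp_mix_sum => // k; exact: exp_mix_pow.
  - move=> m l l0; rewrite ger0_norm; last first.
      apply: sumr_ge0 => k _; rewrite mulr_ge0// exprn_ge0//.
      exact: expR_ge0.
    have h := cvg_c (x01 n l l0).
    apply: (@le_trans _ _ (1 - (1 - x n l) `^ b)).
      rewrite -(cvg_lim _ h)//; apply: nondecreasing_cvgn_le; last first.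
        by apply/cvg_ex; eexists; exact: h.
      apply: nondecreasing_series => k _ _; rewrite mulr_ge0// exprn_ge0//.
      exact: expR_ge0.
    by rewrite gerBl powR_ge0.
  - by move=> l l0; exact/cvg_c/x01.
apply: (@exp_mix_lim (fun n l => expR (- (T n * (1 - x n l) `^ b))) _ 1) => //.
  move=> n l l0; rewrite ger0_norm ?expR_ge0// expR_le1 oppr_le0.
  by rewrite mulr_ge0// powR_ge0.
move=> l l0; apply: (@cvg_seq_continuous _ (fun z => expR (- z))).
  apply: (@continuous_comp _ _ _ (fun z : R => - z) (@expR R)).
    exact: oppr_continuous.
  exact: continuous_expR.
have E n : T n * (1 - x n l) `^ b = t * (n.+1%:R * (1 - x n l)) `^ b.
  by rewrite /T powRM ?mulrA// subr_ge0 ltW//; case/andP: (x01 n l l0).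
under eq_fun do rewrite E.
apply: cvgMl_tmp.
pose u n := n.+1%:R^-1 * (l + n.+1%:R^-1).
have u0 n : 0 <= u n by rewrite mulr_ge0// ?addr_ge0// ltW.
have ch : n.+1%:R^-1 @[n --> \oo] --> (0 : R) := @cvg_harmonic R.
(* squeeze by u / (1 + u) <= 1 - exp (- u) <= u *)
have cw : n.+1%:R * (1 - x n l) @[n --> \oo] --> l.
  apply: (@squeeze_cvgr _ _ _ _
    (fun n => (l + n.+1%:R^-1) / (1 + n.+1%:R^-1 * (l + n.+1%:R^-1)))
    (fun n => l + n.+1%:R^-1)).
  - apply: nearW => n; rewrite /x -/(u n); apply/andP; split.
      have -> : l + n.+1%:R^-1 = n.+1%:R * u n by rewrite /u mulVKf ?pnatr_eq0.
      rewrite -mulrA ler_wpM2l//.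
      have u1 : 0 < 1 + u n by rewrite ltr_pwDl.
      have : expR (- u n) * (1 + u n) <= 1.
        by rewrite expRN ler_pdivrMl ?expR_gt0// mulr1 expR_ge1Dx.
      rewrite ler_pdivrMr// mulrBl mul1r; lra.
    have -> : l + n.+1%:R^-1 = n.+1%:R * u n by rewrite /u mulVKf ?pnatr_eq0.
    rewrite ler_wpM2l// lerBlDr -lerBlDl.
    exact: expR_ge1Dx.
  - rewrite -[X in _ --> X](_ : (l + 0) / (1 + 0 * (l + 0)) = l); last first.
      by rewrite mul0r !addr0 divr1.
    apply: cvgM; first by apply: cvgD => //; exact: cvg_cst.
    apply: cvgV; first by rewrite mul0r addr0 oner_neq0.
    apply: cvgD; first exact: cvg_cst.
    by apply: cvgM => //; apply: cvgD => //; exact: cvg_cst.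
  - rewrite -[X in _ --> X]addr0; apply: cvgD => //; exact: cvg_cst.
have w0 n : 0 < n.+1%:R * (1 - x n l).
  by rewrite mulr_gt0// subr_gt0; case/andP: (x01 n l l0).
move: l0; rewrite le_eqVlt => /predU1P[l0|l0].
  rewrite -l0 in w0 cw *; rewrite powR0 ?gt_eqF//.
  by have /cvg_at_rightP := @powR_cvg0 R b b0; apply; split.
apply: (@cvg_seq_continuous _ (fun z => z `^ b)) => //.
apply: differentiable_continuous; apply/derivable1_diffP.
exact: (@ex_derive _ _ _ _ _ _ _ (is_derive1_powR b l0)).
Qed.

End stable.

End exp_mix.

(** * The one-dimensional stable density *)

Section stable_symbol.
Variables (R : realType) (alpha : R).
Hypothesis halpha : 0 < alpha < 2.
Local Notation mu := (@lebesgue_measure R).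

(** exp(- t |th|^alpha), written through th^2 because mixtures of exponentials in
    th^2 are mixtures of Gaussians in th. *)
Definition stable_cf (t th : R) : R := expR (- (t * (th ^+ 2) `^ (alpha / 2))).

Lemma stable_cfE t th : stable_cf t th = expR (- (`|th| `^ alpha * t)).
Proof.
rewrite /stable_cf (mulrC t) -(real_normK (num_real th)) -powR_mulrn//.
by rewrite -powRrM mulrC (mulrC 2%:R) divfK// mulrC.
Qed.

Lemma stable_cf_exp_mix t : 0 <= t ->
  exp_mix (fun l => expR (- (t * l `^ (alpha / 2)))).
Proof.
have /andP[a0 a2] := halpha => t0; apply: exp_mix_stable => //.
by rewrite divr_gt0//= ltr_pdivrMr// mul1r.
Qed.

Lemma stable_cf_ge0 t th : 0 <= stable_cf t th. Proof. exact: expR_ge0. Qed.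

Lemma stable_cf_le1 t th : 0 <= t -> stable_cf t th <= 1.
Proof. by move=> t0; rewrite expR_le1 oppr_le0 mulr_ge0// powR_ge0. Qed.

Lemma stable_cfD s t th : stable_cf (s + t) th = stable_cf s th * stable_cf t th.
Proof. by rewrite /stable_cf mulrDl opprD expRD. Qed.

Lemma measurable_stable_cf t : measurable_fun setT (stable_cf t).
Proof.
apply: measurableT_comp => //; apply: measurableT_comp => //.
apply: measurable_funM => //.
by apply: (measurableT_comp (measurable_powR (alpha / 2))).
Qed.

Let inv_quad (x : R) : R := (1 + x ^+ 2)^-1.

Let measurable_inv_quad : measurable_fun setT inv_quad.
Proof. exact: continuous_measurable_fun (@continuous_oneDsqrV R). Qed.

Let integrable_inv_quad : mu.-integrable setT (EFin \o inv_quad).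
Proof.
have q0 x : 0 <= inv_quad x by rewrite invr_ge0 addr_ge0// sqr_ge0.
apply/integrableP; split; first exact/measurable_EFinP.
under eq_integral do rewrite /= ger0_norm//.
rewrite ge0_symfun_integralT//; last 2 first.
- move=> x; exact: (@continuous_oneDsqrV R).
- by move=> x; rewrite /inv_quad /= sqrrN.
rewrite (_ : [set x | 0 <= x] = `[0, +oo[%classic); last first.
  by apply/seteqP; split => x/=; rewrite in_itv/= andbT.
by rewrite (@integral0y_oneDsqr R) -EFinM ltry.
Qed.

(** One term z^m / m! of the exponential series already beats th^4 once
    m alpha >= 4, which leaves the integrable bound 1 / (1 + th^2). *)
Lemma integrable_stable_cf t (f : R -> R) (C : R) : 0 < t ->
  measurable_fun setT f -> (forall x, `|f x| <= C * (1 + x ^+ 2)) ->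
  mu.-integrable setT (EFin \o (fun th => f th * stable_cf t th)).
Proof.
move=> t0 mf fC; have /andP[a0 a2] := halpha.
have C0 : 0 <= C.
  have := fC 0; rewrite expr0n/= addr0 mulr1; apply: le_trans; exact: normr_ge0.
pose N := (Num.truncn (4 / alpha)).
have N4 : 2 <= alpha / 2 * N.+1%:R.
  have : 4 / alpha < N.+1%:R by rewrite /N truncnS_gt.
  by rewrite ltr_pdivrMr// => h; lra.
pose K := 4 + 4 * (N.+1`!%:R / t ^+ N.+1).
have K4 : 4 <= K by rewrite lerDl mulr_ge0// divr_ge0// exprn_ge0// ltW.
have bound th : (1 + th ^+ 2) * stable_cf t th <= K * inv_quad th.
  rewrite /inv_quad; set y := th ^+ 2; have y0 : 0 <= y by exact: sqr_ge0.
  have y1 : 0 < 1 + y by rewrite ltr_pwDl.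
  rewrite ler_pdivlMr// mulrAC -expr2.
  have [yle1|yge1] := leP y 1.
    apply: le_trans K4; apply: (@le_trans _ _ ((1 + y) ^+ 2)).
      by rewrite ler_piMr ?sqr_ge0// stable_cf_le1// ltW.
    by nra.
  have ya : y ^+ 2 <= (y `^ (alpha / 2)) ^+ N.+1.
    rewrite -[leRHS]powR_mulrn ?powR_ge0// -powRrM -powR_mulrn//.
    by apply: ler_powR => //; exact: ltW.
  have e : stable_cf t th * (t ^+ N.+1 * y ^+ 2) <= N.+1`!%:R.
    rewrite /stable_cf -/y expRN ler_pdivrMl ?expR_gt0//.
    apply: (@le_trans _ _ ((t * y `^ (alpha / 2)) ^+ N.+1)).
      have -> : (t * y `^ (alpha / 2)) ^+ N.+1 = t ^+ N.+1 * (y `^ (alpha / 2)) ^+ N.+1.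
        exact: exprMn.
      by rewrite ler_wpM2l// exprn_ge0// ltW.
    have z0 : 0 <= t * y `^ (alpha / 2) by rewrite mulr_ge0 ?powR_ge0// ltW.
    have := expR_ge1Dxn N z0; move: (t * _) z0 => z z0 h.
    rewrite -ler_pdivrMr ?ltr0n ?fact_gt0//.
    by apply: le_trans h; rewrite lerDr.
  apply: (@le_trans _ _ (4 * (y ^+ 2 * stable_cf t th))).
    rewrite mulrA ler_wpM2r ?stable_cf_ge0//; nra.
  apply: (@le_trans _ _ (4 * (N.+1`!%:R / t ^+ N.+1))); last by rewrite lerDr.
  rewrite ler_wpM2l// ler_pdivlMr ?exprn_gt0//.
  by apply: le_trans e; rewrite le_eqVlt; apply/orP; left; apply/eqP; ring.
apply: (@integrable_dom _ _ R mu setT _ (fun th => C * (K * inv_quad th))) => //.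
- by apply: measurable_funM => //; exact: measurable_stable_cf.
- exact: (integrableZl measurableT C (integrableZl measurableT K integrable_inv_quad)).
move=> x _; rewrite normrM (ger0_norm (stable_cf_ge0 _ _)).
rewrite (le_trans (ler_wpM2r (stable_cf_ge0 _ _) (fC x)))//.
by rewrite -mulrA ler_wpM2l.
Qed.

End stable_symbol.

(** A density is specified on sets only; this is its action on test functions. *)
Lemma density_expectation d (T : measurableType d) (R : realType)
    (P : probability T R) (Z : T -> R) (f h : R -> R) (C : R) :
  measurable_fun setT Z -> measurable_fun setT f -> (forall y, 0 <= f y) ->
  (forall A : set R, measurable A ->
     P (Z @^-1` A) = (\int[lebesgue_measure]_(y in A) (f y)%:E)%E) ->
  measurable_fun setT h -> (forall y, `|h y| <= C) ->
  [/\ lebesgue_measure.-integrable setT (EFin \o f),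
      lebesgue_measure.-integrable setT (EFin \o (fun y => h y * f y)) &
      \int[lebesgue_measure]_y (h y * f y) = \int[P]_w h (Z w)].
Proof.
move=> mZ mf f0 PZ mh hC.
have i_f : lebesgue_measure.-integrable setT (EFin \o f).
  apply/integrableP; split; first exact/measurable_EFinP.
  under eq_integral do rewrite /= ger0_norm//.
  by rewrite -PZ// preimage_setT probability_setT ltry.
split => //.
  apply: (@integrable_dom _ _ R (@lebesgue_measure R) setT _ (fun y => C * f y)) => //.
  - exact: measurable_funM.
  - exact: (integrableZl measurableT C i_f).
  - by move=> y _; rewrite normrM (ger0_norm (f0 _)) ler_wpM2r.
pose nu : {finite_measure set (measurableTypeR R) -> \bar R} :=
  density_measure i_f f0.
have i_h : nu.-integrable setT (EFin \o h).
  by apply: (@integrable_finite _ _ R nu setT h C).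
have mZ' : measurable_fun setT (Z : T -> measurableTypeR R) := mZ.
have E := @Rintegral_law _ T _ (measurableTypeR R) R P _ mZ' h C mh hC.
rewrite -(integral_density_measure i_h); apply: etrans _ E.
rewrite /Rintegral; congr fine.
by apply: (@eq_measure_integral _ _ R setT (law P mZ') nu) => A mA _; exact: (esym (PZ A mA)).
Qed.

(** By the addition formulas, a shift of W only multiplies its characteristic
    function. *)
Lemma expectation_cos_sin d (T : measurableType d) (R : realType)
    (P : probability T R) (W : T -> R) (c p q : R) :
  measurable_fun setT W -> \int[P]_w cos (W w) = c -> \int[P]_w sin (W w) = 0 ->
  \int[P]_w (p * cos (W w) + q * sin (W w)) = p * c.
Proof.
move=> mW Wc Ws.
have ic : P.-integrable setT (EFin \o (fun w => cos (W w))).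
  apply: (@integrable_finite _ _ R P setT _ 1) => // [|w _]; last exact: cos_max.
  exact: measurableT_comp (continuous_measurable_fun (@continuous_cos R)) mW.
have is_ : P.-integrable setT (EFin \o (fun w => sin (W w))).
  apply: (@integrable_finite _ _ R P setT _ 1) => // [|w _]; last exact: sin_max.
  exact: measurableT_comp (continuous_measurable_fun (@continuous_sin R)) mW.
rewrite RintegralD//; last 2 first.
- exact: (integrableZl measurableT _ ic).
- exact: (integrableZl measurableT _ is_).
by rewrite !RintegralZl// Wc Ws mulr0 addr0.
Qed.

Section stable_density.
Variables (R : realType) (alpha : R).
Hypothesis halpha : 0 < alpha < 2.
Local Notation mu := (@lebesgue_measure R).
Local Notation cf := (stable_cf alpha).

Definition stable_pdf (t v : R) : R :=
  (2 * pi)^-1 * \int[mu]_th (cos (th * v) * cf t th).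

Lemma measurable_cosMl (v : R) : measurable_fun setT (fun th : R => cos (th * v)).
Proof.
apply: measurableT_comp; last exact: measurable_funM.
exact: continuous_measurable_fun (@continuous_cos R).
Qed.

Lemma integrable_cos_cf t v : 0 < t ->
  mu.-integrable setT (EFin \o (fun th => cos (th * v) * cf t th)).
Proof.
move=> t0; apply: (@integrable_stable_cf R alpha halpha t _ 1) => //.
  exact: measurable_cosMl.
by move=> x; rewrite mul1r (le_trans (cos_max _))// lerDl sqr_ge0.
Qed.

Section inversion.
Context d (T : measurableType d) (P : probability T R).
Variables (Z : T -> R) (t x : R) (f : R -> R).
Hypotheses (mZ : measurable_fun setT Z) (t0 : 0 < t).
Hypothesis hcos : forall th, \int[P]_w cos (th * Z w) = cf t th.
Hypothesis hsin : forall th, \int[P]_w sin (th * Z w) = 0.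
Hypotheses (cont_f : continuous f) (f0 : forall y, 0 <= f y).
Hypothesis Pf : forall A : set R, measurable A ->
  P [set w | A (x + Z w)] = (\int[mu]_(y in A) (f y)%:E)%E.

Let mf : measurable_fun setT f. Proof. exact: continuous_measurable_fun. Qed.

Let mxZ : measurable_fun setT (fun w => x + Z w).
Proof. exact: measurable_funD. Qed.

Let e c : R := (c / 2) ^+ 2.

Let e_gt0 c : 0 < c -> 0 < e c.
Proof. by move=> c0; rewrite exprn_gt0// divr_gt0. Qed.

Let mthZ th : measurable_fun setT (fun w => th * Z w).
Proof. exact: measurable_funM. Qed.

Lemma expectation_cos v th : \int[P]_w cos (th * (v - Z w)) = cos (th * v) * cf t th.
Proof.
under eq_Rintegral do rewrite mulrBr cosB.
exact: expectation_cos_sin.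
Qed.

Lemma expectation_sin v th : \int[P]_w sin (th * (v + Z w)) = sin (th * v) * cf t th.
Proof.
under eq_Rintegral do rewrite mulrDr sinD.
exact: expectation_cos_sin.
Qed.

(** The average of f around y at scale c, computed on the Fourier side: the
    Gaussian weight is a mixture of cosines, whose expectations are known. *)
Let smoothing c y : 0 < c ->
  mu.-integrable setT (EFin \o (fun v => gauss 1 v * f (c * v + y))) /\
  \int[mu]_v (gauss 1 v * f (c * v + y)) = gaussZ 1 * (2 * pi)^-1 *
  \int[mu]_th (cos (th * (y - x)) * cf t th * gauss (e c) th).
Proof.
move=> c0; pose h u := gauss (4 * e c)^-1 (y - u).
have e4 : (4 * e c)^-1 = c ^- 2.
  by rewrite /e; field; rewrite gt_eqF.
have hc v : h (c * v + y) = gauss 1 v.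
  rewrite /h e4 /gauss; congr expR; congr (- _).
  by field; rewrite gt_eqF.
have mh : measurable_fun setT h.
  by apply: measurableT_comp; [exact: measurable_gauss|exact: measurable_funB].
have h1 u : `|h u| <= 1.
  by rewrite ger0_norm ?gauss_ge0// gauss_le1// invr_ge0 mulr_ge0// ltW// e_gt0.
have [_ ihf Ehf] := density_expectation mxZ mf f0 Pf mh h1.
have [i1 E1] := integral_affine y c0 ihf.
have E2 : (fun v => h (c * v + y) * f (c * v + y)) =
          (fun v => gauss 1 v * f (c * v + y)).
  by apply/funext => v; rewrite hc.
rewrite E2 in i1 E1; split => //.
have -> : \int[mu]_v (gauss 1 v * f (c * v + y)) = c^-1 * \int[P]_w h (x + Z w).
  by rewrite -Ehf E1 mulKf// gt_eqF.
have -> : \int[P]_w h (x + Z w) = (gaussZ (e c))^-1 *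
    \int[P]_w \int[mu]_th (cos (th * (y - x - Z w)) * gauss (e c) th).
  rewrite -RintegralZl//; last first.
    apply: (@integrable_finite _ _ R P setT _ (gaussZ (e c))) => //.
      rewrite (_ : (fun w => _) = fun w => gaussZ (e c) * h (x + Z w)).
        by apply: measurable_funM => //; exact: measurableT_comp.
      apply/funext => w; under eq_Rintegral do rewrite mulrC (mulrC _ (y - x - Z w)) mulrC.
      by rewrite -/(fourier_gauss _ _) fourier_gaussE ?e_gt0// /h opprD addrA.
    move=> w _; under eq_Rintegral do rewrite mulrC (mulrC _ (y - x - Z w)) mulrC.
    rewrite -/(fourier_gauss _ _) fourier_gaussE ?e_gt0// normrM.
    rewrite !ger0_norm ?gauss_ge0 ?(ltW (gaussZ_gt0 _)) ?e_gt0//.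
    rewrite ler_piMr ?(ltW (gaussZ_gt0 _)) ?e_gt0//.
    by rewrite gauss_le1// invr_ge0 mulr_ge0// ltW// e_gt0.
  apply: eq_Rintegral => w _.
  under eq_Rintegral do rewrite mulrC (mulrC _ (y - x - Z w)) mulrC.
  rewrite -/(fourier_gauss _ _) fourier_gaussE ?e_gt0//.
  by rewrite /h opprD addrA mulKf// gt_eqF// gaussZ_gt0// e_gt0.
have [ig gE] := integrable_gauss (e_gt0 c0).
have mcg : measurable_fun setT
    (fun z : T * R => cos (z.2 * (y - x - Z z.1)) * gauss (e c) z.2).
  apply: measurable_funM.
    apply: measurableT_comp.
      exact: continuous_measurable_fun (@continuous_cos R).
    apply: measurable_funM => //; apply: measurable_funB => //.
    exact: measurableT_comp.
  by apply: measurableT_comp => //; exact: measurable_gauss.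
have bcg w th : setT w -> setT th -> `|cos (th * (y - x - Z w)) * gauss (e c) th|
    <= cst 1 w * gauss (e c) th.
  move=> _ _; rewrite normrM mul1r (ger0_norm (gauss_ge0 _ _)).
  by rewrite ler_piMl ?gauss_ge0// cos_max.
have [_ ->] := @Rintegral_fubini _ _ _ _ R P mu setT setT
  (fun w th => cos (th * (y - x - Z w)) * gauss (e c) th) (cst 1) (gauss (e c))
  measurableT measurableT mcg (finite_measure_integrable_cst P 1 measurableT)
  ig bcg.
have -> : \int[mu]_th \int[P]_w (cos (th * (y - x - Z w)) * gauss (e c) th) =
  \int[mu]_th (cos (th * (y - x)) * cf t th * gauss (e c) th).
  apply: eq_Rintegral => th _; rewrite RintegralZr//.
    by rewrite expectation_cos.
  apply: (@integrable_finite _ _ R P setT _ 1) => //.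
    apply: measurableT_comp.
      exact: continuous_measurable_fun (@continuous_cos R).
    by apply: measurable_funM => //; exact: measurable_funB.
  by move=> w _; exact: cos_max.
rewrite mulrA; congr (_ * _).
have e1 : gaussZ (e c) = 2 / c * gaussZ (1 : R).
  have [_ ->] := @integrable_gauss R 1 ltr01.
  rewrite gE /e sqrtr_sqr ger0_norm ?sqrtr1; last by rewrite divr_ge0// ltW.
  by field; rewrite gt_eqF.
have : gaussZ 1 * gaussZ 1 = pi :> R.
  have [_ ->] := @integrable_gauss R 1 ltr01.
  by rewrite sqrtr1 divr1 -expr2 sqr_sqrtr// pi_ge0.
have g1 := @gaussZ_gt0 R 1 ltr01; have p0 := @pi_gt0 R.
rewrite e1 => <-; field.
by rewrite !gt_eqF.
Qed.

Let cseq n : R := n.+1%:R^-1.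

Let cseq0 n : 0 < cseq n. Proof. by rewrite invr_gt0. Qed.

Let cvg_cseq : cseq n @[n --> \oo] --> (0 : R).
Proof. exact: (@cvg_harmonic R). Qed.

(** The averages concentrate at y when the scale tends to 0. *)
Let cvg_average (k : R -> R) C y : continuous k -> (forall u, `|k u| <= C) ->
  \int[mu]_v (gauss 1 v * k (cseq n * v + y)) @[n --> \oo] --> gaussZ 1 * k y.
Proof.
move=> ck kC; have [ig gE] := @integrable_gauss R 1 ltr01.
rewrite (_ : gaussZ 1 * k y = \int[mu]_v (gauss 1 v * k y)); last first.
  by rewrite RintegralZr.
apply: (@Rintegral_dct _ _ R mu setT (fun n v => gauss 1 v * k (cseq n * v + y))
  _ (fun v => C * gauss 1 v)) => //.
- move=> n; apply: measurable_funM; first exact: measurable_gauss.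
  apply: measurableT_comp; first exact: continuous_measurable_fun.
  by apply: measurable_funD => //; exact: measurable_funM.
- move=> v _; apply: cvgMl_tmp; apply: cvg_seq_continuous; first exact: ck.
  have h : cseq n * v + y @[n --> \oo] --> (0 * v + y : R).
    by apply: cvgD; [exact: cvgMr_tmp cvg_cseq|exact: cvg_cst].
  by rewrite mul0r add0r in h.
- exact: (integrableZl measurableT C ig).
- move=> n v _; rewrite normrM (ger0_norm (gauss_ge0 _ _)) mulrC.
  by rewrite ler_wpM2r ?gauss_ge0.
Qed.

Let cvg_fourier y :
  gaussZ 1 * (2 * pi)^-1 *
    \int[mu]_th (cos (th * (y - x)) * cf t th * gauss (e (cseq n)) th)
  @[n --> \oo] --> gaussZ 1 * stable_pdf t (y - x).
Proof.
rewrite /stable_pdf [X in _ --> X]mulrA; apply: cvgMl_tmp.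
apply: (@Rintegral_dct _ _ R mu setT
  (fun n th => cos (th * (y - x)) * cf t th * gauss (e (cseq n)) th) _
  (fun th => 1 * cf t th)) => //.
- move=> n; apply: measurable_funM; last exact: measurable_gauss.
  apply: measurable_funM; [exact: measurable_cosMl|exact: measurable_stable_cf].
- move=> th _; rewrite -[X in _ --> X]mulr1; apply: cvgMl_tmp.
  have h : e (cseq n) @[n --> \oo] --> ((0 / 2) ^+ 2 : R).
    apply: (@cvg_seq_continuous _ (fun z => (z / 2) ^+ 2)) => //.
    apply: (@continuous_comp _ _ _ (fun z : R => z / 2) (fun z => z ^+ 2)).
      exact: mulrr_continuous.
    exact: exprn_continuous.
  rewrite mul0r expr0n/= in h.
  have h2 := cvg_seq_continuous (h := fun z => expR (- (z * th ^+ 2))) _ h.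
  rewrite mul0r oppr0 expR0 in h2; apply: h2.
  apply: (@continuous_comp _ _ _ (fun z : R => - (z * th ^+ 2)) (@expR R)).
    by move=> z; apply: cvgN; exact: mulrr_continuous.
  exact: continuous_expR.
- apply: (@integrable_stable_cf R alpha halpha t _ 1) => //.
  by move=> z; rewrite normr1 mul1r lerDl sqr_ge0.
- move=> n th _; rewrite mul1r !normrM (ger0_norm (stable_cf_ge0 _ _ _)).
  rewrite (ger0_norm (gauss_ge0 _ _)) -mulrA.
  apply: (@le_trans _ _ (cf t th * gauss (e (cseq n)) th)).
    apply: ler_piMl; last exact: cos_max.
    by apply: mulr_ge0; [exact: stable_cf_ge0|exact: gauss_ge0].
  apply: ler_piMr; first exact: stable_cf_ge0.
  by apply: gauss_le1; apply: ltW; exact: e_gt0.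
Qed.

(** Fourier inversion with Gaussian averages of vanishing scale.  The averages
    converge to f as soon as f is bounded; truncating f first gives
    f <= stable_pdf, hence boundedness. *)
Lemma density_stable_pdf y : f y = stable_pdf t (y - x).
Proof.
have g1 := @gaussZ_gt0 R 1 ltr01.
(* truncation at a level above the limit *)
have f_le z : f z <= stable_pdf t (z - x).
  have H (M : R) : 0 <= M -> Num.min (f z) M <= stable_pdf t (z - x).
    move=> M0; pose k u := Num.min (f u) M.
    have ck : continuous k.
      move=> u; apply: (@continuous_min _ _ f (cst M)); first exact: cont_f.
      exact: cvg_cst.
    have kM u : `|k u| <= M.
      by rewrite ger0_norm /k ?le_min ?f0// ge_min lexx orbT.
    rewrite -(ler_pM2l g1).
    have L := ler_cvg_to (@cvg_average k M z ck kM) (@cvg_fourier z).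
    apply: L; apply: nearW => n; have [i1 <-] := smoothing z (cseq0 n).
    have mav : measurable_fun setT (fun v => cseq n * v + z).
      by apply: measurable_funD => //; exact: measurable_funM.
    apply: le_Rintegral => //.
      apply: (@integrable_dom _ _ R mu setT _ (fun v => M * gauss 1 v)) => //.
      - apply: measurable_funM; first exact: measurable_gauss.
        by apply: measurableT_comp mav => //; exact: continuous_measurable_fun.
      - have [ig _] := @integrable_gauss R 1 ltr01.
        exact: (integrableZl measurableT M ig).
      - move=> v _; rewrite normrM (ger0_norm (gauss_ge0 _ _)) mulrC.
        by rewrite ler_wpM2r ?gauss_ge0.
    by move=> v _; rewrite ler_wpM2l ?gauss_ge0// /k ge_min lexx.
  have := H (`|stable_pdf t (z - x)| + 1) (addr_ge0 (normr_ge0 _) ler01).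
  rewrite ge_min => /orP[//|]; have := ler_norm (stable_pdf t (z - x)).
  by move=> ? ?; lra.
have fC u : `|f u| <= (2 * pi)^-1 * \int[mu]_th (1 * cf t th).
  rewrite ger0_norm//; apply: le_trans (f_le u) _.
  rewrite /stable_pdf ler_wpM2l ?invr_ge0 ?mulr_ge0 ?pi_ge0//.
  apply: le_Rintegral => //.
  - exact: integrable_cos_cf.
  - apply: (@integrable_stable_cf R alpha halpha t _ 1) => //.
    by move=> z; rewrite normr1 mul1r lerDl sqr_ge0.
  - by move=> th _; rewrite ler_wpM2r ?stable_cf_ge0// cos_le1.
apply: (mulfI (lt0r_neq0 g1)).
have h := @cvg_fourier y.
rewrite (_ : (fun n => _) = (fun n =>
    \int[mu]_v (gauss 1 v * f (cseq n * v + y)))) in h; last first.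
  by apply/funext => n; have [_ ->] := smoothing y (cseq0 n).
exact: (cvg_unique _ (@cvg_average f _ y cont_f fC) h).
Qed.

End inversion.

End stable_density.

(** * The radial kernel *)

Section exp_mix_integral.
Context d (T : measurableType d) (R : realType).
Variables (mu : {measure set T -> \bar R}) (lam : T -> R).
Hypotheses (mlam : measurable_fun setT lam) (lam0 : forall x, 0 <= lam x).

Lemma exp_mix_measurable (f : R -> R) : exp_mix f ->
  measurable_fun setT (fun x => f (lam x)).
Proof.
elim=> {f} [s s0||s f g s0 _ mf _ mg|f_ f C _ mf_ fC f_f].
- apply: measurableT_comp => //; apply: measurableT_comp => //.
  exact: measurable_funM.
- exact: measurable_cst.
- by apply: measurable_funD => //; exact: measurable_funM.
- apply/measurable_EFinP.
  apply: (emeasurable_fun_cvg (fun n x => (f_ n (lam x))%:E)) => //.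
  + by move=> n; exact/measurable_EFinP.
  + by move=> x _; apply/cvg_EFin; [exact: nearW|exact: f_f].
Qed.

Lemma exp_mix_integrable (w : T -> R) (f : R -> R) :
  mu.-integrable setT (EFin \o w) -> exp_mix f ->
  mu.-integrable setT (EFin \o (fun x => w x * f (lam x))).
Proof.
move=> iw mf; have [C fC] := exp_mix_bounded mf.
apply: (@integrable_dom _ _ _ _ _ _ (fun x => C * `|w x|)) => //.
- apply: measurable_funM; first exact/measurable_EFinP/(measurable_int _ iw).
  exact: exp_mix_measurable.
- exact: (integrableZl measurableT C (integrable_norm iw)).
- by move=> x _; rewrite normrM mulrC ler_wpM2r// fC.
Qed.

Lemma exp_mix_integral_lim (w : T -> R) (f_ : nat -> R -> R) f C :
  mu.-integrable setT (EFin \o w) -> (forall n, exp_mix (f_ n)) ->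
  (forall n l, 0 <= l -> `|f_ n l| <= C) ->
  (forall l, 0 <= l -> f_ n l @[n --> \oo] --> f l) ->
  \int[mu]_x (w x * f_ n (lam x)) @[n --> \oo] --> \int[mu]_x (w x * f (lam x)).
Proof.
move=> iw mf_ fC f_f.
apply: (@Rintegral_dct _ _ R mu setT (fun n x => w x * f_ n (lam x)) _
  (fun x => C * `|w x|)) => //.
- move=> n; apply: measurable_funM; first exact/measurable_EFinP/(measurable_int _ iw).
  exact: exp_mix_measurable.
- by move=> x _; apply: cvgMl_tmp; exact: f_f.
- exact: (integrableZl measurableT C (integrable_norm iw)).
- by move=> n x _; rewrite normrM mulrC ler_wpM2r// fC.
Qed.

(** Positivity against exponentials suffices; the limits are dominated by the
    integrable weight w. *)
Lemma exp_mix_integral_ge0 (w : T -> R) (f : R -> R) :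
  mu.-integrable setT (EFin \o w) ->
  (forall s, 0 <= s -> 0 <= \int[mu]_x (w x * expR (- (s * lam x)))) ->
  exp_mix f -> 0 <= \int[mu]_x (w x * f (lam x)).
Proof.
move=> iw H; elim=> {f} [s s0||s f g s0 mf Hf mg Hg|f_ f C mf_ Hf fC f_f].
- exact: H.
- by under eq_Rintegral do rewrite mulr0; rewrite /Rintegral integral0.
- under eq_Rintegral do rewrite mulrDr mulrCA.
  rewrite RintegralD//; last 2 first.
  + exact: (integrableZl measurableT s (exp_mix_integrable iw mf)).
  + exact: exp_mix_integrable.
  by rewrite RintegralZl ?addr_ge0 ?mulr_ge0//; exact: exp_mix_integrable.
- have h := exp_mix_integral_lim iw mf_ fC f_f.
  by apply: (ler_cvg_to (cvg_cst 0) h); apply: nearW.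
Qed.

End exp_mix_integral.

(** Compares an integral over R^3 with its radial form: both are explicit for
    exponentials, and the weights dominate the limits. *)
Lemma exp_mix_integral_eq d1 d2 (T1 : measurableType d1) (T2 : measurableType d2)
    (R : realType) (mu1 : {measure set T1 -> \bar R})
    (mu2 : {measure set T2 -> \bar R}) (lam1 w1 : T1 -> R) (lam2 w2 : T2 -> R) f :
  measurable_fun setT lam1 -> measurable_fun setT lam2 ->
  (forall x, 0 <= lam1 x) -> (forall x, 0 <= lam2 x) ->
  mu1.-integrable setT (EFin \o w1) -> mu2.-integrable setT (EFin \o w2) ->
  (forall s, 0 <= s -> \int[mu1]_x (w1 x * expR (- (s * lam1 x))) =
                      \int[mu2]_x (w2 x * expR (- (s * lam2 x)))) ->
  exp_mix f ->
  \int[mu1]_x (w1 x * f (lam1 x)) = \int[mu2]_x (w2 x * f (lam2 x)).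
Proof.
move=> m1 m2 l1 l2 i1 i2 H.
elim=> {f} [s s0||s f g s0 mf Hf mg Hg|f_ f C mf_ Hf fC f_f].
- exact: H.
- under eq_Rintegral do rewrite mulr0.
  by under [RHS]eq_Rintegral do rewrite mulr0; rewrite /Rintegral !integral0.
- under eq_Rintegral do rewrite mulrDr mulrCA.
  under [RHS]eq_Rintegral do rewrite mulrDr mulrCA.
  rewrite !RintegralD//; last 4 first.
  + exact: (integrableZl measurableT s (exp_mix_integrable m2 l2 i2 mf)).
  + exact: exp_mix_integrable.
  + exact: (integrableZl measurableT s (exp_mix_integrable m1 l1 i1 mf)).
  + exact: exp_mix_integrable.
  rewrite !RintegralZl//; last 2 first.
  + exact: exp_mix_integrable.
  + exact: exp_mix_integrable.
  by rewrite Hf Hg.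
- have h1 := exp_mix_integral_lim m1 l1 i1 mf_ fC f_f.
  have h2 := exp_mix_integral_lim m2 l2 i2 mf_ fC f_f.
  rewrite (_ : (fun n => _) = (fun n => \int[mu1]_x (w1 x * f_ n (lam1 x)))) in h2.
    exact: (cvg_unique _ h1 h2).
  by apply/funext => n; rewrite Hf.
Qed.

Section halfline.
Variable R : realType.
Local Notation mu := (@lebesgue_measure R).

Lemma integral_halfline_sym (g : R -> R) :
  mu.-integrable setT (EFin \o g) ->
  \int[mu]_(y in `[0, +oo[) (g y + g (- y)) = \int[mu]_y g y.
Proof.
move=> ig; have [igN _] := integral_reflect ig.
have sub (A : set R) : measurable A -> mu.-integrable A (EFin \o g).
  by move=> mA; apply: (integrableS measurableT) => //.
rewrite RintegralD//; last 2 first.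
- exact: sub.
- exact: (integrableS measurableT _ _ igN).
have -> : \int[mu]_(y in `[0, +oo[) g (- y) = \int[mu]_(y in `]-oo, 0[) g y.
  rewrite Rintegral_itv_bndo_bndc; last exact: sub.
  rewrite Rintegral_mkcond [RHS]Rintegral_mkcond.
  have i0 : mu.-integrable setT (EFin \o (g \_ `]-oo, 0])).
    rewrite -restrict_EFin; apply: (integrable_mkcond _ _).1 => //; exact: sub.
  have [_ ->] := integral_reflect i0; apply: eq_Rintegral => y _.
  rewrite !patchE; congr (if _ then _ else _).
  by apply/idP/idP; rewrite !inE /= !in_itv/= andbT oppr_le0.
rewrite addrC -Rintegral_setU//.
- congr Rintegral; apply/seteqP; split => // y _ /=.
  by rewrite !in_itv/= andbT; have [|] := ltP y 0; [left|right].
- rewrite (_ : _ `|` _ = setT)//.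
  apply/seteqP; split => // y _ /=.
  by rewrite !in_itv/= andbT; have [|] := ltP y 0; [left|right].
- apply/disj_setPS => y [] /=; rewrite !in_itv/= andbT => y0.
  by rewrite leNgt y0.
Qed.

Lemma integral_halfline_even (g : R -> R) : (forall y, g (- y) = g y) ->
  mu.-integrable setT (EFin \o g) ->
  \int[mu]_(y in `[0, +oo[) g y = 2^-1 * \int[mu]_y g y.
Proof.
move=> gN ig; rewrite -integral_halfline_sym//.
have i0 : mu.-integrable `[0, +oo[ (EFin \o g).
  exact: (integrableS measurableT _ _ ig).
under [in RHS]eq_Rintegral do rewrite gN -mulr2n -mulr_natl.
by rewrite RintegralZl// mulKf.
Qed.

End halfline.

Section radial_kernel.
Variables (R : realType) (alpha : R).
Hypothesis halpha : 0 < alpha < 2.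
Local Notation mu := (@lebesgue_measure R).
Local Notation cf := (stable_cf alpha).
Local Notation pdf := (stable_pdf alpha).
Local Notation halfline := (`[0%R, +oo[%classic : set R).

(** The radial Fourier representation of the kernel: sinc (th * |.|) is the
    average over the unit sphere of R^3 of the characters of frequency th. *)
Definition radial_kernel (t x y : R) : R :=
  pi^-1 * (y ^+ 2 * \int[mu]_th (th ^+ 2 * (sinc (th * x) * sinc (th * y)) * cf t th)).

Lemma stable_pdfN t v : pdf t (- v) = pdf t v.
Proof.
by rewrite /stable_pdf; congr (_ * _); apply: eq_Rintegral => th _; rewrite mulrN cosN.
Qed.

Lemma measurable_sincM (v : R) : measurable_fun setT (fun th : R => sinc (th * v)).
Proof.
apply: measurableT_comp; last exact: measurable_funM.
exact: continuous_measurable_fun (@continuous_sinc R).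
Qed.

Lemma sinc2_le1 (u v : R) : `|sinc u * sinc v| <= 1.
Proof. by rewrite normrM mulr_ile1// sinc_le1. Qed.

Lemma integrable_radial t x y : 0 < t -> mu.-integrable setT
  (EFin \o (fun th => th ^+ 2 * (sinc (th * x) * sinc (th * y)) * cf t th)).
Proof.
move=> t0; apply: (@integrable_stable_cf R alpha halpha t _ 1) => //.
  by apply: measurable_funM => //; apply: measurable_funM; exact: measurable_sincM.
move=> th; rewrite mul1r normrM ger0_norm ?sqr_ge0//.
apply: (@le_trans _ _ (th ^+ 2)); last by rewrite lerDr.
by rewrite ler_piMr ?sqr_ge0// sinc2_le1.
Qed.

Lemma integrable_sqr_cf t : 0 < t ->
  mu.-integrable setT (EFin \o (fun th => th ^+ 2 * cf t th)).
Proof.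
move=> t0; apply: (@integrable_stable_cf R alpha halpha t _ 1) => //.
by move=> th; rewrite mul1r ger0_norm ?sqr_ge0// lerDr.
Qed.

(** cos (a - b) - cos (a + b) = 2 sin a sin b, and y / x cancels the
    denominators of the sinc functions. *)
Lemma radial_kernelE t x y : 0 < t -> x != 0 ->
  y / x * (pdf t (y - x) - pdf t (y + x)) = radial_kernel t x y.
Proof.
move=> t0 x0; rewrite /stable_pdf -mulrBr -RintegralB//; last 2 first.
- exact: integrable_cos_cf.
- exact: integrable_cos_cf.
have -> : \int[mu]_th (cos (th * (y - x)) * cf t th - cos (th * (y + x)) * cf t th)
   = 2 * x * y * \int[mu]_th (th ^+ 2 * (sinc (th * x) * sinc (th * y)) * cf t th).
  rewrite -RintegralZl//; last exact: integrable_radial.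
  apply: eq_Rintegral => th _; rewrite -mulrBl mulrBr mulrDr cosB cosD.
  by rewrite -(mul_sinc (th * x)) -(mul_sinc (th * y)); ring.
rewrite /radial_kernel; have := @pi_gt0 R; move: (@pi R) => p p0; field.
by rewrite x0 (gt_eqF p0).
Qed.

Let radial_integrand_le t th u v :
  `|th ^+ 2 * (sinc u * sinc v) * cf t th| <= th ^+ 2 * cf t th.
Proof.
rewrite normrM (ger0_norm (stable_cf_ge0 _ _ _)) ler_wpM2r ?stable_cf_ge0//.
by rewrite normrM ger0_norm ?sqr_ge0// ler_piMr ?sqr_ge0// sinc2_le1.
Qed.

Lemma radial_kernel_bound t : 0 < t -> exists C, forall x y,
  `|radial_kernel t x y| <= C * y ^+ 2.
Proof.
move=> t0; exists (pi^-1 * \int[mu]_th (th ^+ 2 * cf t th)) => x y.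
have p0 := @pi_gt0 R.
have pi0 : 0 <= (@pi R)^-1 by rewrite invr_ge0 ltW.
rewrite /radial_kernel normrM (ger0_norm pi0) -[leRHS]mulrA ler_wpM2l//.
rewrite normrM ger0_norm ?sqr_ge0// mulrC ler_wpM2r ?sqr_ge0//.
apply: le_trans (le_normr_Rintegral _ (integrable_radial x y t0)) _ => //.
apply: le_Rintegral => //.
- exact: integrable_norm (integrable_radial x y t0).
- exact: integrable_sqr_cf.
Qed.

Let cvg_radial_integral t (u : nat -> R) x y : 0 < t -> u n @[n --> \oo] --> x ->
  \int[mu]_th (th ^+ 2 * (sinc (th * u n) * sinc (th * y)) * cf t th) @[n --> \oo] -->
  \int[mu]_th (th ^+ 2 * (sinc (th * x) * sinc (th * y)) * cf t th).
Proof.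
move=> t0 ux; apply: (@Rintegral_dct _ _ R mu setT (fun n th =>
  th ^+ 2 * (sinc (th * u n) * sinc (th * y)) * cf t th) _
  (fun th => th ^+ 2 * cf t th)) => //.
- move=> n; apply: measurable_funM; last exact: measurable_stable_cf.
  by apply: measurable_funM => //; apply: measurable_funM; exact: measurable_sincM.
- move=> th _; apply: cvgMr_tmp; apply: cvgMl_tmp; apply: cvgMr_tmp.
  apply: cvg_seq_continuous; first exact: continuous_sinc.
  exact: cvgMl_tmp.
- exact: integrable_sqr_cf.
Qed.

Lemma cvg_radial_kernel t (u : nat -> R) x y : 0 < t -> u n @[n --> \oo] --> x ->
  radial_kernel t (u n) y @[n --> \oo] --> radial_kernel t x y.
Proof. by move=> t0 ux; do 2 apply: cvgMl_tmp; exact: cvg_radial_integral. Qed.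

Lemma radial_kernelNr t x y : radial_kernel t x (- y) = radial_kernel t x y.
Proof.
rewrite /radial_kernel sqrrN; congr (_ * (_ * _)).
by apply: eq_Rintegral => th _; rewrite mulrN sincN.
Qed.

Lemma continuous_radial_kernel_r t x : 0 < t -> continuous (radial_kernel t x).
Proof.
move=> t0 y; apply/(@cvg_nbhsP _ R^o) => u uy.
rewrite /radial_kernel; apply: cvgMl_tmp; apply: cvgM.
  by apply: (@cvg_seq_continuous _ (fun z => z ^+ 2)) => //; exact: exprn_continuous.
have E z : \int[mu]_th (th ^+ 2 * (sinc (th * x) * sinc (th * z)) * cf t th) =
  \int[mu]_th (th ^+ 2 * (sinc (th * z) * sinc (th * x)) * cf t th).
  by apply: eq_Rintegral => th _; rewrite (mulrC (sinc (th * x))).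
rewrite E; under eq_fun do rewrite E.
exact: cvg_radial_integral.
Qed.

Lemma measurable_radial_kernel t x : 0 < t ->
  measurable_fun setT (radial_kernel t x).
Proof. by move=> t0; apply: continuous_measurable_fun; exact: continuous_radial_kernel_r. Qed.

(** Symmetric unimodality: the Fourier weight cos (th a) - cos (th b) is
    nonnegative against every Gaussian in th, hence against the mixture
    exp(- t |th|^alpha). *)
Lemma stable_pdf_unimodal t a b : 0 < t -> a ^+ 2 <= b ^+ 2 -> pdf t b <= pdf t a.
Proof.
move=> t0 ab; have p0 := @pi_gt0 R.
rewrite /stable_pdf ler_pM2l ?invr_gt0 ?mulr_gt0// -subr_ge0.
rewrite -RintegralB//; [|exact: integrable_cos_cf|exact: integrable_cos_cf].
(* a Gaussian factor makes the weight integrable on its own *)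
pose e n : R := n.+1%:R^-1.
have e0 n : 0 < e n by rewrite invr_gt0.
pose w n th := (cos (a * th) - cos (b * th)) * gauss (e n) th.
have iw n : mu.-integrable setT (EFin \o w n).
  have ia := integrable_cos_gauss a (e0 n); have ib := integrable_cos_gauss b (e0 n).
  rewrite (_ : w n = fun th => cos (a * th) * gauss (e n) th - cos (b * th) * gauss (e n) th).
    exact: (integrableB measurableT ia ib).
  by apply/funext => th; rewrite /w mulrBl.
have L : \int[mu]_th (w n th * cf t th) @[n --> \oo] -->
    \int[mu]_th (cos (th * a) * cf t th - cos (th * b) * cf t th).
  apply: (@Rintegral_dct _ _ R mu setT (fun n th => w n th * cf t th) _
    (fun th => 2 * cf t th)) => //.
  - move=> n; apply: measurable_funM; last exact: measurable_stable_cf.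
    by have := measurable_int _ (iw n); move/measurable_EFinP.
  - move=> th _; rewrite -mulrBl (mulrC th) (mulrC th b); apply: cvgMr_tmp.
    rewrite -[X in _ --> X]mulr1; apply: cvgMl_tmp.
    have h : - (e n * th ^+ 2) @[n --> \oo] --> (- (0 * th ^+ 2) : R).
      by apply: cvgN; apply: cvgMr_tmp; exact: (@cvg_harmonic R).
    have := cvg_seq_continuous (@continuous_expR R _) h.
    by rewrite mul0r oppr0 expR0.
  - apply: (@integrable_stable_cf R alpha halpha t _ 2) => //.
    by move=> th; rewrite ger0_norm// ler_peMr// lerDl sqr_ge0.
  - move=> n th _; rewrite !normrM (ger0_norm (stable_cf_ge0 _ _ _)).
    rewrite ler_wpM2r ?stable_cf_ge0// (ger0_norm (gauss_ge0 _ _)).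
    rewrite -[leRHS]mulr1; apply: ler_pM => //; first exact: gauss_ge0.
      rewrite (le_trans (ler_normB _ _))// -[leRHS]/(1 + 1).
      by rewrite lerD// cos_max.
    by apply: gauss_le1; exact: ltW.
apply: (ler_cvg_to (cvg_cst 0) L); apply: nearW => n.
apply: (@exp_mix_integral_ge0 _ _ R mu (fun th => th ^+ 2) _ _ (w n) _ (iw n) _
   (stable_cf_exp_mix halpha (ltW t0))) => //.
  by move=> th; exact: sqr_ge0.
move=> s s0; have es0 : 0 < e n + s by rewrite ltr_pwDl.
have ia := integrable_cos_gauss a es0; have ib := integrable_cos_gauss b es0.
have -> : \int[mu]_th (w n th * expR (- (s * th ^+ 2))) =
   fourier_gauss (e n + s) a - fourier_gauss (e n + s) b.
  rewrite -RintegralB//; apply: eq_Rintegral => th _.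
  by rewrite -/(gauss s th) /w -mulrA -gaussD mulrBl.
rewrite !fourier_gaussE// -mulrBr mulr_ge0 ?(ltW (gaussZ_gt0 _))//.
rewrite subr_ge0 ler_expR lerN2 ler_wpM2l// invr_ge0 mulr_ge0// ltW//.
Qed.

(** |y - x| <= y + x, so unimodality gives the sign of the reflected
    difference. *)
Lemma radial_kernel_ge0 t x y : 0 < t -> 0 <= x -> 0 <= y ->
  0 <= radial_kernel t x y.
Proof.
move=> t0 + y0; have pos z : 0 < z -> 0 <= radial_kernel t z y.
  move=> z0; rewrite -radial_kernelE ?gt_eqF//.
  rewrite mulr_ge0 ?divr_ge0 ?(ltW z0)// subr_ge0.
  apply: stable_pdf_unimodal => //; nra.
rewrite le_eqVlt => /predU1P[<-|]; last exact: pos.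
have h := @cvg_radial_kernel t (fun n => n.+1%:R^-1) 0 y t0 (@cvg_harmonic R).
apply: (ler_cvg_to (cvg_cst 0) h); apply: nearW => n.
by apply: pos; rewrite invr_gt0.
Qed.

Lemma measurable_radial2 x (f : R -> R) : measurable_fun setT f ->
  measurable_fun setT (fun z : R * R =>
    f z.1 * (z.2 ^+ 2 * (sinc (z.2 * x) * sinc (z.2 * z.1)))).
Proof.
move=> mf; apply: measurable_funM; first exact: measurableT_comp.
apply: measurable_funM; first exact: (measurable_funX 2).
apply: measurable_funM; apply: measurableT_comp.
- exact: continuous_measurable_fun (@continuous_sinc R).
- exact: measurable_funM.
- exact: continuous_measurable_fun (@continuous_sinc R).
- exact: measurable_funM.
Qed.

(** The law of |th| when exp(- s |v|^2) is written as a superposition of the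
    characters of R^3, extended evenly to the line. *)
Definition gauss_spectral (s th : R) : R :=
  gaussZ s / (4 * pi * s) * (th ^+ 2 * gauss (4 * s)^-1 th).

Lemma gauss_spectral_ge0 s th : 0 < s -> 0 <= gauss_spectral s th.
Proof.
move=> s0; have p0 := @pi_gt0 R; apply: mulr_ge0; last first.
  by apply: mulr_ge0; [exact: sqr_ge0|exact: gauss_ge0].
apply: divr_ge0; first exact/ltW/gaussZ_gt0.
by apply: mulr_ge0; [exact: mulr_ge0 _ (ltW p0)|exact: ltW].
Qed.

Lemma integrable_gauss_spectral s : 0 < s ->
  mu.-integrable setT (EFin \o gauss_spectral s).
Proof.
move=> s0; have si : 0 < (4 * s)^-1 by rewrite invr_gt0 mulr_gt0.
have i2 : mu.-integrable setT (EFin \o (fun x => x ^+ 2 * gauss (4 * s)^-1 x)).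
  apply: (@integrable_poly_gauss R _ 1) => //.
  by move=> x; rewrite mul1r ger0_norm ?sqr_ge0// lerDr.
exact: (integrableZl measurableT _ i2).
Qed.

Lemma integrable_sinc_gauss a x : 0 < a -> mu.-integrable setT
  (EFin \o (fun y => y ^+ 2 * sinc (y * x) * gauss a y)).
Proof.
move=> a0; apply: (@integrable_poly_gauss R _ 1) => //.
  by apply: measurable_funM => //; exact: measurable_sincM.
move=> y; rewrite mul1r normrM ger0_norm ?sqr_ge0//.
apply: (@le_trans _ _ (y ^+ 2)); last by rewrite lerDr.
by rewrite ler_piMr ?sqr_ge0// sinc_le1.
Qed.

(** Multiplying by a further Gaussian only changes the variance, so that all
    mixtures reduce to this case. *)
Lemma gauss_spectral_mix s u x : 0 < s -> 0 <= u ->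
  \int[mu]_th (gauss_spectral s th * sinc (th * x) * gauss u th) =
  gaussZ s / (4 * pi * s) * (gaussZ ((4 * s)^-1 + u) / (2 * ((4 * s)^-1 + u)))
   * gauss (4 * ((4 * s)^-1 + u))^-1 x.
Proof.
move=> s0 u0; have a0 : 0 < (4 * s)^-1 + u by rewrite ltr_pwDl// invr_gt0 mulr_gt0.
rewrite -mulrA -fourier_gauss_sinc// -(RintegralZl _ measurableT (integrable_sinc_gauss x a0)).
by apply: eq_Rintegral => th _; rewrite /gauss_spectral gaussD; ring.
Qed.

Lemma gauss_spectral_inv s x : 0 < s ->
  \int[mu]_th (gauss_spectral s th * sinc (th * x)) = gauss s x.
Proof.
move=> s0; have := @gauss_spectral_mix s 0 x s0 (lexx 0).
under eq_Rintegral do rewrite /gauss mul0r oppr0 expR0 mulr1.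
move=> ->; rewrite addr0.
have -> : (4 * (4 * s)^-1)^-1 = s by field; rewrite gt_eqF.
have := gaussZ_dual s0 => E; have p0 := @pi_gt0 R.
have -> : gaussZ (4 * s)^-1 = 2 * pi / gaussZ s.
  by rewrite -E mulrAC divff ?mul1r// gt_eqF// gaussZ_gt0.
have g0 := gaussZ_gt0 s0; move: (@pi R) p0 => p p0.
by field; rewrite !gt_eqF.
Qed.

Lemma gauss_spectral1 s : 0 < s -> \int[mu]_th gauss_spectral s th = 1.
Proof.
move=> s0; rewrite -(gauss0 s) -gauss_spectral_inv//.
by apply: eq_Rintegral => th _; rewrite mulr0 sinc0 mulr1.
Qed.

Lemma integrable_gauss_spectral_cf s t x : 0 < s -> 0 <= t ->
  mu.-integrable setT
    (EFin \o (fun th => gauss_spectral s th * sinc (th * x) * cf t th)).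
Proof.
move=> s0 t0; apply: (@integrable_dom _ _ R mu setT _ (gauss_spectral s)) => //.
- apply: measurable_funM; last exact: measurable_stable_cf.
  apply: measurable_funM; last exact: measurable_sincM.
  by have := measurable_int _ (integrable_gauss_spectral s0); move/measurable_EFinP.
- exact: integrable_gauss_spectral.
- move=> th _; rewrite 2!normrM (ger0_norm (gauss_spectral_ge0 _ s0)) -mulrA.
  rewrite ler_piMr ?gauss_spectral_ge0// mulr_ile1// ?sinc_le1//.
  by rewrite ger0_norm ?stable_cf_ge0// stable_cf_le1.
Qed.

(** Fubini: the y-integral is the radial Fourier transform of a Gaussian. *)
Lemma integral_gauss_radial_kernel s t x : 0 < s -> 0 < t ->
  mu.-integrable setT (EFin \o (fun y => gauss s y * radial_kernel t x y)) /\
  \int[mu]_(y in halfline) (gauss s y * radial_kernel t x y) =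
  \int[mu]_th (gauss_spectral s th * sinc (th * x) * cf t th).
Proof.
move=> s0 t0; have p0 := @pi_gt0 R.
have [C KC] := radial_kernel_bound t0.
have iK : mu.-integrable setT (EFin \o (fun y => gauss s y * radial_kernel t x y)).
  under eq_fun do rewrite mulrC.
  apply: (@integrable_poly_gauss R s `|C|) => //.
    exact: measurable_radial_kernel.
  move=> y; apply: le_trans (KC x y) _; apply: ler_pM => //.
  - by have := le_trans (normr_ge0 _) (KC x 1); rewrite expr1n mulr1.
  - exact: sqr_ge0.
  - exact: ler_norm.
  - by rewrite lerDr.
split => //; rewrite integral_halfline_even//; last first.
  by move=> y; rewrite gaussN radial_kernelNr.
have mG : measurable_fun setT (fun y : R => pi^-1 * (y ^+ 2 * gauss s y)).
  by apply: measurable_funM => //; apply: measurable_funM => //; exact: measurable_gauss.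
have i2 : mu.-integrable setT (EFin \o (fun y => y ^+ 2 * gauss s y)).
  apply: (@integrable_poly_gauss R _ 1) => //.
  by move=> y; rewrite mul1r ger0_norm ?sqr_ge0// lerDr.
have iG := integrableZl measurableT pi^-1 i2.
pose F (y th : R) := pi^-1 * (y ^+ 2 * gauss s y) *
  (th ^+ 2 * (sinc (th * x) * sinc (th * y))) * cf t th.
have mF : measurable_fun setT (fun z : R * R => F z.1 z.2).
  apply: measurable_funM; first exact: (measurable_radial2 x mG).
  by apply: measurableT_comp => //; exact: measurable_stable_cf.
have bF y th : setT y -> setT th -> `|F y th| <=
    pi^-1 * (y ^+ 2 * gauss s y) * (th ^+ 2 * cf t th).
  move=> _ _; rewrite /F normrM (ger0_norm (stable_cf_ge0 _ _ _)) normrM.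
  have g0 : 0 <= pi^-1 * (y ^+ 2 * gauss s y).
    by rewrite mulr_ge0 ?invr_ge0 ?(ltW p0)// mulr_ge0 ?gauss_ge0 ?sqr_ge0.
  rewrite (ger0_norm g0) -[leLHS]mulrA; apply: ler_wpM2l => //.
  rewrite ler_wpM2r ?stable_cf_ge0// normrM ger0_norm ?sqr_ge0//.
  by rewrite ler_piMr ?sqr_ge0// sinc2_le1.
have [_ E] := @Rintegral_fubini _ _ _ _ R mu mu setT setT F
  (fun y => pi^-1 * (y ^+ 2 * gauss s y)) (fun th => th ^+ 2 * cf t th)
  measurableT measurableT mF iG (integrable_sqr_cf t0) bF.
have -> : \int[mu]_y (gauss s y * radial_kernel t x y) =
   \int[mu]_y \int[mu]_th F y th.
  apply: eq_Rintegral => y _; rewrite /F /radial_kernel.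
  transitivity (pi^-1 * (y ^+ 2 * gauss s y) *
    \int[mu]_th (th ^+ 2 * (sinc (th * x) * sinc (th * y)) * cf t th)).
    by ring.
  have zl := RintegralZl (pi^-1 * (y ^+ 2 * gauss s y)) measurableT
    (integrable_radial x y t0).
  apply: (etrans (esym zl)).
  by apply: eq_Rintegral => th _; apply: mulrA.
rewrite E.
clear bF E mF iG mG iK.
have inner th : \int[mu]_y F y th =
    2 * (gauss_spectral s th * sinc (th * x) * cf t th).
  transitivity (\int[mu]_y (pi^-1 * (th ^+ 2 * sinc (th * x) * cf t th) *
     (y ^+ 2 * sinc (y * th) * gauss s y))).
    by apply: eq_Rintegral => y _; rewrite /F (mulrC y th); ring.
  rewrite (RintegralZl _ measurableT (integrable_sinc_gauss th s0)) fourier_gauss_sinc// /gauss_spectral.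
  move: (gaussZ s) (gauss _ _) (@pi R) p0 => A B p p0; field.
  by rewrite !gt_eqF.
under eq_Rintegral do rewrite inner.
by rewrite (RintegralZl 2 measurableT (integrable_gauss_spectral_cf x s0 (ltW t0))) mulrA mulVf ?mul1r.
Qed.

End radial_kernel.

Section radial_kernel_mass.
Variables (R : realType) (alpha : R).
Hypothesis halpha : 0 < alpha < 2.
Local Notation mu := (@lebesgue_measure R).
Local Notation cf := (stable_cf alpha).
Local Notation pdf := (stable_pdf alpha).
Local Notation radial_kernel := (radial_kernel alpha).
Local Notation halfline := (`[0%R, +oo[%classic : set R).

Lemma cvg_stable_cf0 (t th : R) (e : nat -> R) : (forall n, 0 < e n) ->
  e n @[n --> \oo] --> (0 : R) -> cf t (e n * th) @[n --> \oo] --> (1 : R).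
Proof.
move=> e0 ce; have /andP[a0 _] := halpha.
have b0 : 0 < alpha / 2 by rewrite divr_gt0.
have h : ((e n * th) ^+ 2) `^ (alpha / 2) @[n --> \oo] --> (0 : R).
  have [->|th0] := eqVneq th 0.
    by under eq_fun do rewrite mulr0 expr0n/= powR0 ?gt_eqF//; exact: cvg_cst.
  have /cvg_at_rightP := @powR_cvg0 R _ b0; apply; split.
    move=> n; rewrite exprn_even_gt0//= mulf_neq0// gt_eqF//.
  have h1 : e n * th @[n --> \oo] --> (0 * th : R) by exact: cvgMr_tmp.
  have := cvg_seq_continuous (h := fun z => z ^+ 2) (@exprn_continuous _ 2 _) h1.
  by rewrite mul0r expr0n.
have h2 : - (t * ((e n * th) ^+ 2) `^ (alpha / 2)) @[n --> \oo] --> (- (t * 0) : R).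
  by apply: cvgN; exact: cvgMl_tmp.
have := cvg_seq_continuous (@continuous_expR R _) h2.
by rewrite mulr0 oppr0 expR0.
Qed.

Lemma gauss_spectral_scale (e th : R) : 0 < e ->
  e * gauss_spectral (e ^+ 2) (e * th) = gauss_spectral 1 th.
Proof.
move=> e0; have e20 : 0 < e ^+ 2 by rewrite exprn_gt0.
rewrite /gauss_spectral; have [_ ->] := integrable_gauss e20.
have [_ ->] := @integrable_gauss R 1 ltr01.
rewrite sqrtr1 sqrtr_sqr (ger0_norm (ltW e0)).
have -> : gauss (4 * e ^+ 2)^-1 (e * th) = gauss (4 * 1 : R)^-1 th.
  by rewrite /gauss; congr expR; field; rewrite gt_eqF.
move: (Num.sqrt (@pi R)) => A; have := @pi_gt0 R; move: (@pi R) => p p0; field.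
by rewrite !gt_eqF.
Qed.

(** Rescaling the spectral variable by the width of the Gaussian moves the
    limit s -> 0 into the integrand, which tends to [gauss_spectral 1]. *)
Lemma cvg_gauss_radial_mass (t x : R) : 0 < t ->
  \int[mu]_(y in halfline) (gauss (n.+1%:R^-1 ^+ 2) y * radial_kernel t x y)
    @[n --> \oo] --> (1 : R).
Proof.
move=> t0; pose e n : R := n.+1%:R^-1.
have e0 n : 0 < e n by rewrite invr_gt0.
have e20 n : 0 < e n ^+ 2 by rewrite exprn_gt0.
have E n : \int[mu]_(y in halfline) (gauss (e n ^+ 2) y * radial_kernel t x y) =
    \int[mu]_th (gauss_spectral 1 th * (sinc (e n * th * x) * cf t (e n * th))).
  have [_ ->] := integral_gauss_radial_kernel halpha x (e20 n) t0.
  have isc := integrable_gauss_spectral_cf alpha x (e20 n) (ltW t0).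
  have [i0 ->] := integral_affine 0 (e0 n) isc.
  rewrite -(RintegralZl _ measurableT i0).
  apply: eq_Rintegral => th _; rewrite addr0.
  by rewrite -(gauss_spectral_scale th (e0 n)) !mulrA.
rewrite (funext E).
rewrite -[X in _ --> X](@gauss_spectral1 R 1)//.
apply: (@Rintegral_dct _ _ R mu setT (fun n th =>
  gauss_spectral 1 th * (sinc (e n * th * x) * cf t (e n * th))) _
  (gauss_spectral 1)) => //.
- move=> n; apply: measurable_funM.
    by have := measurable_int _ (@integrable_gauss_spectral R 1 ltr01); move/measurable_EFinP.
  apply: measurable_funM.
    apply: measurableT_comp.
      exact: continuous_measurable_fun (@continuous_sinc R).
    by apply: measurable_funM => //; exact: measurable_funM.
  apply: measurableT_comp; first exact: measurable_stable_cf.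
  exact: measurable_funM.
- move=> th _; rewrite -[X in _ --> X]mulr1; apply: cvgMl_tmp.
  rewrite -[X in _ --> X]mulr1; apply: cvgM; last first.
    by apply: cvg_stable_cf0 => //; exact: (@cvg_harmonic R).
  have h : e n * th * x @[n --> \oo] --> (0 * th * x : R).
    by do 2 apply: cvgMr_tmp; exact: (@cvg_harmonic R).
  have := cvg_seq_continuous (@continuous_sinc R _) h.
  by rewrite !mul0r sinc0.
- exact: integrable_gauss_spectral.
- move=> n th _; rewrite normrM (ger0_norm (gauss_spectral_ge0 _ ltr01)).
  rewrite ler_piMr ?gauss_spectral_ge0// normrM mulr_ile1// ?sinc_le1//.
  by rewrite ger0_norm ?stable_cf_ge0// stable_cf_le1// ltW.
Qed.

(** Monotone convergence of the Gaussians exp(- s y^2) to 1. *)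
Lemma radial_kernel_mass (t x : R) : 0 < t -> 0 <= x ->
  (\int[mu]_(y in halfline) (radial_kernel t x y)%:E = 1)%E.
Proof.
move=> t0 x0.
pose s n : R := n.+1%:R^-1 ^+ 2.
have s0 n : 0 < s n by rewrite exprn_gt0// invr_gt0.
pose g n y := (gauss (s n) y * radial_kernel t x y)%:E.
have mK : measurable_fun halfline (radial_kernel t x).
  by apply: measurable_funTS; exact: measurable_radial_kernel.
have mg n : measurable_fun halfline (g n).
  apply/measurable_EFinP; apply: measurable_funM => //.
  by apply: measurable_funTS; exact: measurable_gauss.
have y0P y : halfline y -> 0 <= y by rewrite /= in_itv/= andbT.
have g0 n y : halfline y -> (0 <= g n y)%E.
  by move=> /y0P y0; rewrite lee_fin mulr_ge0 ?gauss_ge0// radial_kernel_ge0.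
have ndg y : halfline y -> {homo g ^~ y : m n / (m <= n)%N >-> (m <= n)%E}.
  move=> /y0P y0 m n mn; rewrite lee_fin ler_wpM2r ?radial_kernel_ge0//.
  rewrite ler_expR lerN2 ler_wpM2r ?sqr_ge0// lerXn2r ?nnegrE ?invr_ge0//.
  by rewrite lef_pV2 ?posrE// ler_nat ltnS.
have lg y : limn (g ^~ y) = (radial_kernel t x y)%:E.
  apply/cvg_lim => //; apply/cvg_EFin; first exact: nearW.
  rewrite -[X in _ --> X]mul1r; apply: cvgMr_tmp.
  have h1 : - (s n * y ^+ 2) @[n --> \oo] --> (- (0 ^+ 2 * y ^+ 2) : R).
    apply: cvgN; apply: cvgMr_tmp.
    apply: (@cvg_seq_continuous _ (fun z => z ^+ 2)); first exact: exprn_continuous.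
    exact: (@cvg_harmonic R).
  have := cvg_seq_continuous (@continuous_expR R _) h1.
  by rewrite expr0n/= mul0r oppr0 expR0.
transitivity (\int[mu]_(y in halfline) limn (g ^~ y))%E.
  by apply: eq_integral => y _; rewrite lg.
rewrite (monotone_convergence mu (measurable_itv `[0%R, +oo[) mg g0 ndg).
apply/cvg_lim => //.
have E n : (\int[mu]_(y in halfline) g n y)%E =
    (\int[mu]_(y in halfline) (gauss (s n) y * radial_kernel t x y))%:E.
  have [i1 _] := integral_gauss_radial_kernel halpha x (s0 n) t0.
  rewrite fineK//; apply: integrable_fin_num => //.
  exact: (integrableS measurableT _ _ i1).
rewrite (funext E); apply/cvg_EFin; first exact: nearW.
exact: cvg_gauss_radial_mass.
Qed.

Lemma integrable_radial_kernel (t x : R) : 0 < t -> 0 <= x ->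
  mu.-integrable halfline (EFin \o radial_kernel t x).
Proof.
move=> t0 x0; apply/integrableP; split.
  apply/measurable_EFinP; apply: measurable_funTS; exact: measurable_radial_kernel.
have -> : (\int[mu]_(y in halfline) `|(EFin \o radial_kernel t x) y| =
    \int[mu]_(y in halfline) (radial_kernel t x y)%:E)%E.
  apply: eq_integral => y; rewrite inE/= in_itv/= andbT => y0.
  by rewrite ger0_norm// radial_kernel_ge0.
by rewrite radial_kernel_mass// ltry.
Qed.

(** Folding the odd function sin (r y) onto the half-line turns the
    one-dimensional characteristic function into an eigenvalue equation. *)
Lemma radial_kernel_eigen (t x r : R) :
  mu.-integrable setT (EFin \o (fun y => pdf t (y - x))) ->
  \int[mu]_y (sin (r * y) * pdf t (y - x)) = sin (r * x) * cf t r ->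
  0 < t -> 0 < x ->
  \int[mu]_(y in halfline) (sinc (r * y) * radial_kernel t x y) =
  sinc (r * x) * cf t r.
Proof.
move=> ip E t0 x0; have [r0|r0] := eqVneq r 0.
  rewrite r0 mul0r sinc0 mul1r.
  rewrite (_ : cf t 0 = 1); last first.
    rewrite /stable_cf expr0n/= powR0 ?mulr0 ?oppr0 ?expR0//.
    by have /andP[a0 _] := halpha; rewrite gt_eqF// divr_gt0.
  under eq_Rintegral do rewrite mul0r sinc0 mul1r.
  by rewrite /Rintegral radial_kernel_mass// ltW.
have mp : measurable_fun setT (fun y : R => pdf t (y - x)).
  by have := measurable_int _ ip; move/measurable_EFinP.
have isp : mu.-integrable setT (EFin \o (fun y => sin (r * y) * pdf t (y - x))).
  apply: (@integrable_dom _ _ R mu setT _ (fun y => `|pdf t (y - x)|)) => //.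
  - apply: measurable_funM => //; apply: measurableT_comp; last exact: measurable_funM.
    exact: continuous_measurable_fun (@continuous_sin R).
  - exact: integrable_norm ip.
  - by move=> y _; rewrite normrM ler_piMl// sin_max.
have h := integral_halfline_sym isp; rewrite E in h.
have hz : mu.-integrable halfline (EFin \o (fun y => sin (r * y) * pdf t (y - x))).
  exact: (integrableS measurableT _ _ isp).
transitivity (\int[mu]_(y in halfline) ((r * x)^-1 *
   (sin (r * y) * pdf t (y - x) + sin (r * - y) * pdf t (- y - x)))).
  apply: eq_Rintegral => y _; rewrite -radial_kernelE ?gt_eqF//.
  have -> : - y - x = - (y + x) by ring.
  rewrite stable_pdfN mulrN sinN -(mul_sinc (r * y)).
  by field; rewrite r0 gt_eqF.
rewrite RintegralZl//; last first.
  have [ispN _] := integral_reflect isp.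
  have hzN : mu.-integrable halfline
      (EFin \o (fun y => sin (r * - y) * pdf t (- y - x))).
    exact: (integrableS measurableT _ _ ispN).
  exact: (integrableD _ hz hzN).
rewrite h -(mul_sinc (r * x)); field; rewrite r0 gt_eqF//.
Qed.

End radial_kernel_mass.

(** * Density of Gaussians among continuous functions vanishing at infinity *)

Section weierstrass.
Variable R : realType.

(** Expectation of phi under the binomial distribution (n, u), by one-step
    conditioning; [bernstein n u (fun k => h (k / n))] is the Bernstein
    polynomial of h. *)
Fixpoint bernstein (n : nat) (u : R) (phi : nat -> R) : R :=
  if n is n'.+1 then u * bernstein n' u (phi \o S) + (1 - u) * bernstein n' u phi
  else phi 0%N.

Lemma bernstein_norm n u phi psi : 0 <= u <= 1 ->
  (forall k, `|phi k| <= psi k) -> `|bernstein n u phi| <= bernstein n u psi.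
Proof.
move=> /andP[u0 u1]; elim: n phi psi => [|n IH] phi psi H /=; first exact: H.
rewrite (le_trans (ler_normD _ _))// !normrM ger0_norm// (@ger0_norm _ (1 - u)).
  by rewrite lerD// ler_wpM2l ?subr_ge0//; apply: IH => k /=; exact: H.
by rewrite subr_ge0.
Qed.

(** The variance of the binomial distribution, in a form stable under the
    recursion. *)
Lemma bernstein_affine n u a b c : bernstein n u (fun k => a * (k%:R - c) ^+ 2 + b)
  = a * ((n%:R * u - c) ^+ 2 + n%:R * u * (1 - u)) + b.
Proof.
elim: n c => [|n IH] c /=; first by rewrite !mul0r addr0.
have -> : (fun k => a * (k%:R - c) ^+ 2 + b) \o S =
    (fun k : nat => a * (k%:R - (c - 1)) ^+ 2 + b).
  by apply/funext => k /=; rewrite -natr1; congr (_ * (_ ^+ 2) + _); ring.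
by rewrite !IH -natr1; ring.
Qed.

Lemma bernsteinB n u phi c : bernstein n u (fun k => phi k - c) = bernstein n u phi - c.
Proof.
elim: n phi => [//|n IH] phi /=.
have -> : (fun k => phi k - c) \o S = (fun k => (phi \o S) k - c) by [].
by rewrite !IH; ring.
Qed.

Lemma unif_continuous_segment (h : R -> R) : continuous h ->
  forall e, 0 < e -> exists2 dl, 0 < dl & forall u v, 0 <= u <= 1 ->
    `|v - u| < dl -> `|h v - h u| <= e.
Proof.
move=> ch e e0.
have := @segment_compact R 0 1; rewrite compact_near_coveringP => cov.
have := cov R (0%R^'+) (fun dl u => forall v, `|v - u| < dl -> `|h v - h u| <= e) _.
move=> /(_ _) [|dl /= dl0 H].
  move=> u _.
  have e20 : 0 < e / 2 by rewrite divr_gt0.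
  have /cvgrPdist_lt /(_ _ e20) [dl /= dl0 Hd] := ch u.
  have d2 : 0 < dl / 2 by rewrite divr_gt0.
  exists (ball u (dl / 2), [set z | z < dl / 2]).
    split => /=; first exact: nbhsx_ballx.
    exact: nbhs_right_lt.
  move=> [u' z] /= [uu' zd] v vu'.
  have h1 : `|h u - h u'| < e / 2.
    apply: Hd => /=; rewrite /ball/= in uu'; apply: lt_trans uu' _.
    by rewrite ltr_pdivrMr// ltr_pMr// ltr1n.
  have h2 : `|h u - h v| < e / 2.
    apply: Hd => /=; rewrite (_ : u - v = (u - u') - (v - u')); last by ring.
    rewrite (le_lt_trans (ler_normB _ _))// [ltRHS]splitr.
    by rewrite ltrD//; exact: lt_trans vu' zd.
  rewrite (_ : h v - h u' = (h u - h u') - (h u - h v)); last by ring.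
  rewrite (le_trans (ler_normB _ _))// [leRHS]splitr.
  by rewrite lerD// ltW.
exists (dl / 2); first by rewrite divr_gt0.
move=> u v u01 vu; apply: (H (dl / 2)) => //=.
- rewrite /ball/= sub0r normrN ger0_norm ?divr_ge0 ?ltW//.
  by rewrite ltr_pdivrMr// ltr_pMr// ltr1n.
- by rewrite divr_gt0.
Qed.

(** Chebyshev's inequality in Bernstein's proof: h (k / n) - h u is at most
    e / 2 near u and 2 M (k / n - u)^2 / dl^2 elsewhere. *)
Lemma bernstein_approx (h : R -> R) M : continuous h -> (forall u, `|h u| <= M) ->
  forall e, 0 < e -> exists n, forall u, 0 <= u <= 1 ->
    `|bernstein n u (fun k => h (k%:R / n%:R)) - h u| <= e.
Proof.
move=> ch hM e e0; have e20 : 0 < e / 2 by rewrite divr_gt0.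
have M0 : 0 <= M := le_trans (normr_ge0 _) (hM 0).
have [dl dl0 Hd] := unif_continuous_segment ch e20.
pose A := 2 * M / dl ^+ 2.
have A0 : 0 <= A by apply: divr_ge0; [exact: mulr_ge0|exact: sqr_ge0].
pose n := (Num.truncn (A / e)).+1.
have n0 : 0 < n%:R :> R by rewrite ltr0n.
have nA : A <= e * n%:R.
  by rewrite mulrC -ler_pdivrMr// ltW// truncnS_gt.
exists n => u u01; have /andP[u0 u1] := u01.
rewrite -bernsteinB.
pose a := A / n%:R ^+ 2.
apply: (@le_trans _ _ (bernstein n u (fun k => a * (k%:R - n%:R * u) ^+ 2 + e / 2))).
  apply: bernstein_norm => // k.
  have E : a * (k%:R - n%:R * u) ^+ 2 = A * (k%:R / n%:R - u) ^+ 2.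
    by rewrite /a; field; rewrite gt_eqF.
  have [lt_d|ge_d] := ltP `|k%:R / n%:R - u| dl.
    by rewrite (le_trans (Hd _ _ u01 lt_d))// lerDr E mulr_ge0// sqr_ge0.
  rewrite E (le_trans (ler_normB _ _))// (@le_trans _ _ (2 * M))//.
    by rewrite (_ : 2 * M = M + M) ?lerD//; ring.
  rewrite -[leLHS]addr0 lerD ?(ltW e20)// /A mulrAC ler_pdivlMr ?exprn_gt0//.
  rewrite ler_wpM2l ?mulr_ge0// -[leRHS]real_normK ?num_real//.
  by rewrite lerXn2r// nnegrE ltW.
rewrite bernstein_affine.
rewrite subrr expr0n/= add0r [leRHS]splitr lerD2r.
have -> : a * (n%:R * u * (1 - u)) = A / n%:R * (u * (1 - u)).
  by rewrite /a; field; rewrite gt_eqF.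
have u4 : u * (1 - u) <= 1 / 4 by have := sqr_ge0 (u - 1 / 2); nra.
have uu0 : 0 <= u * (1 - u) by rewrite mulr_ge0// subr_ge0.
have An : A / n%:R <= e by rewrite ler_pdivrMr.
have An0 : 0 <= A / n%:R by rewrite divr_ge0// ltW.
by nra.
Qed.

End weierstrass.

Section gauss_span.
Variable R : realType.
Implicit Types f g : R -> R.

Inductive gauss_span : (R -> R) -> Prop :=
| gauss_span0 : gauss_span (fun=> 0)
| gauss_span_cons a s f : 0 < s -> gauss_span f ->
    gauss_span (fun y => a * gauss s y + f y).

Lemma gauss_span_comb c f g : gauss_span f -> gauss_span g ->
  gauss_span (fun y => c * f y + g y).
Proof.
move=> sf sg; elim: sf => {f} [|a s f s0 _ IH].
  by under eq_fun do rewrite mulr0 add0r.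
under eq_fun do rewrite mulrDr mulrA -addrA.
exact: gauss_span_cons.
Qed.

Lemma gauss_span_mul s f : 0 < s -> gauss_span f ->
  gauss_span (fun y => gauss s y * f y).
Proof.
move=> s0 sf; elim: sf => {f} [|a t f t0 _ IH].
  by under eq_fun do rewrite mulr0; exact: gauss_span0.
under eq_fun do rewrite mulrDr mulrCA -gaussD.
by apply: gauss_span_cons => //; exact: addr_gt0.
Qed.

(** Powers of exp(- y^2) are Gaussians, so a polynomial in exp(- y^2) is a
    combination of Gaussians up to its constant term. *)
Lemma gauss_span_bernstein n (phi : nat -> R) : exists2 g, gauss_span g &
  forall y, bernstein n (gauss 1 y) phi = phi 0%N + g y.
Proof.
elim: n phi => [|n IH] phi /=.
  by exists (fun=> 0); [exact: gauss_span0|move=> y; rewrite addr0].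
have [g1 s1 E1] := IH (phi \o S); have [g0 s0 E0] := IH phi.
pose g y := (phi 1%N - phi 0%N) * gauss 1 y + (1 * (gauss 1 y * (1 * g1 y + -1 * g0 y)) + 0).
exists (fun y => -1 * (-1 * g0 y + 0) + g y).
  apply: gauss_span_comb.
    by apply: gauss_span_comb => //; exact: gauss_span0.
  apply: gauss_span_cons => //.
  apply: gauss_span_comb; last exact: gauss_span0.
  apply: gauss_span_mul => //; apply: gauss_span_comb => //.
  have h := gauss_span_comb (-1) s0 gauss_span0.
  by under eq_fun do rewrite -[_ * _]addr0.
by move=> y; rewrite E1 E0 /g /=; ring.
Qed.

End gauss_span.

Section C0.
Variable R : realType.
Implicit Types f g : R -> R.

(** Composing with the absolute value replaces continuity within the half-line
    by continuity on the line. *)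
Lemma C0_halflineP f : C0_halfline f <->
  (continuous (fun y : R => f `|y|) /\ f x @[x --> +oo] --> (0 : R)).
Proof.
split=> -[cf f0]; split => //.
  move: cf => /continuous_within_itvcyP[cf fr] y.
  have [y0|y0|y0] := ltgtP y 0.
  - have c1 : {for `|y|, continuous f}.
      by apply: cf; rewrite in_itv/= andbT normr_gt0 lt_eqF.
    exact: (continuous_comp (@norm_continuous _ R y) c1).
  - have c1 : {for `|y|, continuous f}.
      by apply: cf; rewrite in_itv/= andbT normr_gt0 gt_eqF.
    exact: (continuous_comp (@norm_continuous _ R y) c1).
  - rewrite y0; apply/continuous_withinNx; rewrite normr0.
    apply/cvgr_dnbhsP => u [un0 u0]; move/cvg_at_rightP: fr; apply; split.
      by move=> n; rewrite normr_gt0.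
    by rewrite -(@normr0 _ R); exact: cvg_norm.
apply/continuous_within_itvcyP; split.
  move=> y; rewrite in_itv/= andbT => y0.
  have c := cf y; rewrite /continuous_at (gtr0_norm y0) in c.
  apply: cvg_trans c; apply: near_eq_cvg; near=> z; rewrite gtr0_norm//.
  by near: z; exact: lt_nbhsr.
have h0 := cf 0; rewrite /continuous_at normr0 in h0.
have h := cvg_at_right_filter h0.
apply: cvg_trans h; apply: near_eq_cvg; near=> z; rewrite gtr0_norm//.
Unshelve. all: by end_near. Qed.

(** A function of C_0([0, oo[) read in the coordinate exp(- y^2), which
    compactifies the half-line. *)
Let compactified f (u : R) : R := if u <= 0 then 0 else f `|Num.sqrt (- ln u)|.

Let compactifiedE f y : 0 <= y -> compactified f (gauss 1 y) = f y.
Proof.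
move=> y0; rewrite /compactified leNgt gauss_gt0/= /gauss expRK mul1r opprK.
by rewrite sqrtr_sqr normr_id ger0_norm.
Qed.

Let continuous_compactified f : C0_halfline f -> continuous (compactified f).
Proof.
move=> /C0_halflineP[cf f0] u.
have [u0|u0|->] := ltgtP u 0.
- rewrite /continuous_at {2}/compactified ltW//; apply: cvg_near_cst.
  by near=> v; rewrite /compactified ltW//; near: v; exact: lt_nbhsl.
- have c1 : {for u, continuous (fun v => f `|Num.sqrt (- ln v)|)}.
    have cl : {for u, continuous (fun v => Num.sqrt (- ln v))}.
      apply: (@continuous_comp _ _ _ (fun v : R => - ln v) (@Num.sqrt R)).
        by apply: cvgN; exact: continuous_ln.
      exact: sqrt_continuous.
    exact: (continuous_comp cl (cf _)).
  rewrite /continuous_at {2}/compactified leNgt u0/=; apply: cvg_trans c1.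
  apply: near_eq_cvg; near=> v; rewrite /compactified ifF//.
  by apply/negbTE; rewrite -ltNge; near: v; exact: lt_nbhsr.
have C00 : compactified f 0 = 0 by rewrite /compactified lexx.
apply/cvgrPdist_lt => e e0.
have /cvgrPdist_lt /(_ _ e0) [A [Ar HA]] := f0.
have g0 := @gauss_gt0 R 1 (`|A| + 1).
near=> v; rewrite C00 /compactified; case: ifP => [_|/negbT]; first by rewrite subrr normr0.
rewrite -ltNge => v0; apply: HA => /=.
have vg : v < gauss 1 (`|A| + 1).
  near: v; exact: lt_nbhsl.
have : ln v < - (`|A| + 1) ^+ 2.
  have -> : - (`|A| + 1) ^+ 2 = ln (gauss 1 (`|A| + 1)).
    by rewrite /gauss expRK mul1r.
  by rewrite ltr_ln ?posrE.
move=> lv; apply: (@lt_le_trans _ _ (`|A| + 1)).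
  by rewrite (le_lt_trans (ler_norm A))// ltrDl.
have -> : `|A| + 1 = Num.sqrt ((`|A| + 1) ^+ 2).
  by rewrite sqrtr_sqr (@ger0_norm _ (`|A| + 1))// addr_ge0.
apply: le_trans (ler_norm _); rewrite ler_wsqrtr//; lra.
Unshelve. all: by end_near. Qed.

Lemma C0_bounded f : C0_halfline f ->
  exists2 M, 0 <= M & forall y, 0 <= y -> `|f y| <= M.
Proof.
move=> Cf; have cH := continuous_compactified Cf.
have /compact_bounded[M [_ mrt]] : compact (compactified f @` `[0, 1]%classic).
  apply: continuous_compact; last exact: segment_compact.
  exact: continuous_subspaceT.
have HM y : 0 <= y -> `|f y| <= `|M| + 1.
  move=> y0; apply: mrt; first by rewrite (le_lt_trans (ler_norm M))// ltrDl.
  exists (gauss 1 y); last exact: compactifiedE.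
  by rewrite /= in_itv/= gauss_ge0 gauss_le1.
by exists (`|M| + 1) => //; rewrite addr_ge0.
Qed.

Lemma C0_measurable f : C0_halfline f -> measurable_fun (`[0%R, +oo[%classic : set R) f.
Proof.
move=> /C0_halflineP[cf _].
apply: (eq_measurable_fun (fun y : R => f `|y|)).
  by move=> y; rewrite inE/= in_itv/= andbT => y0; rewrite ger0_norm.
by apply: measurable_funTS; exact: continuous_measurable_fun.
Qed.

(** Density of the Gaussians in C_0([0, oo[): Weierstrass' theorem in the
    variable exp(- y^2). *)
Lemma gauss_span_dense f : C0_halfline f -> forall e, 0 < e ->
  exists2 g, gauss_span g & forall y, 0 <= y -> `|f y - g y| <= e.
Proof.
move=> Cf e e0; have [M M0 fM] := C0_bounded Cf.
have hM u : `|compactified f u| <= M.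
  rewrite /compactified; case: ifP => _; first by rewrite normr0.
  exact: fM.
have [n Hn] := bernstein_approx (continuous_compactified Cf) hM e0.
have [g sg Eg] := gauss_span_bernstein n (fun k => compactified f (k%:R / n%:R)).
exists g => // y y0.
have u01 : 0 <= gauss 1 y <= 1 by rewrite gauss_ge0 gauss_le1.
have := Hn _ u01; rewrite Eg compactifiedE// mul0r {1}/compactified lexx add0r.
by rewrite distrC.
Qed.

Lemma gauss_C0 s : 0 < s -> C0_halfline (@gauss R s).
Proof.
move=> s0; apply/C0_halflineP; split.
  rewrite (_ : (fun y => _) = gauss s); first exact: continuous_gauss.
  by apply/funext => y; rewrite /gauss real_normK// num_real.
have h : x ^+ 2 * s @[x --> (+oo : set_system R)] --> (+oo : set_system R).
  by apply: gt0_cvgMly => //; exact: cvgr_expr2.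
rewrite (_ : @gauss R s = (fun x => expR (- (x ^+ 2 * s)))).
  exact: (cvg_comp _ _ h (@cvgr_expR R)).
by apply/funext => x; rewrite mulrC.
Qed.

Lemma C0_closed f :
  (forall e, 0 < e -> exists2 g, C0_halfline g & forall y, 0 <= y -> `|f y - g y| <= e) ->
  C0_halfline f.
Proof.
move=> H; apply/C0_halflineP; split.
  move=> y; apply/cvgrPdist_le => e e0.
  have e3 : 0 < e / 3 by rewrite divr_gt0.
  have [g /C0_halflineP[cg _] fg] := H _ e3.
  have /cvgrPdist_le /(_ _ e3) := cg y; apply: filterS => z hz.
  have h1 := fg _ (normr_ge0 y); have h2 := fg _ (normr_ge0 z).
  have -> : f `|y| - f `|z| =
    (f `|y| - g `|y|) + (g `|y| - g `|z|) - (f `|z| - g `|z|) by ring.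
  rewrite (le_trans (ler_normB _ _))// (le_trans (lerD (ler_normD _ _) (lexx _)))//.
  lra.
apply/cvgrPdist_le => e e0; have e2 : 0 < e / 2 by rewrite divr_gt0.
have [g /C0_halflineP[_ cg] fg] := H _ e2.
have /cvgrPdist_le /(_ _ e2) g0 := cg.
near=> z; rewrite sub0r normrN.
have z0 : 0 <= z by near: z; exact: nbhs_pinfty_ge.
have h1 := fg _ z0.
have h2 : `|0 - g z| <= e / 2 by near: z.
rewrite sub0r normrN in h2.
have -> : f z = (f z - g z) + g z by ring.
by rewrite (le_trans (ler_normD _ _))//; lra.
Unshelve. all: by end_near. Qed.

Lemma C0_comb a f g : C0_halfline f -> C0_halfline g ->
  C0_halfline (fun y => a * f y + g y).
Proof.
move=> /C0_halflineP[cf f0] /C0_halflineP[cg g0]; apply/C0_halflineP; split.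
  by move=> y; apply: cvgD; [apply: cvgMl_tmp; exact: cf|exact: cg].
rewrite -[X in _ --> X](@addr0 R) -[X in _ --> X + _](mulr0 a).
by apply: cvgD => //; exact: cvgMl_tmp.
Qed.

Lemma gauss_span_C0 g : gauss_span g -> C0_halfline g.
Proof.
elim=> {g} [|a s f s0 _ IH].
  by apply/C0_halflineP; split=> [y|]; exact: cvg_cst.
by apply: C0_comb => //; exact: gauss_C0.
Qed.

End C0.

(** * The Feller semigroup *)

Section C0_more.
Variable R : realType.
Implicit Types f g : R -> R.

Lemma C0_ext f g : (forall y, 0 <= y -> f y = g y) -> C0_halfline f -> C0_halfline g.
Proof.
move=> fg /C0_halflineP[cf f0]; apply/C0_halflineP; split.
  rewrite (_ : (fun y => _) = (fun y : R => f `|y|))//.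
  by apply/funext => y; rewrite fg.
apply: cvg_trans f0; apply: near_eq_cvg; near=> y; apply: fg.
by near: y; exact: nbhs_pinfty_ge.
Unshelve. all: by end_near. Qed.

(** Identities in C_0 that are proved by dividing by x > 0 extend to the
    origin. *)
Lemma C0_eq0 f g : C0_halfline f -> C0_halfline g ->
  (forall y, 0 < y -> f y = g y) -> f 0 = g 0.
Proof.
move=> /C0_halflineP[cf _] /C0_halflineP[cg _] fg.
have h (k : R -> R) : continuous (fun y : R => k `|y|) ->
    k n.+1%:R^-1 @[n --> \oo] --> k 0.
  move=> ck; have := cvg_seq_continuous (ck 0) (@cvg_harmonic R).
  rewrite normr0 (_ : (fun n => _) = (fun n => k n.+1%:R^-1))//.
  by apply/funext => n /=; rewrite ger0_norm ?invr_ge0.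
have hf := h _ cf; have hg := h _ cg.
rewrite (_ : (fun n => _) = (fun n => g n.+1%:R^-1)) in hf.
  exact: (cvg_unique _ hf hg).
by apply/funext => n; rewrite fg// invr_gt0.
Qed.

Lemma sinc_bound (u : R) : `|u| * `|sinc u| <= 1.
Proof. by rewrite -normrM mul_sinc sin_max. Qed.

End C0_more.

Section radial_semigroup.
Variables (R : realType) (alpha : R).
Hypothesis halpha : 0 < alpha < 2.
Local Notation mu := (@lebesgue_measure R).
Local Notation cf := (stable_cf alpha).
Local Notation K := (radial_kernel alpha).
Local Notation halfline := (`[0%R, +oo[%classic : set R).
Hypothesis eigen : forall t x r : R, 0 < t -> 0 < x ->
  \int[mu]_(y in halfline) (sinc (r * y) * K t x y) = sinc (r * x) * cf t r.
Variable p : R -> R -> R -> R.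
Hypothesis pK : forall t x y : R, 0 < t -> 0 <= x -> 0 <= y -> p t x y = K t x y.
Local Notation S := (density_semigroup p).
Implicit Types (s t x y a c M N e : R) (f g : R -> R).

Let half0 y : halfline y -> 0 <= y. Proof. by rewrite /= in_itv/= andbT. Qed.

Lemma semigroup0 f x : S 0 f x = f x.
Proof. by rewrite /density_semigroup eqxx. Qed.

Lemma semigroupE t f x : 0 < t -> 0 <= x ->
  S t f x = \int[mu]_(y in halfline) (f y * K t x y).
Proof.
move=> t0 x0; rewrite /density_semigroup gt_eqF//.
apply: eq_Rintegral => y; rewrite inE => /half0 y0.
by rewrite pK.
Qed.

Lemma semigroup_integrable t f x M : 0 < t -> 0 <= x ->
  measurable_fun halfline f -> (forall y, 0 <= y -> `|f y| <= M) ->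
  mu.-integrable halfline (EFin \o (fun y => f y * K t x y)).
Proof.
move=> t0 x0 mf fM; have iK := integrable_radial_kernel halpha t0 x0.
apply: (@integrable_dom _ _ R mu halfline _ (fun y => M * K t x y)) => //.
- apply: measurable_funM => //; apply: measurable_funTS.
  exact: measurable_radial_kernel.
- exact: (integrableZl _ M iK).
- move=> y /half0 y0; rewrite normrM (ger0_norm (radial_kernel_ge0 _ _ _ _))//.
  by rewrite ler_wpM2r ?radial_kernel_ge0// fM.
Qed.

Lemma semigroup_ext t f g x : 0 <= t -> 0 <= x ->
  (forall y, 0 <= y -> f y = g y) -> S t f x = S t g x.
Proof.
rewrite le_eqVlt => /predU1P[<-|t0] x0 fg; first by rewrite !semigroup0 fg.
rewrite !semigroupE//; apply: eq_Rintegral => y; rewrite inE => /half0 y0.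
by rewrite fg.
Qed.

Lemma semigroup_comb t a f g x M N : 0 <= t -> 0 <= x ->
  measurable_fun halfline f -> (forall y, 0 <= y -> `|f y| <= M) ->
  measurable_fun halfline g -> (forall y, 0 <= y -> `|g y| <= N) ->
  S t (fun y => a * f y + g y) x = a * S t f x + S t g x.
Proof.
rewrite le_eqVlt => /predU1P[<-|t0] x0 mf fM mg gN; first by rewrite !semigroup0.
have i1 := semigroup_integrable t0 x0 mf fM.
have i2 := semigroup_integrable t0 x0 mg gN.
rewrite !semigroupE//; under eq_Rintegral do rewrite mulrDl -mulrA.
by rewrite RintegralD// ?RintegralZl//; exact: (integrableZl _ a i1).
Qed.

Lemma semigroup_le t f g x M N : 0 <= t -> 0 <= x ->
  measurable_fun halfline f -> (forall y, 0 <= y -> `|f y| <= M) ->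
  measurable_fun halfline g -> (forall y, 0 <= y -> `|g y| <= N) ->
  (forall y, 0 <= y -> f y <= g y) -> S t f x <= S t g x.
Proof.
rewrite le_eqVlt => /predU1P[<-|t0] x0 mf fM mg gN fg; first by rewrite !semigroup0 fg.
have i1 := semigroup_integrable t0 x0 mf fM.
have i2 := semigroup_integrable t0 x0 mg gN.
rewrite !semigroupE//; apply: le_Rintegral => // y /half0 y0.
by rewrite ler_wpM2r ?radial_kernel_ge0// fg.
Qed.

Lemma semigroup_cst t c x : 0 <= t -> 0 <= x -> S t (fun=> c) x = c.
Proof.
rewrite le_eqVlt => /predU1P[<-|t0] x0; first by rewrite semigroup0.
rewrite semigroupE// RintegralZl//; last exact: integrable_radial_kernel.
by rewrite /Rintegral radial_kernel_mass// mulr1.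
Qed.

Lemma semigroup_norm t f x M : 0 <= t -> 0 <= x ->
  measurable_fun halfline f -> (forall y, 0 <= y -> `|f y| <= M) ->
  `|S t f x| <= M.
Proof.
move=> t0 x0 mf fM; rewrite ler_norml; apply/andP; split.
  rewrite -(semigroup_cst (- M) t0 x0).
  apply: (@semigroup_le _ _ _ _ `|M| M) => //.
    by move=> y _; rewrite normrN.
  by move=> y y0; have := fM _ y0; rewrite ler_norml => /andP[].
rewrite -[leRHS](semigroup_cst M t0 x0).
apply: (@semigroup_le _ _ _ _ M `|M|) => //.
by move=> y y0; have := fM _ y0; rewrite ler_norml => /andP[].
Qed.

Lemma semigroup_dist t f g x M N e : 0 <= t -> 0 <= x ->
  measurable_fun halfline f -> (forall y, 0 <= y -> `|f y| <= M) ->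
  measurable_fun halfline g -> (forall y, 0 <= y -> `|g y| <= N) ->
  (forall y, 0 <= y -> `|f y - g y| <= e) -> `|S t f x - S t g x| <= e.
Proof.
move=> t0 x0 mf fM mg gN fg.
have -> : S t f x - S t g x = S t (fun y => -1 * g y + f y) x.
  by rewrite (@semigroup_comb _ _ _ _ _ N M)// mulN1r addrC.
apply: semigroup_norm => //.
  by apply: measurable_funD => //; exact: measurable_funM.
by move=> y y0; rewrite mulN1r addrC fg.
Qed.

Let gaussM s : 0 < s -> forall y, 0 <= y -> `|@gauss R s y| <= 1.
Proof. by move=> s0 y _; rewrite ger0_norm ?gauss_ge0// gauss_le1// ltW. Qed.

Let gaussm s : measurable_fun halfline (@gauss R s).
Proof. by apply: measurable_funTS; exact: measurable_gauss. Qed.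

Lemma semigroup_gauss s t x : 0 < s -> 0 <= t -> 0 <= x ->
  S t (gauss s) x = \int[mu]_th (gauss_spectral s th * sinc (th * x) * cf t th).
Proof.
move=> s0; rewrite le_eqVlt => /predU1P[<-|t0] x0.
  rewrite semigroup0 -gauss_spectral_inv//; apply: eq_Rintegral => th _.
  by rewrite /stable_cf mul0r oppr0 expR0 mulr1.
by rewrite semigroupE//; have [_ ->] := integral_gauss_radial_kernel halpha x s0 t0.
Qed.

Let spectral_dct s t (u : nat -> R) (v : R -> R) : 0 < s -> 0 <= t ->
  (forall th, gauss_spectral s th * sinc (th * u n) @[n --> \oo] --> v th) ->
  \int[mu]_th (gauss_spectral s th * sinc (th * u n) * cf t th) @[n --> \oo] -->
  \int[mu]_th (v th * cf t th).
Proof.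
move=> s0 t0 uv.
apply: (@Rintegral_dct _ _ R mu setT (fun n th =>
  gauss_spectral s th * sinc (th * u n) * cf t th) _ (gauss_spectral s)) => //.
- move=> n; have := measurable_int _ (integrable_gauss_spectral_cf alpha (u n) s0 t0).
  by move/measurable_EFinP.
- by move=> th _; apply: cvgMr_tmp; exact: uv.
- exact: integrable_gauss_spectral.
- move=> n th _; rewrite 2!normrM (ger0_norm (gauss_spectral_ge0 _ s0)) -mulrA.
  rewrite ler_piMr ?gauss_spectral_ge0// mulr_ile1// ?sinc_le1//.
  by rewrite ger0_norm ?stable_cf_ge0// stable_cf_le1.
Qed.

(** Decay at infinity comes from |sinc (th x)| <= 1 / |th x| under the spectral
    integral. *)
Lemma semigroup_gauss_C0 s t : 0 < s -> 0 <= t -> C0_halfline (S t (gauss s)).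
Proof.
move=> s0 t0.
pose G x := \int[mu]_th (gauss_spectral s th * sinc (th * x) * cf t th).
apply: (@C0_ext _ G); first by move=> y y0; rewrite semigroup_gauss.
apply/C0_halflineP; split.
  have GE x : G `|x| = G x.
    apply: eq_Rintegral => th _; have [x0|x0] := leP 0 x; first by rewrite ger0_norm.
    by rewrite ltr0_norm// mulrN sincN.
  rewrite (funext GE) => x; apply/(@cvg_nbhsP _ R^o) => u ux.
  apply: (@spectral_dct s t u (fun th => gauss_spectral s th * sinc (th * x))) => //.
  move=> th; apply: cvgMl_tmp; apply: cvg_seq_continuous; first exact: continuous_sinc.
  exact: cvgMl_tmp.
apply/cvg_pinftyP => u uoo.
have := @spectral_dct s t u (fun=> 0) s0 t0 _.
have -> : \int[mu]_th (0 * cf t th) = 0.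
  by under eq_Rintegral do rewrite mul0r; rewrite /Rintegral integral0.
apply => th; have [->|th0] := eqVneq th 0.
  under eq_fun do rewrite /gauss_spectral expr0n/= mul0r mulr0 mul0r.
  exact: cvg_cst.
rewrite -[X in _ --> X](mulr0 (gauss_spectral s th)); apply: cvgMl_tmp.
apply/cvgrPdist_le => e e0; have th1 : 0 < `|th| by rewrite normr_gt0.
have /cvgryPge /(_ ((e * `|th|)^-1)) := uoo; apply: filterS => n un.
have eth0 : 0 < e * `|th| by rewrite mulr_gt0.
have un0 : 0 < u n by apply: lt_le_trans un; rewrite invr_gt0.
rewrite sub0r normrN; have := sinc_bound (th * u n).
have a0 := normr_ge0 (sinc (th * u n)).
rewrite normrM (gtr0_norm un0).
have : 1 <= e * (`|th| * u n) by rewrite mulrA -ler_pdivrMl ?mulr1.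
have : 0 < `|th| * u n by rewrite mulr_gt0.
by move: (`|th| * u n) (`|sinc _|) a0 => z w w0 z0 ez zw; nra.
Qed.

Lemma semigroup_span_C0 g t : gauss_span g -> 0 <= t -> C0_halfline (S t g).
Proof.
move=> sg t0; elim: sg => {g} [|a s f s0 sf IH].
  apply: (@C0_ext _ (fun=> 0)); first by move=> y y0; rewrite semigroup_cst.
  exact: (gauss_span_C0 (@gauss_span0 R)).
have [M M0 fM] := C0_bounded (gauss_span_C0 sf).
have mf := C0_measurable (gauss_span_C0 sf).
apply: (@C0_ext _ (fun x => a * S t (gauss s) x + S t f x)).
  by move=> x x0; rewrite (semigroup_comb _ _ _ _ (gaussM s0) _ fM).
by apply: C0_comb => //; exact: semigroup_gauss_C0.
Qed.

(** The semigroup contracts the uniform norm and C_0 is closed, so the case of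
    Gaussians suffices. *)
Lemma semigroup_C0 f t : 0 <= t -> C0_halfline f -> C0_halfline (S t f).
Proof.
move=> t0 Cf; apply: C0_closed => e e0.
have [g sg fg] := gauss_span_dense Cf e0.
exists (S t g); first exact: semigroup_span_C0.
have [M _ fM] := C0_bounded Cf; have [N _ gN] := C0_bounded (gauss_span_C0 sg).
move=> y y0; apply: semigroup_dist fg => //; [|exact: fM| |exact: gN].
  exact: (C0_measurable Cf).
exact: (C0_measurable (gauss_span_C0 sg)).
Qed.

(** Chapman-Kolmogorov on Gaussians, away from the origin: [eigen] is applied
    under the spectral integral. *)
Let chapman_gauss a s t x : 0 < a -> 0 < s -> 0 <= t -> 0 < x ->
  S s (S t (gauss a)) x = S (s + t) (gauss a) x.
Proof.
move=> a0 s0 t0 x0; have st0 : 0 <= s + t by rewrite addr_ge0// ltW.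
rewrite semigroup_gauss ?(ltW x0)//.
have h y : 0 <= y -> S t (gauss a) y =
    \int[mu]_th (gauss_spectral a th * sinc (th * y) * cf t th).
  by move=> y0; exact: semigroup_gauss.
rewrite (semigroup_ext (ltW s0) (ltW x0) h) semigroupE ?(ltW x0)//.
have iK := integrable_radial_kernel halpha s0 (ltW x0).
have ig := integrable_gauss_spectral a0.
pose F y th := gauss_spectral a th * sinc (th * y) * cf t th * K s x y.
have mF : measurable_fun setT (fun z : R * R => F z.1 z.2).
  apply: measurable_funM.
    apply: measurable_funM; last first.
      by apply: measurableT_comp => //; exact: measurable_stable_cf.
    apply: measurable_funM.
      apply: measurableT_comp => //.
      by have := measurable_int _ ig; move/measurable_EFinP.
    apply: measurableT_comp; last exact: measurable_funM.
    exact: continuous_measurable_fun (@continuous_sinc R).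
  by apply: measurableT_comp => //; exact: measurable_radial_kernel.
have bF y th : halfline y -> setT th -> `|F y th| <= K s x y * gauss_spectral a th.
  move=> /half0 y0 _; rewrite 3!normrM (ger0_norm (gauss_spectral_ge0 _ a0)).
  rewrite (ger0_norm (radial_kernel_ge0 halpha s0 (ltW x0) y0)) mulrC.
  apply: ler_wpM2l; first exact: radial_kernel_ge0 _ _ (ltW x0) _.
  rewrite -mulrA; apply: ler_piMr; first exact: gauss_spectral_ge0.
  apply: mulr_ile1 => //; first exact: sinc_le1.
  by rewrite (ger0_norm (stable_cf_ge0 _ _ _)) stable_cf_le1.
have mH : measurable (halfline : set (measurableTypeR R)) by [].
have [_ E] := @Rintegral_fubini _ _ _ _ R mu mu halfline setT F (K s x)
  (gauss_spectral a) mH measurableT mF iK ig bF.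
transitivity (\int[mu]_(y in halfline) \int[mu]_th F y th).
  apply: eq_Rintegral => y _.
  have i1 := integrable_gauss_spectral_cf alpha y a0 t0.
  exact: (esym (RintegralZr (K s x y) measurableT i1)).
rewrite E; apply: eq_Rintegral => th _.
have is_ : mu.-integrable halfline (EFin \o (fun y => sinc (th * y) * K s x y)).
  apply: (@semigroup_integrable _ _ _ 1 s0 (ltW x0)).
    apply: measurable_funTS; apply: measurableT_comp; last exact: measurable_funM.
    exact: continuous_measurable_fun (@continuous_sinc R).
  by move=> y _; exact: sinc_le1.
transitivity (\int[mu]_(y in halfline)
   ((gauss_spectral a th * cf t th) * (sinc (th * y) * K s x y))).
  by apply: eq_Rintegral => y _; rewrite /F; ring.
rewrite (RintegralZl _ mH is_) (eigen _ s0 x0) stable_cfD.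
by move: (stable_cf alpha s th) (stable_cf alpha t th) (sinc _) (gauss_spectral a th) => u v w z; ring.
Qed.

(** Density of Gaussians for x > 0; both sides are continuous at 0. *)
Lemma chapman_kolmogorov f s t x : 0 <= s -> 0 <= t -> 0 <= x ->
  C0_halfline f -> S (s + t) f x = S s (S t f) x.
Proof.
move=> s0' t0 x0' Cf; apply/esym; move: s0'; rewrite le_eqVlt => /predU1P[<-|s0].
  by rewrite add0r semigroup0.
have st0 : 0 <= s + t by rewrite addr_ge0// ltW.
have pos y : 0 < y -> S s (S t f) y = S (s + t) f y.
  move=> y0; have y0' := ltW y0; apply/eqP; rewrite -subr_eq0 -normr_eq0.
  rewrite eq_le normr_ge0 andbT; apply/ler_addgt0Pr => e e0; rewrite add0r.
  have e2 : 0 < e / 2 by rewrite divr_gt0.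
  have [g sg fg] := gauss_span_dense Cf e2.
  have [M _ fM] := C0_bounded Cf; have mf := C0_measurable Cf.
  have Cg := gauss_span_C0 sg.
  have [N _ gN] := C0_bounded Cg; have mg := C0_measurable Cg.
  have Sg : S s (S t g) y = S (s + t) g y.
    elim: sg {fg gN mg Cg} => [|a r k r0 sk IH].
      have h z : 0 <= z -> S t (fun=> 0) z = 0.
        by move=> z0; exact: semigroup_cst.
      rewrite (semigroup_ext (ltW s0) y0' h) (semigroup_cst 0 (ltW s0) y0').
      by rewrite (semigroup_cst 0 st0 y0').
    have Ck := gauss_span_C0 sk; have mk := C0_measurable Ck.
    have [L _ kL] := C0_bounded Ck.
    have h z : 0 <= z -> S t (fun y => a * gauss r y + k y) z =
        a * S t (gauss r) z + S t k z.
      by move=> z0; exact: (semigroup_comb _ t0 z0 _ (gaussM r0) mk kL).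
    rewrite (semigroup_ext (ltW s0) y0' h).
    rewrite (semigroup_comb _ st0 y0' (gaussm r) (gaussM r0) mk kL).
    rewrite -IH -chapman_gauss//.
    have mSg : measurable_fun halfline (S t (gauss r)).
      by apply: C0_measurable; apply: semigroup_C0 => //; exact: gauss_C0.
    have Sg1 z : 0 <= z -> `|S t (gauss r) z| <= 1.
      by move=> z0; exact: (semigroup_norm t0 z0 (gaussm r) (gaussM r0)).
    have mSk : measurable_fun halfline (S t k).
      by apply: C0_measurable; exact: semigroup_C0.
    have SkL z : 0 <= z -> `|S t k z| <= L.
      by move=> z0; exact: (semigroup_norm t0 z0 mk kL).
    exact: (semigroup_comb _ (ltW s0) y0' mSg Sg1 mSk SkL).
  have -> : S s (S t f) y - S (s + t) f y =
    (S s (S t f) y - S s (S t g) y) - (S (s + t) f y - S (s + t) g y).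
    by rewrite Sg; ring.
  rewrite (le_trans (ler_normB _ _))// [leRHS]splitr lerD//; last first.
    exact: (semigroup_dist st0 y0' mf fM mg gN fg).
  have mSf : measurable_fun halfline (S t f).
    by apply: C0_measurable; exact: semigroup_C0.
  have mSg : measurable_fun halfline (S t g).
    by apply: C0_measurable; exact: semigroup_C0.
  have SfM z (z0 : 0 <= z) := semigroup_norm t0 z0 mf fM.
  have SgN z (z0 : 0 <= z) := semigroup_norm t0 z0 mg gN.
  apply: (semigroup_dist (ltW s0) y0' mSf SfM mSg SgN) => z z0.
  exact: (semigroup_dist t0 z0 mf fM mg gN fg).
move: x0'; rewrite le_eqVlt => /predU1P[<-|x0]; last exact: pos.
apply: C0_eq0 => //; apply: semigroup_C0 => //; first exact: ltW.
exact: semigroup_C0.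
Qed.

(** Strong continuity is uniform because |sinc| <= 1 under the spectral
    integral. *)
Let strong_gauss a : 0 < a -> forall e, 0 < e ->
  \forall t \near (0 : R)^'+, forall x, 0 <= x -> `|S t (gauss a) x - gauss a x| <= e.
Proof.
move=> a0.
pose D t := \int[mu]_th (gauss_spectral a th * (1 - cf t th)).
have iD t : 0 <= t -> mu.-integrable setT
    (EFin \o (fun th => gauss_spectral a th * (1 - cf t th))).
  move=> t0; apply: (@integrable_dom _ _ R mu setT _ (gauss_spectral a)) => //.
  - apply: measurable_funM.
      by have := measurable_int _ (integrable_gauss_spectral a0); move/measurable_EFinP.
    by apply: measurable_funB => //; exact: measurable_stable_cf.
  - exact: integrable_gauss_spectral.
  - move=> th _; rewrite normrM (ger0_norm (gauss_spectral_ge0 _ a0)).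
    rewrite ler_piMr ?gauss_spectral_ge0// ger0_norm ?subr_ge0 ?stable_cf_le1//.
    by rewrite gerBl stable_cf_ge0.
have SD t x : 0 <= t -> 0 <= x -> `|S t (gauss a) x - gauss a x| <= D t.
  move=> t0 x0; rewrite -[gauss a x](semigroup0 _ x) !semigroup_gauss//.
  have i1 := integrable_gauss_spectral_cf alpha x a0 t0.
  have i0 := integrable_gauss_spectral_cf alpha x a0 (lexx 0).
  rewrite -RintegralB//.
  have i2 := integrableB measurableT i1 i0.
  apply: le_trans (le_normr_Rintegral measurableT i2) _.
  apply: le_Rintegral => //.
  - exact: (integrable_norm i2).
  - exact: iD.
  - move=> th _; rewrite {2}/stable_cf mul0r oppr0 expR0 mulr1.
    rewrite -[X in _ - X]mulr1 -mulrBr normrM normrM.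
    rewrite (ger0_norm (gauss_spectral_ge0 _ a0)) distrC.
    rewrite (@ger0_norm _ (1 - _)) ?subr_ge0 ?stable_cf_le1//.
    rewrite -mulrA ler_wpM2l ?gauss_spectral_ge0// ler_piMl ?sinc_le1//.
    by rewrite subr_ge0 stable_cf_le1.
have D0 : D t @[t --> (0 : R)^'+] --> (0 : R).
  apply/cvg_at_rightP => u [u0 ucv].
  rewrite [X in _ --> X](_ : _ = \int[mu]_(th in setT) (0 : R)); last first.
    by rewrite /Rintegral integral0.
  apply: (@Rintegral_dct _ _ R mu setT (fun n th =>
     gauss_spectral a th * (1 - cf (u n) th)) _ (gauss_spectral a)) => //.
  - by move=> n; have := measurable_int _ (iD _ (ltW (u0 n))); move/measurable_EFinP.
  - move=> th _; rewrite -[X in _ --> X](mulr0 (gauss_spectral a th)).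
    apply: cvgMl_tmp; rewrite -[X in _ --> X](subrr 1).
    apply: cvgB; first exact: cvg_cst.
    have h : - (u n * (th ^+ 2) `^ (alpha / 2)) @[n --> \oo] -->
       (- (0 * (th ^+ 2) `^ (alpha / 2)) : R).
      by apply: cvgN; exact: cvgMr_tmp.
    have := cvg_seq_continuous (@continuous_expR R _) h.
    by rewrite mul0r oppr0 expR0.
  - exact: integrable_gauss_spectral.
  - move=> n th _; rewrite normrM (ger0_norm (gauss_spectral_ge0 _ a0)).
    have un0 := ltW (u0 n).
    rewrite ler_piMr ?gauss_spectral_ge0// ger0_norm ?subr_ge0 ?stable_cf_le1//.
    by rewrite gerBl stable_cf_ge0.
move=> e e0; have /cvgrPdist_le /(_ _ e0) h := D0.
near=> t => x x0; have t0 : 0 < t by near: t; exact: nbhs_right_gt.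
rewrite (le_trans (SD t x (ltW t0) x0))//.
have : `|0 - D t| <= e by near: t.
by rewrite sub0r normrN; apply: le_trans; exact: ler_norm.
Unshelve. all: by end_near. Qed.

Let strong_span g : gauss_span g -> forall e, 0 < e ->
  \forall t \near (0 : R)^'+, forall x, 0 <= x -> `|S t g x - g x| <= e.
Proof.
elim=> {g} [|a s f s0 sf IH] e e0.
  near=> t => x x0; have t0 : 0 < t by near: t; exact: nbhs_right_gt.
  by rewrite semigroup_cst ?(ltW t0)// subrr normr0 ltW.
have Cf := gauss_span_C0 sf; have mf := C0_measurable Cf.
have [M _ fM] := C0_bounded Cf.
have a1 : 0 < `|a| + 1 by rewrite ltr_pwDr.
have e1 : 0 < e / 2 / (`|a| + 1) by rewrite !divr_gt0.
have e2 : 0 < e / 2 by rewrite divr_gt0.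
have h1 := strong_gauss s0 e1; have h2 := IH _ e2.
near=> t => x x0; have t0 : 0 < t by near: t; exact: nbhs_right_gt.
have H1 : forall x, 0 <= x -> `|S t (gauss s) x - gauss s x| <= e / 2 / (`|a| + 1).
  by near: t.
have H2 : forall x, 0 <= x -> `|S t f x - f x| <= e / 2 by near: t.
rewrite (semigroup_comb _ (ltW t0) x0 (gaussm s) (gaussM s0) mf fM).
have -> : a * S t (gauss s) x + S t f x - (a * gauss s x + f x) =
  a * (S t (gauss s) x - gauss s x) + (S t f x - f x) by ring.
rewrite (le_trans (ler_normD _ _))// [leRHS]splitr lerD//; last exact: H2.
rewrite normrM (le_trans (ler_wpM2l (normr_ge0 a) (H1 _ x0)))//.
rewrite mulrC mulrAC ler_pdivrMr// ler_wpM2l ?(ltW e2)// lerDl.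
by [].
Unshelve. all: by end_near. Qed.

Lemma semigroup_strong f : C0_halfline f -> forall e, 0 < e ->
  \forall t \near (0 : R)^'+, forall x, 0 <= x -> `|S t f x - f x| < e.
Proof.
move=> Cf e e0; have e4 : 0 < e / 4 by rewrite divr_gt0.
have [g sg fg] := gauss_span_dense Cf e4.
have [M _ fM] := C0_bounded Cf; have mf := C0_measurable Cf.
have Cg := gauss_span_C0 sg.
have [N _ gN] := C0_bounded Cg; have mg := C0_measurable Cg.
have h := strong_span sg e4.
near=> t => x x0; have t0 : 0 < t by near: t; exact: nbhs_right_gt.
have H : forall x, 0 <= x -> `|S t g x - g x| <= e / 4 by near: t.
have h1 := H _ x0; have h2 := fg _ x0.
have h3 := semigroup_dist (ltW t0) x0 mf fM mg gN fg.
have -> : S t f x - f x = (S t f x - S t g x) + (S t g x - g x) - (f x - g x) by ring.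
rewrite (le_lt_trans (ler_normB _ _))// (le_lt_trans (lerD (ler_normD _ _) (lexx _)))//.
lra.
Unshelve. all: by end_near. Qed.

Lemma radial_feller : feller_semigroup S.
Proof.
split.
- by move=> t f t0 Cf; exact: semigroup_C0.
- move=> t a f g x t0 x0 Cf Cg.
  have [M _ fM] := C0_bounded Cf; have [N _ gN] := C0_bounded Cg.
  exact: (semigroup_comb _ t0 x0 (C0_measurable Cf) fM (C0_measurable Cg) gN).
- move=> t f t0 Cf f01 x x0; have mf := C0_measurable Cf.
  have [M _ fM] := C0_bounded Cf; apply/andP; split.
    rewrite -(semigroup_cst 0 t0 x0); apply: (@semigroup_le _ _ _ _ 0 M) => //.
      by move=> y _; rewrite normr0.
    by move=> y /f01 /andP[].
  rewrite -[leRHS](semigroup_cst 1 t0 x0).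
  apply: (@semigroup_le _ _ _ _ M 1) => //.
    by move=> y _; rewrite normr1.
  by move=> y /f01 /andP[].
- split; first by move=> f x _ _; rewrite semigroup0.
  by move=> s t f x s0 t0 x0 Cf; exact: chapman_kolmogorov.
- by move=> f Cf e e0; exact: semigroup_strong.
Qed.

End radial_semigroup.

(** * The radial part of a stable vector in dimension three *)

Section clamp.
Variable R : realType.
Implicit Types a x y : R.

(** Projection onto [0, 1], written with norms so that continuity is
    immediate. *)
Definition clamp a : R := (`|a| - `|a - 1| + 1) / 2.

Lemma clamp_le0 a : a <= 0 -> clamp a = 0.
Proof.
move=> a0; rewrite /clamp !ler0_norm ?subr_le0 ?(le_trans a0)//.
by field.
Qed.

Lemma clamp_ge1 a : 1 <= a -> clamp a = 1.
Proof.
move=> a1; rewrite /clamp !ger0_norm ?subr_ge0 ?(le_trans _ a1)//.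
by field.
Qed.

Lemma clamp_le1 a : `|clamp a| <= 1.
Proof.
have [a0|/ltW a0] := leP a 0; first by rewrite clamp_le0// normr0.
have [a1|/ltW a1] := leP 1 a; first by rewrite clamp_ge1// normr1.
have -> : clamp a = a.
  by rewrite /clamp (ger0_norm a0) ler0_norm ?subr_le0//; field.
by rewrite ger0_norm.
Qed.

Definition ramp x (n : nat) y : R := clamp (n.+1%:R * (x - y)).

Lemma continuous_ramp x n : continuous (ramp x n).
Proof.
have ca : continuous (fun y : R => n.+1%:R * (x - y)).
  by move=> y; apply: cvgMl_tmp; apply: cvgB; [exact: cvg_cst|exact: cvg_id].
move=> y; apply: cvgMr_tmp; apply: cvgD; last exact: cvg_cst.
apply: cvgB; first by apply: cvg_norm; exact: ca.
by apply: cvg_norm; apply: cvgB; [exact: ca|exact: cvg_cst].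
Qed.

Lemma ramp_C0 x n : C0_halfline (ramp x n).
Proof.
apply/C0_halflineP; split.
  move=> y; have := @continuous_comp _ _ _ (fun y : R => `|y|) (ramp x n) y.
  by apply; [exact: norm_continuous|exact: continuous_ramp].
apply: cvg_near_cst; near=> y; apply: clamp_le0.
by rewrite pmulr_rle0// subr_le0; near: y; apply: nbhs_pinfty_ge; exact: num_real.
Unshelve. all: by end_near. Qed.

Lemma cvg_ramp x y : ramp x n y @[n --> \oo] --> (\1_(`]-oo, x[%classic : set R) y : R).
Proof.
rewrite indicE; have [yx|xy] := ltP y x.
  rewrite mem_set/= ?in_itv//=; apply: cvg_near_cst.
  have xy0 : 0 < x - y by rewrite subr_gt0.
  near=> n; apply: clamp_ge1.
  rewrite -ler_pdivrMr// mul1r ltW//.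
  rewrite (@lt_le_trans _ _ n%:R)// ?ler_nat//; near: n.
  exact: nbhs_infty_gtr.
rewrite memNset/= ?in_itv/= ?ltNge ?xy//.
rewrite (_ : (fun n => _) = fun=> 0); first exact: cvg_cst.
by apply/funext => n; apply: clamp_le0; rewrite pmulr_rle0// subr_le0.
Unshelve. all: by end_near. Qed.

End clamp.

Section laplace_unique.
Variable R : realType.
Local Notation halfline := (`[0%R, +oo[%classic : set (measurableTypeR R)).
Variables m1 m2 : {finite_measure set (measurableTypeR R) -> \bar R}.
Hypothesis m1neg : m1 (~` halfline) = 0%E.
Hypothesis m2neg : m2 (~` halfline) = 0%E.
Hypothesis m12 : forall s : R, 0 < s ->
  \int[m1]_(y in halfline) gauss s y = \int[m2]_(y in halfline) gauss s y.

Let mH : measurable halfline. Proof. by []. Qed.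

Let half0 (y : R) : halfline y -> 0 <= y. Proof. by rewrite /= in_itv/= andbT. Qed.

Let C0_integrable (m : {finite_measure set (measurableTypeR R) -> \bar R}) (f : R -> R) :
  C0_halfline f -> m.-integrable halfline (EFin \o f).
Proof.
move=> Cf; have [M _ fM] := C0_bounded Cf.
apply: (@integrable_finite _ _ R m halfline f M) => //; first exact: C0_measurable.
by move=> y /half0; exact: fM.
Qed.

Let span_eq (g : R -> R) : gauss_span g ->
  \int[m1]_(y in halfline) g y = \int[m2]_(y in halfline) g y.
Proof.
elim=> {g} [|a s f s0 sf IH]; first by rewrite /Rintegral !integral0.
have Cf := gauss_span_C0 sf; have Cg := gauss_C0 s0.
have E (m : {finite_measure set (measurableTypeR R) -> \bar R}) :
    \int[m]_(y in halfline) (a * gauss s y + f y) =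
    a * \int[m]_(y in halfline) gauss s y + \int[m]_(y in halfline) f y.
  have i1 := C0_integrable m Cg.
  rewrite RintegralD//; first by rewrite (RintegralZl a mH i1).
    exact: (integrableZl mH a i1).
  exact: C0_integrable.
by rewrite !E m12// IH.
Qed.

Let C0_eq (f : R -> R) : C0_halfline f ->
  \int[m1]_(y in halfline) f y = \int[m2]_(y in halfline) f y.
Proof.
move=> Cf; apply/eqP; rewrite -subr_eq0 -normr_le0; apply/ler_addgt0Pr => e e0.
rewrite add0r.
pose M : R := fine (m1 halfline) + fine (m2 halfline) + 1.
have a0 : 0 <= fine (m1 halfline) by exact: fine_ge0.
have b0 : 0 <= fine (m2 halfline) by exact: fine_ge0.
have M0 : 0 < M by rewrite ltr_wpDl// addr_ge0.
have [g sg fg] := gauss_span_dense Cf (divr_gt0 e0 M0).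
have Cg := gauss_span_C0 sg.
have D (m : {finite_measure set (measurableTypeR R) -> \bar R}) :
   `|\int[m]_(y in halfline) f y - \int[m]_(y in halfline) g y| <=
     e / M * fine (m halfline).
  have i1 := C0_integrable m Cf; have i2 := C0_integrable m Cg.
  rewrite -RintegralB//; have i3 := integrableB mH i1 i2.
  apply: le_trans (le_normr_Rintegral mH i3) _.
  have <- : \int[m]_(y in halfline) cst (e / M) y = e / M * fine (m halfline).
    by rewrite Rintegral_cst.
  apply: le_Rintegral => //.
  - exact: (integrable_norm i3).
  - exact: finite_measure_integrable_cst.
  - by move=> y /half0; exact: fg.
have -> : \int[m1]_(y in halfline) f y - \int[m2]_(y in halfline) f y =
   (\int[m1]_(y in halfline) f y - \int[m1]_(y in halfline) g y)
   - (\int[m2]_(y in halfline) f y - \int[m2]_(y in halfline) g y).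
  by rewrite (span_eq sg); ring.
apply: le_trans (ler_normB _ _) _; apply: le_trans (lerD (D _) (D _)) _.
rewrite -mulrDr mulrAC ler_pdivrMr// ler_wpM2l ?(ltW e0)//.
by rewrite /M lerDl.
Qed.

Let ray_eq (x : R) : fine (m1 (`]-oo, x[%classic `&` halfline)) =
                     fine (m2 (`]-oo, x[%classic `&` halfline)).
Proof.
have L (m : {finite_measure set (measurableTypeR R) -> \bar R}) :
   \int[m]_(y in halfline) ramp x n y @[n --> \oo] -->
   fine (m (`]-oo, x[%classic `&` halfline)).
  have -> : fine (m (`]-oo, x[%classic `&` halfline)) =
     \int[m]_(y in halfline) (\1_(`]-oo, x[%classic : set R) y).
    by rewrite /Rintegral integral_indic// setIC.
  apply: (@Rintegral_dct _ _ R m halfline (fun n => ramp x n) _ (cst 1)) => //.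
  - by move=> n; apply: C0_measurable; exact: ramp_C0.
  - by move=> y _; exact: cvg_ramp.
  - exact: finite_measure_integrable_cst.
  - by move=> n y _; exact: clamp_le1.
have h1 := L m1; have h2 := L m2.
rewrite (_ : (fun n => _) = (fun n => \int[m2]_(y in halfline) ramp x n y)) in h1.
  exact: (cvg_unique _ h1 h2).
by apply/funext => n; apply: C0_eq; exact: ramp_C0.
Qed.

(** The Gaussians span a dense subspace of C_0, so they separate finite
    measures on the half-line. *)
Lemma gauss_measure_unique A : measurable A -> m1 A = m2 A.
Proof.
have split_ (m : {finite_measure set (measurableTypeR R) -> \bar R}) B :
   m (~` halfline) = 0%E -> measurable B -> m B = m (B `&` halfline).
  move=> mneg mB.
  have e0 : m (B `\` halfline) = 0%E.
    apply: (@subset_measure0 _ _ _ m _ (~` halfline)) => //.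
    - exact: measurableD.
    - exact: measurableC.
  transitivity (0 + m (B `&` halfline))%E; last by rewrite add0e.
  by rewrite -e0; exact: measureDI.
move=> mA.
apply: (@g_sigma_algebra_measure_unique _ R (measurableTypeR R)
  (@RGenInftyO.G R) _ (fun n => `]-oo, n%:R[%classic)).
- by move=> _ [x ->].
- by move=> n; exists n%:R.
- rewrite -subTset => y _; exists (Num.trunc `|y|).+1 => //=.
  rewrite in_itv/=; apply: le_lt_trans (ler_norm y) _.
  exact: Num.Theory.truncnS_gt.
- move=> _ _ [x ->] [y ->]; exists (Num.min x y).
  apply/seteqP; split=> z /=; rewrite !in_itv/= lt_min; first by case=> -> ->.
  by move=> /andP[].
- move=> _ [x ->].
  have mI : measurable (`]-oo, x[%classic `&` halfline : set (measurableTypeR R)).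
    exact: measurableI.
  have mx : measurable (`]-oo, x[%classic : set (measurableTypeR R)) by [].
  apply: etrans (split_ m1 _ m1neg mx) _; apply: etrans _ (esym (split_ m2 _ m2neg mx)).
  apply: etrans (esym (fineK (fin_num_measure m1 _ mI))) _.
  by rewrite ray_eq; exact: fineK (fin_num_measure m2 _ mI).
- by move=> n; rewrite ltey_eq fin_num_measure.
- have := congr1 (fun F => F A) (@RGenInftyO.measurableE R).
  by move=> E; have : (RGenInftyO.G (R:=R)).-sigma.-measurable A by rewrite -E.
Qed.

End laplace_unique.

Section product_probability.
Context d1 (T1 : measurableType d1) d2 (T2 : measurableType d2) (R : realType).
Variables (P1 : probability T1 R) (P2 : probability T2 R).

Lemma Rintegral_prod (F : T1 * T2 -> R) (C : R) :
  measurable_fun setT F -> (forall z, `|F z| <= C) ->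
  \int[(P1 \x P2)%E]_z F z = \int[P1]_x \int[P2]_y F (x, y).
Proof.
move=> mF FC.
pose P12 : probability (T1 * T2)%type R := (P1 \x P2)%E.
have iF : (P1 \x P2)%E.-integrable setT (EFin \o F).
  by apply: (@integrable_finite _ _ R P12 setT F C).
rewrite /Rintegral; congr fine; rewrite -integral12_prod_meas1//.
apply: eq_integral => x _; rewrite /fubini_F /= fineK//.
apply: (integrable_fin_num measurableT).
apply: (@integrable_finite _ _ R P2 setT (fun y => F (x, y)) C) => //.
exact: measurableT_comp mF (measurable_pair1 _).
Qed.

End product_probability.

Section gaussian_vector.
Variables (R : realType) (s : R).
Hypothesis s0 : 0 < s.
Local Notation mu := (@lebesgue_measure R).
Let a0 : R := (4 * s)^-1.
Let a0_gt0 : 0 < a0. Proof. by rewrite invr_gt0 mulr_gt0. Qed.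
Let sg : R := Num.sqrt (2 * s).

(** The probability with density proportional to [gauss (4 * s)^-1], whose
    characteristic function is [gauss s]. *)
Definition gaussP : probability (measurableTypeR R) R := normal_prob 0 sg.

Let sg2 : sg ^+ 2 *+ 2 = 4 * s.
Proof. by rewrite /sg sqr_sqrtr ?mulr_ge0 ?(ltW s0)// -mulr_natl mulrA -natrM. Qed.

Let sg_neq0 : sg != 0.
Proof. by rewrite gt_eqF// sqrtr_gt0 mulr_gt0. Qed.

Let pdfE x : normal_pdf 0 sg x = normal_peak sg * gauss a0 x.
Proof.
rewrite normal_pdfE// -[LHS]/(normal_peak sg * normal_fun 0 sg x).
rewrite /normal_fun sg2 subr0 /gauss /a0.
by congr (_ * expR _); rewrite mulNr mulrC.
Qed.

Let peakE : normal_peak sg = (gaussZ a0)^-1.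
Proof.
have := @integral_normal_pdf R 0 sg.
have [ig _] := integrable_gauss a0_gt0.
under eq_integral do rewrite pdfE.
move=> /(congr1 fine); rewrite -/(Rintegral _ _ _) (RintegralZl _ measurableT ig) /=.
rewrite -/(gaussZ a0) => E; have Z0 := gaussZ_gt0 a0_gt0.
by rewrite -[RHS]mul1r -E mulfK// gt_eqF.
Qed.

Lemma gaussPE (h : R -> R) (C : R) :
  measurable_fun setT h -> (forall x, `|h x| <= C) ->
  \int[gaussP]_x h x = (gaussZ a0)^-1 * \int[mu]_x (h x * gauss a0 x).
Proof.
move=> mh hC; have [ig _] := integrable_gauss a0_gt0.
have i_f : mu.-integrable setT (EFin \o normal_pdf 0 sg) by exact: integrable_normal_pdf.
have f0 := @normal_pdf_ge0 R 0 sg.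
pose nu : {finite_measure set (measurableTypeR R) -> \bar R} := density_measure i_f f0.
have i_h : nu.-integrable setT (EFin \o h).
  by apply: (@integrable_finite _ _ R nu setT h C).
rewrite -[LHS]/(\int[nu]_x h x) (integral_density_measure i_h).
have ihg : mu.-integrable setT (EFin \o (fun x => h x * gauss a0 x)).
  apply: (@integrable_dom _ _ R mu setT _ (fun x => C * gauss a0 x)) => //.
  - by apply: measurable_funM => //; exact: measurable_gauss.
  - exact: (integrableZl measurableT C ig).
  - by move=> x _; rewrite normrM (ger0_norm (gauss_ge0 _ _)) ler_wpM2r ?gauss_ge0.
rewrite -(RintegralZl _ measurableT ihg); apply: eq_Rintegral => x _.
by rewrite pdfE peakE mulrCA.
Qed.

Let mcos (x b : R) : measurable_fun setT (fun th : R => cos (b + th * x)).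
Proof.
apply: measurableT_comp; first exact: continuous_measurable_fun (@continuous_cos R).
by apply: measurable_funD => //; exact: measurable_funM.
Qed.

(** Fourier transform in one coordinate, the others contributing a phase. *)
Let cos_gaussP u x b : 0 <= u ->
  \int[gaussP]_th (cos (b + th * x) * gauss u th) =
  gaussZ (a0 + u) / gaussZ a0 * gauss (4 * (a0 + u))^-1 x * cos b.
Proof.
move=> u0; have au0 : 0 < a0 + u by rewrite ltr_pwDl.
rewrite (@gaussPE _ 1); first last.
- move=> th; rewrite normrM (ger0_norm (gauss_ge0 _ _)) mulr_ile1 ?gauss_ge0//.
    exact: cos_max.
  exact: gauss_le1.
- by apply: measurable_funM; [exact: mcos|exact: measurable_gauss].
under eq_Rintegral do rewrite -mulrA -gaussD (addrC u).
have ic := integrable_cos_gauss x au0.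
have is_ : mu.-integrable setT (EFin \o (fun th => sin (x * th) * gauss (a0 + u) th)).
  apply: (@integrable_poly_gauss R _ 1) => //.
    apply: measurableT_comp; last exact: measurable_funM.
    exact: continuous_measurable_fun (@continuous_sin R).
  by move=> th; rewrite mul1r (le_trans (sin_max _))// lerDl sqr_ge0.
have s_0 : \int[mu]_th (sin (x * th) * gauss (a0 + u) th) = 0.
  have [_ E] := integral_reflect is_.
  have := RintegralZl (-1) measurableT is_.
  have -> : \int[mu]_th (-1 * (sin (x * th) * gauss (a0 + u) th)) =
            \int[mu]_th (sin (x * - th) * gauss (a0 + u) (- th)).
    by apply: eq_Rintegral => th _; rewrite gaussN mulrN sinN; ring.
  by rewrite -E; move: (Rintegral _ _ _) => I; lra.
transitivity ((gaussZ a0)^-1 * \int[mu]_th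
    (cos b * (cos (x * th) * gauss (a0 + u) th) +
     - sin b * (sin (x * th) * gauss (a0 + u) th))).
  congr (_ * _); apply: eq_Rintegral => th _.
  by rewrite cosD (mulrC th); ring.
rewrite RintegralD//; last 2 first.
- exact: (integrableZl measurableT _ ic).
- exact: (integrableZl measurableT _ is_).
rewrite (RintegralZl _ measurableT ic) (RintegralZl _ measurableT is_) s_0.
rewrite -/(fourier_gauss (a0 + u) x) fourier_gaussE//; ring.
Qed.

Definition gaussP3 : probability ((measurableTypeR R * measurableTypeR R) * measurableTypeR R)%type R :=
  ((gaussP \x gaussP) \x gaussP)%E.

Let sqr3 (z : (R * R) * R) : R := z.1.1 ^+ 2 + z.1.2 ^+ 2 + z.2 ^+ 2.
Let dot3 x1 x2 x3 (z : (R * R) * R) : R := z.1.1 * x1 + z.1.2 * x2 + z.2 * x3.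

(** The coordinates are integrated out one at a time; only the cosine part
    survives because the Gaussian is even. *)
Lemma cos_gaussP3 u x1 x2 x3 : 0 <= u ->
  \int[gaussP3]_z (cos (dot3 x1 x2 x3 z) * expR (- (u * sqr3 z))) =
  (gaussZ (a0 + u) / gaussZ a0) ^+ 3 *
    gauss (4 * (a0 + u))^-1 (Num.sqrt (x1 ^+ 2 + x2 ^+ 2 + x3 ^+ 2)).
Proof.
move=> u0; set k := _ / _; set v := (4 * _)^-1.
have mu_ : measurable_fun setT (gauss u : R -> R) by exact: measurable_gauss.
have mc : measurable_fun setT (@cos R) by exact: continuous_measurable_fun (@continuous_cos R).
have b1 (c y1 y2 y3 : R) : `|cos c * (gauss u y1 * gauss u y2 * gauss u y3)| <= 1.
  rewrite normrM mulr_ile1 ?cos_max// ger0_norm.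
    by rewrite !mulr_ile1 ?mulr_ge0 ?gauss_ge0 ?gauss_le1.
  by rewrite !mulr_ge0 ?gauss_ge0.
have gE z : expR (- (u * sqr3 z)) = gauss u z.1.1 * gauss u z.1.2 * gauss u z.2.
  by rewrite /gauss -!expRD /sqr3; congr expR; ring.
under eq_Rintegral do rewrite gE.
have icg (b x : R) : gaussP.-integrable setT (EFin \o (fun y => cos (b + y * x) * gauss u y)).
  apply: (@integrable_finite _ _ R gaussP setT _ 1) => //.
    by apply: measurable_funM => //; exact: mcos.
  by move=> y _; have := b1 (b + y * x) y 0 0; rewrite gauss0 !mulr1.
have m2 : measurable_fun setT (fun z : measurableTypeR R * measurableTypeR R =>
    cos (z.1 * x1 + z.2 * x2) * (gauss u z.1 * gauss u z.2)).
  have f1 : measurable_fun setT (@fst (measurableTypeR R) (measurableTypeR R)) := measurable_fst.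
  have f2 : measurable_fun setT (@snd (measurableTypeR R) (measurableTypeR R)) := measurable_snd.
  apply: measurable_funM; last first.
    by apply: measurable_funM; [exact: measurableT_comp f1|exact: measurableT_comp f2].
  by apply: (measurableT_comp mc); apply: measurable_funD; exact: measurable_funM.
have m3 : measurable_fun setT (fun z : (measurableTypeR R * measurableTypeR R) * measurableTypeR R =>
    cos (dot3 x1 x2 x3 z) * (gauss u z.1.1 * gauss u z.1.2 * gauss u z.2)).
  have f1 : measurable_fun setT (fun z : (measurableTypeR R * measurableTypeR R) * measurableTypeR R => z.1.1).
    exact: (measurableT_comp measurable_fst measurable_fst).
  have f2 : measurable_fun setT (fun z : (measurableTypeR R * measurableTypeR R) * measurableTypeR R => z.1.2).
    exact: (measurableT_comp measurable_snd measurable_fst).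
  have f3 : measurable_fun setT (fun z : (measurableTypeR R * measurableTypeR R) * measurableTypeR R => z.2).
    exact: measurable_snd.
  apply: measurable_funM; last first.
    apply: measurable_funM; last exact: measurableT_comp f3.
    by apply: measurable_funM; [exact: measurableT_comp f1|exact: measurableT_comp f2].
  apply: (measurableT_comp mc); apply: measurable_funD; last exact: measurable_funM.
  by apply: measurable_funD; exact: measurable_funM.
rewrite (@Rintegral_prod _ _ _ _ _ _ _ _ 1)//.
have i2 : (gaussP \x gaussP)%E.-integrable setT (EFin \o (fun z : R * R =>
    cos (z.1 * x1 + z.2 * x2) * (gauss u z.1 * gauss u z.2))).
  pose G2 : probability (measurableTypeR R * measurableTypeR R)%type R := (gaussP \x gaussP)%E.
  apply: (@integrable_finite _ _ R G2 setT _ 1) => //.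
  by move=> z _; have := b1 (z.1 * x1 + z.2 * x2) z.1 z.2 0; rewrite gauss0 mulr1.
transitivity (\int[(gaussP \x gaussP)%E]_z
   (k * gauss v x3 * (cos (z.1 * x1 + z.2 * x2) * (gauss u z.1 * gauss u z.2)))).
  apply: eq_Rintegral => z _ /=.
  transitivity (gauss u z.1 * gauss u z.2 *
     \int[gaussP]_y (cos ((z.1 * x1 + z.2 * x2) + y * x3) * gauss u y)).
    rewrite -(RintegralZl _ measurableT (icg _ _)).
    by apply: eq_Rintegral => y _; rewrite /dot3/=; ring.
  rewrite cos_gaussP// -/k -/v; ring.
rewrite (RintegralZl _ measurableT i2) (@Rintegral_prod _ _ _ _ _ _ _ _ 1)//; last first.
  by move=> z; have := b1 (z.1 * x1 + z.2 * x2) z.1 z.2 0; rewrite gauss0 mulr1.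
transitivity (k * gauss v x3 * \int[gaussP]_y
   (k * gauss v x2 * (cos (0 + y * x1) * gauss u y))).
  congr (_ * _); apply: eq_Rintegral => y _ /=.
  transitivity (gauss u y * \int[gaussP]_z (cos (y * x1 + z * x2) * gauss u z)).
    rewrite -(RintegralZl _ measurableT (icg _ _)).
    by apply: eq_Rintegral => z _; ring.
  by rewrite cos_gaussP// -/k -/v add0r; ring.
rewrite (RintegralZl _ measurableT (icg _ _)) cos_gaussP// -/k -/v cos0.
have -> : gauss v (Num.sqrt (x1 ^+ 2 + x2 ^+ 2 + x3 ^+ 2)) =
    gauss v x1 * gauss v x2 * gauss v x3.
  rewrite /gauss sqr_sqrtr; first by rewrite -!expRD; congr expR; ring.
  by rewrite addr_ge0 ?sqr_ge0// addr_ge0 ?sqr_ge0.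
ring.
Qed.

End gaussian_vector.

Section radial_expectation.
Variables (R : realType) (alpha : R).
Hypothesis halpha : 0 < alpha < 2.
Local Notation mu := (@lebesgue_measure R).
Local Notation cf := (stable_cf alpha).
Local Notation K := (radial_kernel alpha).
Local Notation halfline := (`[0%R, +oo[%classic : set R).
Context d (T : measurableType d) (P : probability T R).
Variables (D : T -> 'rV[R]_3) (t : R).
Hypothesis mD : forall i, measurable_fun setT (fun w => D w 0 i).
Hypothesis t0 : 0 < t.
Hypothesis hcos : forall th, \int[P]_w cos (dotv th (D w)) = cf t (enorm th).
Hypothesis hsin : forall th, \int[P]_w sin (dotv th (D w)) = 0.

Let vec3 (z : (R * R) * R) : 'rV[R]_3 := \row_i [:: z.1.1; z.1.2; z.2]`_i.

Let dotv3 (u v : 'rV[R]_3) :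
  dotv u v = u 0 0 * v 0 0 + u 0 1 * v 0 1 + u 0 2%R * v 0 2%R.
Proof.
rewrite /dotv !big_ord_recl big_ord0 addr0 addrA.
by congr (_ * _ + _ * _ + _ * _); congr (_ _ _); apply/val_inj.
Qed.

Let dot_vec3 z v : dotv (vec3 z) v = z.1.1 * v 0 0 + z.1.2 * v 0 1 + z.2 * v 0 2%R.
Proof. by rewrite dotv3 !mxE. Qed.

Let enorm3 (v : 'rV[R]_3) :
  enorm v = Num.sqrt (v 0 0 ^+ 2 + v 0 1 ^+ 2 + v 0 2%R ^+ 2).
Proof. by rewrite /enorm dotv3 !expr2. Qed.

Let dotvD (u v w : 'rV[R]_3) : dotv u (v + w) = dotv u v + dotv u w.
Proof. by rewrite !dotv3 !mxE; ring. Qed.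

Let sqr3 (z : (R * R) * R) : R := z.1.1 ^+ 2 + z.1.2 ^+ 2 + z.2 ^+ 2.

Let mcos : measurable_fun setT (@cos R).
Proof. exact: continuous_measurable_fun (@continuous_cos R). Qed.
Let m1 : measurable_fun setT (fun z : (measurableTypeR R * measurableTypeR R) * measurableTypeR R => z.1.1).
Proof. exact: (measurableT_comp measurable_fst measurable_fst). Qed.
Let m2 : measurable_fun setT (fun z : (measurableTypeR R * measurableTypeR R) * measurableTypeR R => z.1.2).
Proof. exact: (measurableT_comp measurable_snd measurable_fst). Qed.
Let m3 : measurable_fun setT (fun z : (measurableTypeR R * measurableTypeR R) * measurableTypeR R => z.2).
Proof. exact: measurable_snd. Qed.

Let mdotD th : measurable_fun setT (fun w => dotv th (D w)).
Proof.
under eq_fun do rewrite dotv3.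
by apply: measurable_funD; [apply: measurable_funD|]; apply: measurable_funM.
Qed.

(** exp(- s |v|^2) is the characteristic function of a Gaussian vector. *)
Let gauss_fourier3 (s : R) (v : 'rV[R]_3) : 0 < s ->
  gauss s (enorm v) = \int[gaussP3 s]_z cos (dotv (vec3 z) v).
Proof.
move=> s0; have := @cos_gaussP3 R s s0 0 (v 0 0) (v 0 1) (v 0 2%R) (lexx 0).
have Z0 : gaussZ (4 * s)^-1 != 0.
  by rewrite gt_eqF// gaussZ_gt0// invr_gt0 mulr_gt0.
rewrite addr0 divff// expr1n mul1r -enorm3.
have -> : (4 * (4 * s)^-1)^-1 = s by field; rewrite gt_eqF.
move=> <-; apply: eq_Rintegral => z _.
by rewrite mul0r oppr0 expR0 mulr1 dot_vec3.
Qed.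

Let expectation_cosD th v :
  \int[P]_w cos (dotv th (v + D w)) = cos (dotv th v) * cf t (enorm th).
Proof.
transitivity (\int[P]_w (cos (dotv th v) * cos (dotv th (D w)) +
                        - sin (dotv th v) * sin (dotv th (D w)))).
  by apply: eq_Rintegral => w _; rewrite dotvD cosD; ring.
exact: expectation_cos_sin.
Qed.

(** The constants of the Cartesian and of the polar computation agree. *)
Let kappa (s u : R) : 0 < s -> 0 <= u -> let a := (4 * s)^-1 in
  (gaussZ (a + u) / gaussZ a) ^+ 3 =
  gaussZ s / (4 * pi * s) * (gaussZ (a + u) / (2 * (a + u))).
Proof.
move=> s0 u0 a; have a0 : 0 < a by rewrite invr_gt0 mulr_gt0.
have au0 : 0 < a + u by rewrite ltr_pwDl.
have E1 := gaussZ_dual s0; rewrite -/a in E1.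
have [_ Es] := integrable_gauss s0; have [_ Ea] := integrable_gauss a0.
have [_ Eu] := integrable_gauss au0.
have p0 : 0 < (pi : R) by exact: pi_gt0.
have sq (b : R) : 0 < b -> gaussZ b = Num.sqrt pi / Num.sqrt b ->
    gaussZ b ^+ 2 = pi / b.
  move=> b0 ->; rewrite expr_div_n !sqr_sqrtr ?ltW//.
have Qa := sq _ a0 Ea; have Qu := sq _ au0 Eu; have Qs := sq _ s0 Es.
have Zs := gaussZ_gt0 s0; have Za := gaussZ_gt0 a0; have Zu := gaussZ_gt0 au0.
have aE : a = (4 * s)^-1 by [].
rewrite exprSr expr_div_n Qa Qu.
have -> : gaussZ s = 2 * pi / gaussZ a by rewrite -E1 mulfK// gt_eqF.
move: (gaussZ a) (gaussZ (a + u)) Za Zu => z y z0 y0.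
have -> : s = (4 * a)^-1 by rewrite aE; field; rewrite gt_eqF.
move: (pi : R) p0 => p p0.
by field; rewrite !gt_eqF.
Qed.

Let cf_vec3 z : cf t (enorm (vec3 z)) = expR (- (t * sqr3 z `^ (alpha / 2))).
Proof.
rewrite /stable_cf enorm3 sqr_sqrtr ?mxE//.
by rewrite addr_ge0 ?sqr_ge0// addr_ge0 ?sqr_ge0.
Qed.

(** Writing the Gaussian as a superposition of characters gives an integral
    over R^3 of exp(- t |th|^alpha); it agrees with its radial form because both
    are explicit when exp(- t |th|^alpha) is replaced by a Gaussian. *)
Lemma expectation_gauss_radial (s : R) (x : 'rV[R]_3) : 0 < s ->
  \int[P]_w gauss s (enorm (x + D w)) =
  \int[mu]_th (gauss_spectral s th * sinc (th * enorm x) * cf t th).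
Proof.
move=> s0.
pose F w (z : (measurableTypeR R * measurableTypeR R) * measurableTypeR R) :=
  cos (dotv (vec3 z) (x + D w)).
have mF : measurable_fun setT (fun y : T * ((measurableTypeR R * measurableTypeR R) * measurableTypeR R) =>
    F y.1 y.2).
  apply: (measurableT_comp mcos); under eq_fun do rewrite dot_vec3 !mxE.
  have mD' i : measurable_fun setT (fun y : T * ((measurableTypeR R * measurableTypeR R) * measurableTypeR R) =>
      x 0 i + D y.1 0 i).
    by apply: measurable_funD => //; exact: (measurableT_comp (mD i) measurable_fst).
  apply: measurable_funD; [apply: measurable_funD|]; apply: measurable_funM => //.
  - exact: (measurableT_comp m1 measurable_snd).
  - exact: (measurableT_comp m2 measurable_snd).
  - exact: (measurableT_comp m3 measurable_snd).
have i1 : P.-integrable setT (EFin \o cst (1 : R)) by exact: finite_measure_integrable_cst.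
have i2 : (gaussP3 s).-integrable setT (EFin \o cst (1 : R)).
  exact: finite_measure_integrable_cst.
have bF w z : setT w -> setT z -> `|F w z| <= cst 1 w * cst 1 z.
  by move=> _ _; rewrite /cst mulr1 cos_max.
have [_ E] := @Rintegral_fubini _ _ _ _ R P (gaussP3 s) setT setT F (cst 1) (cst 1)
  measurableT measurableT mF i1 i2 bF.
transitivity (\int[P]_w \int[gaussP3 s]_z F w z).
  by apply: eq_Rintegral => w _; exact: gauss_fourier3.
rewrite E.
pose w1 z := cos (dotv (vec3 z) x).
pose w2 th := gauss_spectral s th * sinc (th * enorm x).
pose phi (l : R) := expR (- (t * l `^ (alpha / 2))).
transitivity (\int[gaussP3 s]_z (w1 z * phi (sqr3 z))).
  by apply: eq_Rintegral => z _; rewrite expectation_cosD cf_vec3.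
apply: (@exp_mix_integral_eq _ _ _ _ R (gaussP3 s) mu sqr3 w1 (fun th => th ^+ 2) w2 phi).
- apply: measurable_funD; last exact: measurable_funX.
  by apply: measurable_funD; exact: measurable_funX.
- exact: measurable_funX.
- by move=> z; rewrite addr_ge0 ?sqr_ge0// addr_ge0 ?sqr_ge0.
- by move=> th; exact: sqr_ge0.
- apply: (@integrable_finite _ _ R (gaussP3 s) setT _ 1) => //.
    apply: (measurableT_comp mcos); rewrite [X in measurable_fun _ X](_ : _ =
      fun z => z.1.1 * x 0 0 + z.1.2 * x 0 1 + z.2 * x 0 2%R); last first.
      by apply/funext => z; rewrite dot_vec3.
    by apply: measurable_funD; [apply: measurable_funD|]; apply: measurable_funM.
  by move=> z _; exact: cos_max.
- have := integrable_gauss_spectral_cf alpha (enorm x) s0 (lexx 0).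
  rewrite (_ : (fun th => _) = w2)//; apply/funext => th.
  by rewrite /stable_cf mul0r oppr0 expR0 mulr1.
- move=> u u0.
  have -> : \int[mu]_th (w2 th * expR (- (u * th ^+ 2))) =
    \int[mu]_th (gauss_spectral s th * sinc (th * enorm x) * gauss u th) by [].
  rewrite gauss_spectral_mix// -kappa// enorm3 -cos_gaussP3//.
  by apply: eq_Rintegral => z _; rewrite /w1 dot_vec3.
- exact: stable_cf_exp_mix (ltW t0).
Qed.

Let half0 (y : R) : halfline y -> 0 <= y. Proof. by rewrite /= in_itv/= andbT. Qed.

Let mnorm (x : 'rV[R]_3) : measurable_fun setT (fun w => enorm (x + D w) : measurableTypeR R).
Proof.
under eq_fun do rewrite enorm3 !mxE.
apply: (measurableT_comp (continuous_measurable_fun (@sqrt_continuous R))).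
by apply: measurable_funD; [apply: measurable_funD|]; apply: measurable_funX; apply: measurable_funD.
Qed.

(** The law of |x + D| and the kernel started from |x| integrate Gaussians
    alike, and Gaussians separate measures on the half-line. *)
Lemma expectation_radial (x : 'rV[R]_3) (f : R -> R) (M : R) :
  measurable_fun setT f -> (forall y, `|f y| <= M) ->
  \int[P]_w f (enorm (x + D w)) =
  \int[mu]_(y in halfline) (f y * K t (enorm x) y).
Proof.
move=> mf fM; set r := enorm x.
have r0 : 0 <= r by exact: sqrtr_ge0.
have mH : measurable (halfline : set (measurableTypeR R)) by [].
have iK := integrable_radial_kernel halpha t0 r0.
pose k := (K t r) \_ halfline.
have ik : mu.-integrable setT (EFin \o k).
  by rewrite /k -restrict_EFin; apply: (integrable_mkcond _ mH).1.
have k0 y : 0 <= k y.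
  rewrite /k patchE; case: ifPn => // /set_mem /half0 y0.
  exact: radial_kernel_ge0.
pose nu : {finite_measure set (measurableTypeR R) -> \bar R} := density_measure ik k0.
have intnu (g : R -> R) (C : R) : measurable_fun setT g -> (forall y, `|g y| <= C) ->
    \int[nu]_y g y = \int[mu]_(y in halfline) (g y * K t r y).
  move=> mg gC; have ig : nu.-integrable setT (EFin \o g).
    exact: (@integrable_finite _ _ R nu setT g C).
  rewrite (integral_density_measure ig) [RHS]Rintegral_mkcond.
  apply: eq_Rintegral => y _; rewrite /k !patchE.
  by case: ifP => //; rewrite mulr0.
have nunull : nu (~` halfline) = 0%E.
  rewrite -[LHS]/(\int[mu]_(y in ~` halfline) (k y)%:E)%E.
  apply: integral0_eq => y yH; rewrite /k patchE memNset//.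
pose m := law P (mnorm x).
have mnull : m (~` halfline) = 0%E.
  rewrite -[LHS]/(P _) (_ : _ @^-1` _ = set0) ?measure0//.
  apply/seteqP; split => // w; apply.
  by rewrite /= in_itv/= andbT sqrtr_ge0.
have restr (m' : {finite_measure set (measurableTypeR R) -> \bar R}) (s : R) :
    0 < s -> m' (~` halfline) = 0%E ->
    \int[m']_(y in halfline) gauss s y = \int[m']_y gauss s y.
  move=> s0 m0.
  have ig : m'.-integrable setT (EFin \o gauss s).
    apply: (@integrable_finite _ _ R m' setT _ 1) => //; first exact: measurable_gauss.
    by move=> y _; rewrite ger0_norm ?gauss_ge0// gauss_le1// ltW.
  rewrite /Rintegral; congr fine.
  rewrite [RHS](negligible_integral (measurableC mH) measurableT ig m0).
  by rewrite setTD setCK.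
have E A : measurable A -> m A = nu A.
  apply: gauss_measure_unique => // s s0.
  have b1 y : `|gauss s y| <= 1 by rewrite ger0_norm ?gauss_ge0// gauss_le1// ltW.
  have mg := measurable_gauss s.
  rewrite (restr m)// (restr nu)// (intnu _ 1)//.
  have [_ ->] := integral_gauss_radial_kernel halpha r s0 t0.
  have EL := @Rintegral_law _ T _ (measurableTypeR R) R P _ (mnorm x) (gauss s) 1 mg b1.
  rewrite -/m in EL; apply: etrans EL _.
  exact: expectation_gauss_radial.
have EL := @Rintegral_law _ T _ (measurableTypeR R) R P _ (mnorm x) f M mf fM.
rewrite -(intnu f M)//; apply: etrans (esym EL) _; rewrite /Rintegral; congr fine.
by apply: (@eq_measure_integral _ _ R setT nu m) => A mA _; exact: E.
Qed.

End radial_expectation.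

(** * Laws of Markov processes on paths *)

Section scheffe.
Variables (R : realType) (alpha : R).
Hypothesis halpha : 0 < alpha < 2.
Local Notation mu := (@lebesgue_measure R).
Local Notation K := (radial_kernel alpha).
Local Notation halfline := (`[0%R, +oo[%classic : set R).

Let half0 y : halfline y -> 0 <= y. Proof. by rewrite /= in_itv/= andbT. Qed.

(** Scheffe: pointwise convergence of probability densities is convergence in
    L^1, because the positive part of the difference is dominated. *)
Lemma cvg_kernel_integral (t x M : R) (u : nat -> R) (f : R -> R) : 0 < t -> 0 <= x ->
  (forall n, 0 <= u n) -> u n @[n --> \oo] --> x ->
  measurable_fun setT f -> (forall y, `|f y| <= M) ->
  \int[mu]_(y in halfline) (f y * K t (u n) y) @[n --> \oo] -->
  \int[mu]_(y in halfline) (f y * K t x y).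
Proof.
move=> t0 x0 u0 ux mf fM.
have mH : measurable (halfline : set (measurableTypeR R)) by [].
have M0 : 0 <= M by apply: le_trans (fM 0).
have iK v (v0 : 0 <= v) := integrable_radial_kernel halpha t0 v0.
have ifK v : 0 <= v -> mu.-integrable halfline (EFin \o (fun y => f y * K t v y)).
  move=> v0; apply: (@integrable_dom _ _ R mu halfline _ (fun y => M * K t v y)) => //.
  - apply: measurable_funTS; apply: measurable_funM => //.
    exact: measurable_radial_kernel.
  - exact: (integrableZl mH M (iK _ v0)).
  - move=> y /half0 y0; rewrite normrM (ger0_norm (radial_kernel_ge0 _ _ _ _))//.
    by rewrite ler_wpM2r ?radial_kernel_ge0.
pose pos n y := (`|K t x y - K t (u n) y| + (K t x y - K t (u n) y)) / 2.
have mpos n : measurable_fun halfline (pos n).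
  have mK v : measurable_fun halfline (K t v).
    by apply: measurable_funTS; exact: measurable_radial_kernel.
  apply: measurable_funM => //; apply: measurable_funD.
    by apply: measurableT_comp => //; exact: measurable_funB.
  exact: measurable_funB.
have posK n y : halfline y -> `|pos n y| <= K t x y.
  move=> /half0 y0; have k1 := radial_kernel_ge0 halpha t0 x0 y0.
  have k2 := radial_kernel_ge0 halpha t0 (u0 n) y0.
  rewrite /pos; move: (K t x y) (K t (u n) y) k1 k2 => a b a0 b0.
  have [ab|/ltW ab] := leP b a.
    rewrite (ger0_norm (_ : 0 <= a - b)) ?subr_ge0// ger0_norm; lra.
  rewrite (ler0_norm (_ : a - b <= 0)) ?subr_le0// addNr mul0r normr0//.
have ipos n : mu.-integrable halfline (EFin \o pos n).
  exact: (@integrable_dom _ _ R mu halfline _ (K t x)) mH (mpos n) (iK _ x0) (posK n).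
have pos_0 : \int[mu]_(y in halfline) pos n y @[n --> \oo] --> (0 : R).
  rewrite [X in _ --> X](_ : _ = \int[mu]_(y in halfline) (0 : R)); last first.
    by rewrite /Rintegral integral0.
  apply: (@Rintegral_dct _ _ R mu halfline pos _ (K t x)) => //; last exact: iK.
  move=> y _; have h := @cvg_radial_kernel R alpha halpha t u x y t0 ux.
  have h1 : K t x y - K t (u n) y @[n --> \oo] --> (0 : R).
    by rewrite -[X in _ --> X](subrr (K t x y)); apply: cvgB; [exact: cvg_cst|exact: h].
  have h2 : `|K t x y - K t (u n) y| @[n --> \oo] --> (0 : R).
    by rewrite -[X in _ --> X](@normr0 _ R); apply: cvg_norm.
  have h3 := cvgMr_tmp (b := 2^-1) (cvgD h2 h1).
  rewrite addr0 mul0r in h3; exact: h3.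
have dist n : `|\int[mu]_(y in halfline) (f y * K t (u n) y) -
                \int[mu]_(y in halfline) (f y * K t x y)| <=
    M * (2 * \int[mu]_(y in halfline) pos n y).
  rewrite -RintegralB//; [|exact: ifK|exact: ifK].
  have i3 := integrableB mH (ifK _ (u0 n)) (ifK _ x0).
  apply: le_trans (le_normr_Rintegral mH i3) _.
  have i4 := integrableB mH (iK _ (u0 n)) (iK _ x0).
  have mass : \int[mu]_(y in halfline) (K t (u n) y - K t x y) = 0.
    by rewrite RintegralB//; [rewrite /Rintegral !radial_kernel_mass// subrr|exact: iK|exact: iK].
  have -> : M * (2 * \int[mu]_(y in halfline) pos n y) =
     \int[mu]_(y in halfline) (M * (2 * pos n y + (K t (u n) y - K t x y))).
    have i2 := integrableZl mH 2 (ipos n).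
    rewrite (RintegralZl _ mH (integrableD mH i2 i4)).
    by rewrite RintegralD// mass addr0 (RintegralZl _ mH (ipos n)).
  apply: le_Rintegral => //.
  - exact: (integrable_norm i3).
  - exact: (integrableZl mH M (integrableD mH (integrableZl mH 2 (ipos n)) i4)).
  - move=> y _; rewrite -mulrBr normrM ler_pM//.
    by rewrite /pos distrC; lra.
apply/cvgrPdist_le => e e0.
have L : M * (2 * \int[mu]_(y in halfline) pos n y) @[n --> \oo] --> (0 : R).
  have h := cvgMl_tmp (a := M) (cvgMl_tmp (a := 2) pos_0).
  rewrite !mulr0 in h; exact: h.
move/cvgrPdist_le : L => /(_ e e0); apply: filterS => n.
rewrite sub0r normrN distrC => h; apply: le_trans (dist n) _.
by apply: le_trans h; exact: ler_norm.
Qed.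

Variable p : R -> R -> R -> R.
Hypothesis pK : forall t x y : R, 0 < t -> 0 <= x -> 0 <= y -> p t x y = K t x y.
Local Notation S := (density_semigroup p).

(** The absolute value extends the image function off the half-line, where the
    kernel is unspecified. *)
Lemma semigroup_bounded_measurable (t M : R) (f : R -> R) : 0 <= t ->
  measurable_fun setT f -> (forall y, `|f y| <= M) ->
  exists g : R -> R, [/\ measurable_fun setT g, (forall y, `|g y| <= M) &
    forall x, 0 <= x -> g x = S t f x].
Proof.
rewrite le_eqVlt => /predU1P[<-|t0] mf fM.
  by exists f; split => // x _; rewrite semigroup0.
exists (fun x => \int[mu]_(y in halfline) (f y * K t `|x| y)); split.
- apply: continuous_measurable_fun => x; apply/continuous_withinNx.
  apply/cvgr_dnbhsP => u [_ ux].
  apply: (@cvg_kernel_integral t `|x| M (fun n => `|u n|)) => //.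
  exact: cvg_norm ux.
- move=> y; rewrite -(semigroupE pK)//.
  apply: (semigroup_norm halpha pK (ltW t0)) => //; first exact: measurable_funTS.
- by move=> x x0; rewrite ger0_norm// (semigroupE pK).
Qed.

End scheffe.

Definition visits (R : realType) T (Z : R -> T -> R) (t : nat -> R)
    (B : nat -> set R) (n : nat) : set T :=
  [set w | forall k, (k <= n)%N -> B k (Z (t k) w)].

(** The Markov property tested on finitely many ordered times: the form that is
    stable under scaling and that independence of increments yields directly. *)
Definition markov_along (R : realType) (S : R -> (R -> R) -> R -> R)
    d (T : measurableType d) (P : probability T R) (Z : R -> T -> R) : Prop :=
  forall (t : nat -> R) (B : nat -> set R) (n : nat) (f : R -> R) (M : R),
    t 0%N = 0 -> (forall k, t k <= t k.+1) -> (forall k, measurable (B k)) ->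
    measurable_fun setT f -> (forall y, `|f y| <= M) ->
    \int[P]_(w in visits Z t B n) f (Z (t n.+1) w) =
    \int[P]_(w in visits Z t B n) S (t n.+1 - t n) f (Z (t n) w).

Lemma Rintegral_setI d (T : measurableType d) (R : realType)
    (m : {measure set T -> \bar R}) (A B : set T) (f : T -> R) :
  \int[m]_(w in A `&` B) f w = \int[m]_(w in A) (\1_B w * f w).
Proof.
rewrite /Rintegral; congr fine; rewrite setIC integral_mkcondl.
apply: eq_integral => w _; rewrite patchE indicE.
by case: ifP; rewrite ?mul1r ?mul0r.
Qed.

Lemma nondecreasing_time (R : realType) (t : nat -> R) : t 0%N = 0 ->
  (forall k, t k <= t k.+1) -> forall k, 0 <= t k.
Proof. by move=> t0 tS; elim=> [|k]; [rewrite t0|move/le_trans; apply]. Qed.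

Section visits.
Variables (R : realType).
Context d (T : measurableType d) (P : probability T R) (Z : R -> T -> R).
Hypothesis mZ : forall t, 0 <= t -> measurable_fun setT (Z t).
Variables (t : nat -> R) (B : nat -> set R).
Hypothesis t_ge0 : forall k, 0 <= t k.
Hypothesis mB : forall k, measurable (B k).

Lemma visitsS n : visits Z t B n.+1 = visits Z t B n `&` (Z (t n.+1) @^-1` B n.+1).
Proof.
apply/seteqP; split=> w.
  by move=> h; split=> [k kn|]; [apply: h; exact: leqW|exact: h].
by move=> [h1 h2] k; rewrite leq_eqVlt => /predU1P[->//|]; exact: h1.
Qed.

Lemma visits0 : visits Z t B 0 = Z (t 0%N) @^-1` B 0%N.
Proof.
apply/seteqP; split=> w; first exact.
by move=> h k; rewrite leqn0 => /eqP ->.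
Qed.

Lemma measurable_visits n : measurable (visits Z t B n).
Proof.
have mp k : measurable (Z (t k) @^-1` B k).
  by rewrite -[X in measurable X]setTI; exact: mZ.
elim: n => [|n IH]; first by rewrite visits0.
by rewrite visitsS; exact: measurableI.
Qed.

Lemma Rintegral_start (x : R) (h : R -> R) (M : R) :
  P [set w | Z 0 w = x] = 1%E -> measurable_fun setT h -> (forall y, `|h y| <= M) ->
  \int[P]_w h (Z 0 w) = h x.
Proof.
move=> Px mh hM; have mZ0 := mZ (lexx 0).
have mE : measurable [set w | Z 0 w = x].
  have -> : [set w | Z 0 w = x] = setT `&` Z 0 @^-1` [set x] by rewrite setTI.
  exact: mZ0.
have i : P.-integrable setT (EFin \o (fun w => h (Z 0 w))).
  by apply: (@integrable_finite _ _ R P setT _ M) => //; exact: measurableT_comp mh mZ0.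
have N0 : P (~` [set w | Z 0 w = x]) = 0%E by rewrite probability_setC// Px subee.
rewrite /Rintegral (negligible_integral (measurableC mE) measurableT i N0) setTD setCK.
have -> : (\int[P]_(w in [set w | Z 0 w = x]) (EFin \o (fun w => h (Z 0 w))) w =
  \int[P]_(w in [set w | Z 0 w = x]) (h x)%:E)%E.
  by apply: eq_integral => w; rewrite inE/= => ->.
rewrite integral_cst//.
have -> : ((h x)%:E * P [set w | Z 0 w = x] = (h x)%:E)%E by rewrite Px mule1.
by [].
Qed.

End visits.

Section markov_uniqueness.
Variables (R : realType) (S : R -> (R -> R) -> R -> R) (x : R).
Hypothesis S_meas : forall (t M : R) (f : R -> R), 0 <= t ->
  measurable_fun setT f -> (forall y, `|f y| <= M) ->
  exists g : R -> R, [/\ measurable_fun setT g, (forall y, `|g y| <= M) &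
    forall x, 0 <= x -> g x = S t f x].
Context d1 (T1 : measurableType d1) (P1 : probability T1 R) (Z1 : R -> T1 -> R).
Context d2 (T2 : measurableType d2) (P2 : probability T2 R) (Z2 : R -> T2 -> R).
Hypothesis Z1_ge0 : forall t w, 0 <= t -> 0 <= Z1 t w.
Hypothesis Z2_ge0 : forall t w, 0 <= t -> 0 <= Z2 t w.
Hypothesis mZ1 : forall t, 0 <= t -> measurable_fun setT (Z1 t).
Hypothesis mZ2 : forall t, 0 <= t -> measurable_fun setT (Z2 t).
Hypothesis Z1_0 : P1 [set w | Z1 0 w = x] = 1%E.
Hypothesis Z2_0 : P2 [set w | Z2 0 w = x] = 1%E.
Hypothesis MZ1 : markov_along S P1 Z1.
Hypothesis MZ2 : markov_along S P2 Z2.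

(** Induction on the number of visits: the last constraint is moved into the
    test function, and the Markov property replaces it by a function of the
    previous position. *)
Lemma markov_visits_eq (t : nat -> R) (B : nat -> set R) n (f : R -> R) M :
  t 0%N = 0 -> (forall k, t k <= t k.+1) -> (forall k, measurable (B k)) ->
  measurable_fun setT f -> (forall y, `|f y| <= M) ->
  \int[P1]_(w in visits Z1 t B n) f (Z1 (t n) w) =
  \int[P2]_(w in visits Z2 t B n) f (Z2 (t n) w).
Proof.
move=> t0 tS mB; have tge := nondecreasing_time t0 tS.
have mI k (g : R -> R) : measurable_fun setT g ->
    measurable_fun setT (fun y => \1_(B k) y * g y).
  by move=> mg; apply: measurable_funM => //; exact: measurable_indic.
have bI k (g : R -> R) L : (forall y, `|g y| <= L) ->
    forall y, `|\1_(B k) y * g y| <= L.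
  move=> gL y; rewrite normrM indicE; apply: le_trans (gL y).
  by case: (_ \in _); rewrite ?normr1 ?mul1r// normr0 mul0r.
elim: n f M => [|n IH] f M mf fM.
  rewrite !visits0 -(setTI (_ @^-1` _)) -[in RHS](setTI (_ @^-1` _)) !Rintegral_setI t0.
  apply: etrans (Rintegral_start mZ1 Z1_0 (mI 0%N _ mf) (bI 0%N _ _ fM)) _.
  exact: esym (Rintegral_start mZ2 Z2_0 (mI 0%N _ mf) (bI 0%N _ _ fM)).
rewrite !visitsS !Rintegral_setI.
pose h y := \1_(B n.+1) y * f y.
have mh : measurable_fun setT h := mI n.+1 _ mf.
have bh : forall y, `|h y| <= M := bI n.+1 _ _ fM.
have E1 := MZ1 n t0 tS mB mh bh.
have E2 := MZ2 n t0 tS mB mh bh.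
apply: etrans E1 _; apply: etrans _ (esym E2).
have dt : 0 <= t n.+1 - t n by rewrite subr_ge0.
have [g [mg gM gE]] := S_meas dt mh bh.
under eq_Rintegral do rewrite -gE ?Z1_ge0//.
under [RHS]eq_Rintegral do rewrite -gE ?Z2_ge0//.
exact: IH mg gM.
Qed.

Let visits_eq t B n : t 0%N = 0 -> (forall k, t k <= t k.+1) ->
  (forall k, measurable (B k)) ->
  P1 (visits Z1 t B n) = P2 (visits Z2 t B n).
Proof.
move=> t0 tS mB; have tge := nondecreasing_time t0 tS.
have m1 := measurable_visits mZ1 tge mB n.
have m2 := measurable_visits mZ2 tge mB n.
have := @markov_visits_eq t B n (fun=> 1) 1 t0 tS mB (measurable_cst _).
rewrite (Rintegral_cst P1)//= (Rintegral_cst P2)//= !mul1r => E.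
rewrite -(fineK (fin_num_measure P1 _ m1)) -(fineK (fin_num_measure P2 _ m2)) E//.
by move=> _; rewrite normr1.
Qed.

(** Cylinders over unordered lists of times form a pi-system by concatenation. *)
Let cylinder (s : seq (R * set R)) : set (R -> R) :=
  [set p | forall vB, vB \in s -> vB.2 (p vB.1)].

Let admissible (s : seq (R * set R)) :=
  forall vB, vB \in s -> 0 <= vB.1 /\ measurable vB.2.

Let cylinders : set (set (R -> R)) :=
  [set C | exists2 s, admissible s & C = cylinder s].

Let pathT := g_sigma_algebraType cylinders.

Let cylinder_cat s1 s2 : cylinder (s1 ++ s2) = cylinder s1 `&` cylinder s2.
Proof.
apply/seteqP; split=> p.
  by move=> h; split=> vB vBs; apply: h; rewrite mem_cat vBs ?orbT.
by move=> [h1 h2] vB; rewrite mem_cat => /orP[/h1|/h2].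
Qed.

(** Sorting the times turns a cylinder into successive visits. *)
Let cylinder_sorted s : admissible s -> exists t B n,
  [/\ t 0%N = 0, (forall k, t k <= t k.+1), (forall k, measurable (B k)) &
   forall T (Z : R -> T -> R),
     [set w | cylinder s (fun v => Z v w)] = visits Z t B n].
Proof.
move=> As.
pose le1 (a b : R * set R) := a.1 <= b.1.
pose s' := (0, setT) :: sort le1 s.
have sorted_s' : sorted le1 s'.
  rewrite /s' /= path_sortedE; last by move=> a b c; exact: le_trans.
  apply/andP; split; last by apply: sort_sorted => a b; exact: le_total.
  by apply/allP => vB; rewrite mem_sort => /As[].
have memE vB : (vB \in s') = (vB == (0, setT)) || (vB \in s).
  by rewrite in_cons mem_sort.
pose z := last (0, setT) s'.
have nthS k : le1 (nth z s' k) (nth z s' k.+1).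
  have [k1|k1] := ltnP k.+1 (size s').
    apply: (sortedP z) => //.
  rewrite [nth z s' k.+1]nth_default//.
  move: k1; rewrite leq_eqVlt => /predU1P[E|k1]; last first.
    by rewrite nth_default// /le1.
  have -> : nth z s' k = z; last exact: lexx.
  rewrite -[RHS]/(last (0, setT) s') -nth_last E /=.
  by apply: set_nth_default; rewrite E.
have mem_nth' k : nth z s' k \in s'.
  have [k1|k1] := ltnP k (size s'); first exact: mem_nth.
  by rewrite nth_default// /z /s' /= mem_last.
exists (fun k => (nth z s' k).1), (fun k => (nth z s' k).2), (size s').-1; split => //.
- move=> k; have := mem_nth' k; rewrite memE => /orP[/eqP ->|]; first exact: measurableT.
  by move=> h; case: (As _ h).
- move=> T Z; apply/seteqP; split=> w h.
    move=> k _; have := mem_nth' k; rewrite memE => /orP[/eqP ->//|].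
    exact: h.
  move=> vB vBs; have /(nthP z)[k ks <-] : vB \in s' by rewrite memE vBs orbT.
  by apply: h; rewrite -ltnS prednK.
Qed.

Let path_measurable d (T : measurableType d) (Z : R -> T -> R) :
  (forall t, 0 <= t -> measurable_fun setT (Z t)) ->
  measurable_fun setT (fun w => (fun t => Z t w) : pathT).
Proof.
move=> mZ; have mE : @measurable _ pathT = <<s cylinders >> by [].
apply: (@measurability _ _ T pathT setT (fun w => fun t => Z t w) cylinders mE) => _ [_ [s As ->] <-].
rewrite setTI.
have [t [B [n [t0 tS mB E]]]] := cylinder_sorted As.
have -> : (fun w => (fun t => Z t w) : pathT) @^-1` cylinder s = visits Z t B n.
  exact: E.
by apply: measurable_visits => //; exact: nondecreasing_time.
Qed.

(** Initial law and semigroup determine all finite-dimensional laws, hence the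
    law on paths by the pi-lambda theorem. *)
Theorem markov_eq_in_law : eq_in_law P1 Z1 P2 Z2.
Proof.
have m1 := path_measurable mZ1; have m2 := path_measurable mZ2.
move=> C pC.
have {}pC : <<s cylinders >> C.
  move: pC; apply: smallest_sub; first exact: smallest_sigma_algebra.
  move=> _ [t [B [t0 mB ->]]]; apply: sub_sigma_algebra.
  exists [:: (t, B)]; first by move=> vB; rewrite inE => /eqP ->.
  apply/seteqP; split => p h; first by move=> vB; rewrite inE => /eqP ->.
  by have := h (t, B); rewrite inE eqxx; apply.
rewrite -[LHS]/(law P1 m1 C) -[RHS]/(law P2 m2 C).
apply: (@g_sigma_algebra_measure_unique _ R pathT cylinders _ (fun=> setT)) => //.
- by move=> A; exact: sub_sigma_algebra.
- move=> _; exists [::] => //; apply/seteqP; split => // p _ vB; by rewrite in_nil.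
- by rewrite bigcup_const.
- move=> _ _ [s1 A1 ->] [s2 A2 ->]; exists (s1 ++ s2); last by rewrite cylinder_cat.
  by move=> vB; rewrite mem_cat => /orP[/A1|/A2].
- move=> _ [s As ->]; have [t [B [n [t0 tS mB E]]]] := cylinder_sorted As.
  rewrite [LHS](_ : _ = P1 (visits Z1 t B n)); last by rewrite -E.
  by rewrite visits_eq// -E.
- move=> _; apply: (le_lt_trans (probability_le1 (law P1 m1) measurableT)).
  exact: ltry.
Qed.

End markov_uniqueness.

(** * Increments of a Levy process *)

Lemma Rintegral_as d (T : measurableType d) (R : realType) (P : probability T R)
    (E : set T) (h1 h2 : T -> R) : measurable E -> P E = 1%E ->
  P.-integrable setT (EFin \o h1) -> P.-integrable setT (EFin \o h2) ->
  (forall w, E w -> h1 w = h2 w) -> \int[P]_w h1 w = \int[P]_w h2 w.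
Proof.
move=> mE PE i1 i2 h12.
have N0 : P (~` E) = 0%E by rewrite probability_setC// PE subee.
rewrite /Rintegral; congr fine.
rewrite (negligible_integral (measurableC mE) measurableT i1 N0).
rewrite (negligible_integral (measurableC mE) measurableT i2 N0).
by apply: eq_integral => w; rewrite setTD setCK inE => /h12 h; rewrite /= h.
Qed.

Section borel_vector.
Variables (R : realType) (n : nat).

Definition borel_rV_gen : set (set 'rV[R]_n) :=
  \big[setU/set0]_(i < n) preimage_set_system setT (fun v : 'rV[R]_n => v 0 i) measurable.

Definition vecT := g_sigma_algebraType borel_rV_gen.

Let in_gen i (B : set R) : measurable B ->
  borel_rV_gen [set v : 'rV[R]_n | B (v 0 i)].
Proof.
move=> mB; rewrite /borel_rV_gen (bigD1 i)//=; left.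
by exists B => //; rewrite setTI.
Qed.

Lemma measurable_coord i : measurable_fun setT (fun v : vecT => v 0 i).
Proof.
move=> _ B mB; rewrite setTI; apply: sub_sigma_algebra; exact: in_gen.
Qed.

Lemma measurable_vecP d (T : measurableType d) (V : T -> vecT) :
  measurable_fun setT V <-> forall i, measurable_fun setT (fun w => V w 0 i).
Proof.
split=> [mV i|mV]; first exact: (measurableT_comp (measurable_coord i) mV).
have mE : @measurable _ vecT = <<s borel_rV_gen >> by [].
apply: (@measurability _ _ T vecT setT V borel_rV_gen mE) => _ [A gA <-].
rewrite setTI; move: A gA; rewrite /borel_rV_gen.
elim/big_ind : _ => [//|G1 G2 h1 h2 A [/h1|/h2]//|i _ _ [B mB <-]].
by rewrite setTI; have := mV i measurableT B mB; rewrite setTI.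
Qed.

Lemma measurable_dotv d (T : measurableType d) (V W : T -> 'rV[R]_n) :
  (forall i, measurable_fun setT (fun w => V w 0 i)) ->
  (forall i, measurable_fun setT (fun w => W w 0 i)) ->
  measurable_fun setT (fun w => dotv (V w) (W w)).
Proof.
move=> mV mW; apply: measurable_sum => i.
exact: measurable_funM.
Qed.

Lemma measurable_enorm d (T : measurableType d) (V : T -> 'rV[R]_n) :
  (forall i, measurable_fun setT (fun w => V w 0 i)) ->
  measurable_fun setT (fun w => enorm (V w)).
Proof.
move=> mV; apply: (measurableT_comp (continuous_measurable_fun (@sqrt_continuous R))).
exact: measurable_dotv.
Qed.

End borel_vector.

Section independence.
Variables (R : realType) (n : nat).
Context d (T : measurableType d) (P : probability T R).
Variable D : nat -> T -> 'rV[R]_n.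
Hypothesis mD : forall k i, measurable_fun setT (fun w => D k w 0 i).
Hypothesis indep : forall (m : nat) (A : nat -> set 'rV[R]_n),
  (forall k, borel_rV (A k)) ->
  P [set w | forall k, (k < m)%N -> A k (D k w)] =
  (\prod_(k < m) P [set w | A k (D k w)])%E.
Variable m : nat.

(** Rectangles in the first m increments: the pi-system on which independence is
    given. *)
Definition past_events : set (set T) :=
  [set C | exists2 A : nat -> set 'rV[R]_n, (forall k, borel_rV (A k)) &
    C = [set w | forall k, (k < m)%N -> A k (D k w)]].

Definition pastT := g_sigma_algebraType past_events.

Let mDv k : measurable_fun setT (D k : T -> vecT R n).
Proof. by apply/measurable_vecP. Qed.

Let borelT : borel_rV [set: 'rV[R]_n].
Proof. exact: (@measurableT _ (vecT R n)). Qed.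

Let mevent k (A : set 'rV[R]_n) : borel_rV A -> measurable [set w | A (D k w)].
Proof. by move=> mA; have := mDv k measurableT mA; rewrite setTI. Qed.

Let past_sub : past_events `<=` measurable.
Proof.
move=> _ [A mA ->].
have -> : [set w | forall k, (k < m)%N -> A k (D k w)] =
    \bigcap_(k in [set k | (k < m)%N]) [set w | A k (D k w)].
  by apply/seteqP; split.
by apply: bigcap_measurableType => k _; exact: mevent.
Qed.

Let pastI : setI_closed past_events.
Proof.
move=> _ _ [A mA ->] [B mB ->]; exists (fun k => A k `&` B k).
  by move=> k; exact: (@measurableI _ (vecT R n) _ _ (mA k) (mB k)).
apply/seteqP; split => w; first by move=> [h1 h2] k km; split; [exact: h1|exact: h2].
by move=> h; split => k /h[].
Qed.

Lemma measurable_past k i : (k < m)%N ->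
  measurable_fun setT (fun w : pastT => D k w 0 i).
Proof.
move=> km; have mDk : measurable_fun setT (D k : pastT -> vecT R n).
  move=> _ A mA; rewrite setTI; apply: sub_sigma_algebra.
  exists (fun j => if j == k then A else setT); first by move=> j; case: ifP.
  apply/seteqP; split=> w h; last by have := h k km; rewrite eqxx.
  by move=> j _; case: eqP => // ->.
exact: (measurableT_comp (measurable_coord i) mDk).
Qed.

(** The product formula extends from the pi-system of past events to the
    sigma-algebra of the past. *)
Lemma past_indep (C : set T) (A : set 'rV[R]_n) : <<s past_events >> C -> borel_rV A ->
  P (C `&` [set w | A (D m w)]) = (P C * P [set w | A (D m w)])%E.
Proof.
move=> sC mA; have mE := mevent m mA.
set E := [set w | A (D m w)].
have r0 : 0 <= fine (P E) by exact: fine_ge0.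
have PE : P E = (fine (P E))%:E by rewrite fineK// fin_num_measure.
pose m1 := mrestr P mE; pose m2 := mscale (NngNum r0) P.
have m2E X : m2 X = (P E * P X)%E by rewrite PE.
rewrite muleC -m2E.
rewrite -[LHS]/(m1 C).
apply: (@g_sigma_algebra_measure_unique _ R T past_events _ (fun=> setT)) => //.
- move=> _; exists (fun=> setT) => //; apply/seteqP; split => //.
- by rewrite bigcup_const.
- move=> _ [B mB ->]; rewrite -[LHS]/(P (_ `&` E)) [RHS]m2E.
  pose B' k := if k == m then A else B k.
  have mB' k : borel_rV (B' k) by rewrite /B'; case: ifP.
  have := indep m.+1 mB'; rewrite big_ord_recr/= {3}/B' eqxx.
  have -> : (\prod_(k < m) P [set w | B' k (D k w)] =
      \prod_(k < m) P [set w | B k (D k w)])%E.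
    by apply: eq_bigr => k _; rewrite /B' ltn_eqF.
  rewrite -indep// muleC => EP; rewrite /E -EP; congr (P _).
  apply/seteqP; split => w.
    move=> [h1 h2] k; rewrite ltnS leq_eqVlt /B' => /predU1P[->|km].
      by rewrite eqxx.
    by rewrite ltn_eqF//; exact: h1.
  move=> h; split; last by have := h m (ltnSn _); rewrite /B' eqxx.
  by move=> k km; have := h k (ltnW km); rewrite /B' ltn_eqF.
- by move=> _; rewrite /m1 /mrestr; apply: le_lt_trans (probability_le1 _ _) (ltry _); exact: measurableI.
Qed.

(** Freezing lemma: the next increment can be integrated out on its own. *)
Lemma freezing (F : pastT * vecT R n -> R) (M : R) :
  measurable_fun setT F -> (forall z, `|F z| <= M) ->
  \int[P]_w F (w, D m w) = \int[P]_w \int[P]_w' F (w, D m w').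
Proof.
move=> mF FM.
have mid : measurable_fun setT (id : T -> pastT).
  move=> _ C mC; rewrite setTI preimage_id.
  exact: (smallest_sub (@sigma_algebra_measurable _ T) past_sub mC).
pose phi w : pastT * vecT R n := (w, D m w).
have mphi : measurable_fun setT phi.
  by apply: measurable_fun_pair.
have E X : measurable X -> (law P mid \x law P (mDv m))%E X = law P mphi X.
  apply: product_measure_unique => C A mC mA.
  exact: (@past_indep C A mC mA).
rewrite -[LHS](Rintegral_law P mphi mF FM).
transitivity (\int[(law P mid \x law P (mDv m))%E]_z F z).
  rewrite /Rintegral; congr fine; apply: eq_measure_integral => X mX _.
  exact: (esym (E X mX)).
rewrite (@Rintegral_prod _ _ _ _ _ _ _ _ M)//.
have mF1 w : measurable_fun setT (fun e => F (w, e)).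
  exact: measurableT_comp mF (measurable_pair1 _).
pose I w := \int[law P (mDv m)]_e F (w, e).
have IE w : I w = \int[P]_w' F (w, D m w').
  exact: (Rintegral_law P (mDv m) (mF1 w) (fun e => FM (w, e))).
have iM : (law P mid).-integrable setT (EFin \o cst M) by exact: finite_measure_integrable_cst.
have i1 : (law P (mDv m)).-integrable setT (EFin \o cst (1 : R)).
  exact: finite_measure_integrable_cst.
have bF w e : setT w -> setT e -> `|F (w, e)| <= cst M w * cst 1 e.
  by move=> _ _; rewrite /cst mulr1.
have mF' : measurable_fun setT (fun z : pastT * vecT R n => F (z.1, z.2)).
  by apply: (eq_measurable_fun F) mF => -[].
have [iI _] := @Rintegral_fubini _ _ _ _ R (law P mid) (law P (mDv m)) setT setT
  (fun w e => F (w, e)) (cst M) (cst 1) measurableT measurableT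
  mF' iM i1 bF.
have mI : measurable_fun setT I.
  by have := measurable_int _ iI; move/measurable_EFinP.
have bI w : `|I w| <= M.
  have iF : (law P (mDv m)).-integrable setT (EFin \o (fun e => F (w, e))).
    by apply: (@integrable_finite _ _ R _ setT _ M).
  apply: le_trans (le_normr_Rintegral measurableT iF) _.
  have -> : M = \int[law P (mDv m)]_e cst M e.
    by rewrite Rintegral_cst//= probability_setT/= mulr1.
  apply: le_Rintegral => //; last exact: finite_measure_integrable_cst.
  exact: (integrable_norm iF).
transitivity (\int[law P mid]_w I w) => //.
rewrite (Rintegral_law P mid mI bI).
by apply: eq_Rintegral => w _; exact: IE.
Qed.

End independence.

Section levy_increments.
Variables (R : realType) (n : nat).
Context d (T : measurableType d) (P : probability T R).
Variables (z : 'rV[R]_n) (X : R -> T -> 'rV[R]_n).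
Hypothesis levyX : levy_process P z X.

Lemma measurable_levy t : 0 <= t -> measurable_fun setT (X t : T -> vecT R n).
Proof. by case: levyX => mX _ _ _ _ t0; apply/measurable_vecP => i; exact: mX. Qed.

Lemma measurable_levyB s t i : 0 <= s -> 0 <= t ->
  measurable_fun setT (fun w => (X t w - X s w) 0 i).
Proof.
case: levyX => mX _ _ _ _ s0 t0.
under eq_fun do rewrite !mxE.
by apply: measurable_funD; [exact: mX|apply: measurableT_comp => //; exact: mX].
Qed.

Lemma measurable_levy_start : measurable [set w | X 0 w = z].
Proof.
have -> : [set w | X 0 w = z] =
    \bigcap_(i in [set: 'I_n]) ([set w | X 0 w 0 i = z 0 i]).
  apply/seteqP; split=> w /=; first by move=> h i _ /=; rewrite h.
  by move=> h; apply/rowP => i; exact: h.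
apply: fin_bigcap_measurable => // i _.
have := (measurable_vecP (X 0)).1 (measurable_levy (lexx 0)) i measurableT [set z 0 i].
by rewrite setTI; apply; exact: measurable_set1.
Qed.

(** Stationarity of the increments, for bounded test functions. *)
Lemma levy_increment_expectation (s t M : R) (h : vecT R n -> R) : 0 <= s -> s <= t ->
  measurable_fun setT h -> (forall v, `|h v| <= M) ->
  \int[P]_w h (X t w - X s w) = \int[P]_w h (X (t - s) w - z).
Proof.
move=> s0 st mh hM; have ts0 : 0 <= t - s by rewrite subr_ge0.
have mB u v (u0 : 0 <= u) (v0 : 0 <= v) :
    measurable_fun setT ((fun w => X v w - X u w) : T -> vecT R n).
  by apply/measurable_vecP => i; exact: measurable_levyB.
have mz : measurable_fun setT ((fun w => X (t - s) w - z) : T -> vecT R n).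
  apply/measurable_vecP => i; under eq_fun do rewrite !mxE.
  by apply: measurable_funB => //; exact: (measurable_vecP _).1 (measurable_levy ts0) i.
have m1 := mB s t s0 (le_trans s0 st); have m2 := mB 0 (t - s) (lexx 0) ts0.
rewrite -(Rintegral_law P m1 mh hM).
transitivity (\int[law P m2]_v h v).
  rewrite /Rintegral; congr fine; apply: eq_measure_integral => A mA _.
  case: levyX => _ _ _ stat _.
  have := @stat s (t - s) A s0 ts0 mA.
  by rewrite (addrC s) subrK.
rewrite (Rintegral_law P m2 mh hM).
case: levyX => _ X0 _ _ _.
have int u (mu_ : measurable_fun setT (u : T -> vecT R n)) :
    P.-integrable setT (EFin \o (fun w => h (u w))).
  apply: (@integrable_finite _ _ R P setT _ M) => //.
  exact: (measurableT_comp mh mu_).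
apply: (Rintegral_as measurable_levy_start X0 (int _ m2) (int _ mz)).
by move=> w /= ->.
Qed.

Lemma measurable_cos_dotv th : measurable_fun setT (fun v : vecT R n => cos (dotv th v)).
Proof.
apply: (measurableT_comp (continuous_measurable_fun (@continuous_cos R))).
by apply: measurable_dotv => i //; exact: measurable_coord.
Qed.

Lemma measurable_sin_dotv th : measurable_fun setT (fun v : vecT R n => sin (dotv th v)).
Proof.
apply: (measurableT_comp (continuous_measurable_fun (@continuous_sin R))).
by apply: measurable_dotv => i //; exact: measurable_coord.
Qed.

End levy_increments.

Section radial_levy.
Variables (R : realType) (alpha : R).
Hypothesis halpha : 0 < alpha < 2.
Local Notation K := (radial_kernel alpha).
Variable p : R -> R -> R -> R.
Hypothesis pK : forall t x y : R, 0 < t -> 0 <= x -> 0 <= y -> p t x y = K t x y.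
Local Notation S := (density_semigroup p).
Context d (T : measurableType d) (P : probability T R).
Variables (z : 'rV[R]_3) (X : R -> T -> 'rV[R]_3).
Hypothesis stableX : isotropic_stable alpha P z X.

Let levyX : levy_process P z X. Proof. by case: stableX. Qed.

(** Stationarity reduces to the law of X at time t - s; the case s = t is the
    identity of the semigroup. *)
Lemma radial_increment (s t M : R) (x : 'rV[R]_3) (f : R -> R) : 0 <= s -> s <= t ->
  measurable_fun setT f -> (forall y, `|f y| <= M) ->
  \int[P]_w f (enorm (x + (X t w - X s w))) = S (t - s) f (enorm x).
Proof.
move=> s0; rewrite le_eqVlt => /predU1P[<-|st] mf fM.
  rewrite subrr semigroup0; under eq_Rintegral do rewrite subrr addr0.
  by rewrite Rintegral_cst//= probability_setT/= mulr1.
have ts0 : 0 < t - s by rewrite subr_gt0.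
have stable := stableX.2 (t - s) ^~ (ltW ts0).
rewrite (semigroupE pK)// ?sqrtr_ge0//.
have mD i : measurable_fun setT (fun w => (X t w - X s w) 0 i).
  exact: (measurable_levyB levyX i s0 (le_trans s0 (ltW st))).
have hcos th : \int[P]_w cos (dotv th (X t w - X s w)) = stable_cf alpha (t - s) (enorm th).
  have := levy_increment_expectation levyX s0 (ltW st)
    (measurable_cos_dotv th) (fun v => cos_max _).
  have [h _] := stable th; rewrite [X in _ = X -> _]/Rintegral h /= stable_cfE.
  by rewrite (ger0_norm (sqrtr_ge0 _)).
have hsin th : \int[P]_w sin (dotv th (X t w - X s w)) = 0.
  have := levy_increment_expectation levyX s0 (ltW st)
    (measurable_sin_dotv th) (fun v => sin_max _).
  by have [_ h] := stable th; rewrite [X in _ = X -> _]/Rintegral h.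
exact: (expectation_radial halpha mD ts0 hcos hsin x mf fM).
Qed.

(** X starts at z only almost surely; recentring makes the starting point exact
    and writes every position as z plus a sum of increments. *)
Definition radial_part (t : R) (w : T) : R := enorm (z + (X t w - X 0 w)).

Lemma measurable_radial_part t : 0 <= t -> measurable_fun setT (radial_part t).
Proof.
move=> t0; apply: measurable_enorm => i; under eq_fun do rewrite mxE.
by apply: measurable_funD => //; exact: (measurable_levyB levyX i (lexx 0) t0).
Qed.

(** The past visits are measurable with respect to the past increments, so the
    next increment is integrated out by [freezing], and only the norm of the
    current position remains by [expectation_radial]. *)
Lemma markov_radial_part : markov_along S P radial_part.
Proof.
move=> t B m f M t0 tS mB mf fM.
have tge := nondecreasing_time t0 tS.
pose D k w := X (t k.+1) w - X (t k) w.
have mD k i : measurable_fun setT (fun w => D k w 0 i).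
  exact: (measurable_levyB levyX i (tge k) (tge k.+1)).
have indep (j : nat) (A : nat -> set 'rV[R]_3) : (forall k, borel_rV (A k)) ->
    P [set w | forall k, (k < j)%N -> A k (D k w)] =
    (\prod_(k < j) P [set w | A k (D k w)])%E.
  by case: levyX => _ _ h _ _; apply: h; rewrite ?t0.
pose V k w := z + \sum_(i < k) D i w.
have VE k w : V k w = z + (X (t k) w - X 0 w).
  congr (_ + _); elim: k => [|k IH]; first by rewrite big_ord0 t0 subrr.
  by rewrite big_ord_recr/= IH /D addrC addrA subrK.
have ZE k w : radial_part (t k) w = enorm (V k w) by rewrite VE.
pose T' := pastT D m.
have mV k i : (k <= m)%N -> measurable_fun setT (fun w : T' => V k w 0 i).
  move=> km; under eq_fun do rewrite /V mxE summxE.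
  apply: measurable_funD => //; apply: measurable_sum => j.
  by apply: measurable_past; exact: leq_trans km.
have mvis : measurable (visits radial_part t B m : set T').
  have -> : visits radial_part t B m =
      \bigcap_(k in [set k | (k <= m)%N]) ([set w | B k (enorm (V k w))]).
    by apply/seteqP; split=> w h k /h; rewrite ZE.
  apply: bigcap_measurableType => k km.
  have := measurable_enorm (fun i => mV k i km) measurableT (mB k).
  by rewrite setTI.
pose F (y : T' * vecT R 3) := \1_(visits radial_part t B m) y.1 * f (enorm (V m y.1 + y.2)).
have mF : measurable_fun setT F.
  apply: measurable_funM.
    by apply: (measurableT_comp _ measurable_fst); exact: measurable_indic.
  apply: (measurableT_comp mf); apply: measurable_enorm => i.
  under eq_fun do rewrite mxE; apply: measurable_funD.
    exact: (measurableT_comp (mV m i (leqnn m)) measurable_fst).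
  exact: (measurableT_comp (measurable_coord i) measurable_snd).
have FM y : `|F y| <= M.
  rewrite normrM indicE; apply: le_trans (fM _).
  by case: (_ \in _); rewrite ?normr1 ?mul1r// normr0 mul0r.
have E := freezing mD indep mF FM.
rewrite -(setTI (visits _ _ _ _)) !Rintegral_setI.
transitivity (\int[P]_w F (w, D m w)).
  apply: eq_Rintegral => w _; rewrite /F/= ZE; congr (_ * f (enorm _)).
  by rewrite /V big_ord_recr/= addrA.
rewrite E; apply: eq_Rintegral => w _.
rewrite ZE -(radial_increment (V m w) (tge m) (tS m) mf fM).
rewrite /F/= RintegralZl//.
apply: (@integrable_finite _ _ R P setT _ M) => //.
apply: (measurableT_comp mf); apply: measurable_enorm => i.
by under eq_fun do rewrite mxE; apply: measurable_funD.
Qed.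

End radial_levy.

(** * Self-similarity and conclusion *)

Section scaling.
Variables (R : realType) (alpha : R).
Hypothesis halpha : 0 < alpha < 2.
Local Notation mu := (@lebesgue_measure R).
Local Notation cf := (stable_cf alpha).
Local Notation K := (radial_kernel alpha).
Local Notation halfline := (`[0%R, +oo[%classic : set R).

(** Substitution th -> c th in the radial Fourier integral. *)
Lemma radial_kernel_scale (c t x y : R) : 0 < c -> 0 < t ->
  K (c `^ (- alpha) * t) x y = c * K t (c * x) (c * y).
Proof.
move=> c0 t0; have ct0 : 0 < c `^ (- alpha) * t by rewrite mulr_gt0// powR_gt0.
have i1 := integrable_radial halpha x y ct0.
have [_ E] := integral_affine 0 c0 i1.
rewrite /radial_kernel E.
have i2 := integrable_radial halpha (c * x) (c * y) t0.
have -> : \int[mu]_th ((c * th + 0) ^+ 2 * (sinc ((c * th + 0) * x) * sinc ((c * th + 0) * y)) *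
     cf (c `^ (- alpha) * t) (c * th + 0)) =
  \int[mu]_th (c ^+ 2 * (th ^+ 2 * (sinc (th * (c * x)) * sinc (th * (c * y))) * cf t th)).
  apply: eq_Rintegral => th _; rewrite addr0 -!(mulrA c) (mulrC c (_ * x)) (mulrC c (_ * y)).
  rewrite -!(mulrA th) (mulrC x) (mulrC y).
  have -> : cf (c `^ (- alpha) * t) (c * th) = cf t th; last first.
    by rewrite exprMn; ring.
  rewrite !stable_cfE normrM (gtr0_norm c0) powRM ?(ltW c0)//.
  rewrite mulrACA -powRD; last by rewrite (gt_eqF c0) implybT.
  by rewrite subrr powRr0 mul1r.
rewrite (RintegralZl _ measurableT i2); ring.
Qed.

Variable p : R -> R -> R -> R.
Hypothesis pK : forall t x y : R, 0 < t -> 0 <= x -> 0 <= y -> p t x y = K t x y.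
Local Notation S := (density_semigroup p).

Lemma semigroup_scale (c t x M : R) (f : R -> R) : 0 < c -> 0 <= t -> 0 <= x ->
  measurable_fun setT f -> (forall y, `|f y| <= M) ->
  S t f (c * x) = S (c `^ (- alpha) * t) (fun y => f (c * y)) x.
Proof.
move=> c0; rewrite le_eqVlt => /predU1P[<-|t0] x0 mf fM.
  by rewrite mulr0 !semigroup0.
have cx0 : 0 <= c * x by rewrite mulr_ge0// ltW.
have ct0 : 0 < c `^ (- alpha) * t by rewrite mulr_gt0// powR_gt0.
rewrite (semigroupE pK f t0 cx0) (semigroupE pK _ ct0 x0).
have iK := semigroup_integrable halpha t0 cx0 (measurable_funTS mf) (fun y _ => fM y).
have mH : measurable (halfline : set (measurableTypeR R)) by [].
rewrite Rintegral_mkcond.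
have i1 : mu.-integrable setT (EFin \o ((fun y => f y * K t (c * x) y) \_ halfline)).
  by rewrite -restrict_EFin; apply: (integrable_mkcond _ mH).1.
have [i2 ->] := integral_affine 0 c0 i1.
rewrite -(RintegralZl _ measurableT i2) [RHS]Rintegral_mkcond.
apply: eq_Rintegral => y _; rewrite addr0 !patchE.
have -> : (c * y \in halfline) = (y \in halfline).
  by apply/idP/idP; rewrite !inE/= !in_itv/= !andbT pmulr_rge0.
by case: ifP => _; rewrite ?mulr0// radial_kernel_scale//; ring.
Qed.

End scaling.

Section markov_process.
Variables (R : realType) (S : R -> (R -> R) -> R -> R).
Context d (T : measurableType d) (P : R -> probability T R) (Y : R -> T -> R).
Hypothesis markovY : markov_process S P Y.

Lemma markov_process_along (x : R) : 0 <= x -> markov_along S (P x) Y.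
Proof.
move=> x0 t B n f M t0 tS mB mf fM; have tge := nondecreasing_time t0 tS.
have dt : 0 <= t n.+1 - t n by rewrite subr_ge0.
have t_le k : (k <= n)%N -> t k <= t n.
  elim: n {dt} => [|n IH]; first by rewrite leqn0 => /eqP ->.
  rewrite leq_eqVlt => /predU1P[->//|kn]; exact: le_trans (IH kn) (tS n).
have past : natural_filtration Y (t n) (visits Y t B n).
  rewrite /natural_filtration; set G := [set A | _].
  have -> : visits Y t B n = \bigcap_(k in [set k | (k <= n)%N]) (Y (t k) @^-1` B k).
    by apply/seteqP; split=> w h k /h.
  apply: (@bigcap_measurableType _ (g_sigma_algebraType G)) => k kn.
  by apply: sub_sigma_algebra; exists (t k), (B k); split => //; rewrite tge t_le.
case: markovY => _ _ _ H.
have := H x (t n) (t n.+1 - t n) f _ x0 (tge n) dt mf (ex_intro _ M fM) past.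
by rewrite addrC subrK /Rintegral => ->.
Qed.

End markov_process.

Section events.
Variable R : realType.

Lemma measurable_path_event d (T : measurableType d) (Z : R -> T -> R) (C : set (R -> R)) :
  (forall t, 0 <= t -> measurable_fun setT (Z t)) -> path_sigma_algebra C ->
  measurable [set w | C (fun t => Z t w)].
Proof.
move=> mZ; rewrite /path_sigma_algebra; set G := [set A | _] => GC.
pose pathT := g_sigma_algebraType G.
have mE : @measurable _ pathT = <<s G >> by [].
have mpath : measurable_fun setT ((fun w => fun t => Z t w) : T -> pathT).
  apply: (@measurability _ _ T pathT setT _ G mE) => _ [_ [t [B [t0 mB ->]]] <-].
  exact: (mZ t t0 measurableT B mB).
by have := mpath measurableT C GC; rewrite setTI.
Qed.

Lemma probability_as d (T : measurableType d) (P : probability T R) (E A B : set T) :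
  measurable E -> P E = 1%E -> measurable A -> measurable B ->
  A `&` E = B `&` E -> P A = P B.
Proof.
move=> mE PE mA mB AB.
have h (C : set T) : measurable C -> P C = P (C `&` E).
  move=> mC; have e0 : P (C `\` E) = 0%E.
    apply: (@subset_measure0 _ _ _ P _ (~` E)) => //.
    - exact: measurableD.
    - exact: measurableC.
    - by rewrite -[LHS]/(P (~` E)) probability_setC// PE subee.
  transitivity (0 + P (C `&` E))%E; last by rewrite add0e.
  by rewrite -e0; exact: measureDI.
by rewrite h// AB -h.
Qed.

End events.

Section stable_density.
Variables (R : realType) (alpha : R).
Hypothesis halpha : 0 < alpha < 2.
Local Notation mu := (@lebesgue_measure R).
Local Notation K := (radial_kernel alpha).
Local Notation cf := (stable_cf alpha).
Local Notation halfline := (`[0%R, +oo[%classic : set R).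
Context d (T : measurableType d) (P : probability T R).
Variable X : R -> T -> 'rV[R]_1.
Hypothesis stableX : isotropic_stable alpha P 0 X.
Variable q : R -> R -> R -> R.
Hypothesis densX : transition_density P X q.

Let Z t w := X t w 0 0.

Let mZ t : 0 <= t -> measurable_fun setT (Z t).
Proof. by case: stableX => -[mX _ _ _ _] _ t0; exact: mX. Qed.

Let dot1 th t w : dotv (const_mx th : 'rV[R]_1) (X t w - 0) = th * Z t w.
Proof. by rewrite subr0 /dotv big_ord_recl big_ord0 addr0 mxE. Qed.

Let enorm1 (th : R) : enorm (const_mx th : 'rV[R]_1) = `|th|.
Proof. by rewrite /enorm /dotv big_ord_recl big_ord0 addr0 mxE -expr2 sqrtr_sqr. Qed.

Let hcos t th : 0 <= t -> \int[P]_w cos (th * Z t w) = cf t th.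
Proof.
move=> t0; have [h _] := stableX.2 t (const_mx th) t0.
rewrite stable_cfE -enorm1 -[RHS]/(fine (_%:E)) -h.
by apply: eq_Rintegral => w _; rewrite dot1.
Qed.

Let hsin t th : 0 <= t -> \int[P]_w sin (th * Z t w) = 0.
Proof.
move=> t0; have [_ h] := stableX.2 t (const_mx th) t0.
rewrite -[RHS]/(fine 0%E) -h.
by apply: eq_Rintegral => w _; rewrite dot1.
Qed.

Lemma transition_densityE t x y : 0 < t -> q t x y = stable_pdf alpha t (y - x).
Proof.
move=> t0; have [cq q0 Pq] := densX x t0; have t0' := ltW t0.
exact: (density_stable_pdf halpha (mZ t0') t0 (fun th => hcos th t0')
  (fun th => hsin th t0') cq q0 Pq).
Qed.

Lemma qstar_posE t x y : 0 < t -> x != 0 -> qstar_pos q t x y = K t x y.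
Proof.
move=> t0 x0; rewrite /qstar_pos !transition_densityE//.
by rewrite -opprD stable_pdfN radial_kernelE.
Qed.

Lemma cvg_qstar_pos t y : 0 < t ->
  qstar_pos q t x y @[x --> (0 : R)^'+] --> K t 0 y.
Proof.
move=> t0; apply/cvg_at_rightP => u [u0 ucv].
rewrite (_ : (fun n => _) = (fun n => K t (u n) y)).
  exact: (@cvg_radial_kernel R alpha halpha t u 0 y t0 ucv).
by apply/funext => n; rewrite qstar_posE// gt_eqF.
Qed.

Lemma qstarE t x y : 0 < t -> qstar q t x y = K t x y.
Proof.
move=> t0; rewrite /qstar; have [->|x0] := eqVneq x 0; last exact: qstar_posE.
by apply: cvg_lim => //; exact: cvg_qstar_pos.
Qed.

Lemma radial_eigenfunction t x r : 0 < t -> 0 < x ->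
  \int[mu]_(y in halfline) (sinc (r * y) * K t x y) = sinc (r * x) * cf t r.
Proof.
move=> t0 x0; have t0' := ltW t0; have [cq q0 Pq] := densX x t0.
have mxZ : measurable_fun setT (fun w => x + Z t w).
  by apply: measurable_funD => //; exact: mZ.
have ms : measurable_fun setT (fun y : R => sin (r * y)).
  apply: measurableT_comp; last exact: measurable_funM.
  exact: continuous_measurable_fun (@continuous_sin R).
have [iq _ E] := density_expectation mxZ (continuous_measurable_fun cq) q0 Pq ms
  (fun y => sin_max _).
have qE : q t x = (fun y => stable_pdf alpha t (y - x)).
  by apply/funext => y; exact: transition_densityE.
rewrite qE in iq E; apply: radial_kernel_eigen => //.
by rewrite E; exact: (expectation_sin (mZ t0') (fun th => hcos th t0') (fun th => hsin th t0')).
Qed.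

End stable_density.

Theorem theorem1 (R : realType) (alpha : R) (halpha : 0 < alpha < 2)
    (d1 : measure_display) (T1 : measurableType d1) (P1 : probability T1 R)
    (X1 : R -> T1 -> 'rV[R]_1) (hX1 : isotropic_stable alpha P1 0 X1)
    (q : R -> R -> R -> R) (hq : transition_density P1 X1 q) :
  [/\ (forall t y : R, 0 < t -> 0 <= y ->
         cvg (qstar_pos q t x y @[x --> (0 : R)^'+])),
      conservative_density (qstar q),
      feller_semigroup (density_semigroup (qstar q)) &
      forall (d : measure_display) (T : measurableType d)
             (P : R -> probability T R) (Y : R -> T -> R),
        markov_process (density_semigroup (qstar q)) P Y ->
        self_similar alpha P Y /\
        (forall (d3 : measure_display) (T3 : measurableType d3)
                (P3 : probability T3 R) (z : 'rV[R]_3)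
                (X : R -> T3 -> 'rV[R]_3),
           isotropic_stable alpha P3 z X ->
           eq_in_law P3 (fun t w => enorm (X t w)) (P (enorm z)) Y)].
Proof.
have pK t x y : 0 < t -> 0 <= x -> 0 <= y -> qstar q t x y = radial_kernel alpha t x y.
  by move=> t0 _ _; exact: (qstarE halpha hX1 hq).
split.
- move=> t y t0 _; apply/cvg_ex; exists (radial_kernel alpha t 0 y).
  exact: (@cvg_qstar_pos R alpha halpha _ T1 P1 X1 hX1 q hq t y t0).
- move=> t x t0 x0; have -> : qstar q t x = radial_kernel alpha t x.
    by apply/funext => y; exact: (qstarE halpha hX1 hq).
  split; last exact: radial_kernel_mass.
    by apply: measurable_funTS; exact: measurable_radial_kernel.
  by move=> y y0; exact: radial_kernel_ge0.
- apply: (radial_feller halpha _ pK) => t x r t0 x0.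
  exact: (radial_eigenfunction halpha hX1 hq).
move=> d T P Y markovY; case: (markovY) => Y0 mY startY _.
have smeas := semigroup_bounded_measurable halpha pK.
have ca (c : R) : 0 < c -> 0 < c `^ (- alpha) by move=> c0; exact: powR_gt0.
split=> [c x c0 x0|d3 T3 P3 z X stableX].
  have cx0 : 0 <= c * x by rewrite mulr_ge0// ltW.
  have c0' := ltW (ca _ c0).
  apply: (markov_eq_in_law (x := c * x) smeas).
  - by move=> t w t0; rewrite mulr_ge0 ?(ltW c0)// Y0// mulr_ge0.
  - exact: Y0.
  - by move=> t t0; apply: measurable_funM => //; apply: mY; rewrite mulr_ge0.
  - exact: mY.
  - rewrite mulr0 -(startY x x0); congr (P x _); apply/seteqP; split=> w /=.
      by move/(mulfI (negbT (gt_eqF c0))).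
    by move=> ->.
  - exact: startY.
  - move=> t B n f M t0 tS mB mf fM; have tge := nondecreasing_time t0 tS.
    have mc : measurable_fun setT (fun y : R => c * y) by exact: measurable_funM.
    have mBc k : measurable [set y : R | B k (c * y)].
      by have := mc measurableT _ (mB k); rewrite setTI.
    have := @markov_process_along _ _ _ _ _ _ markovY x x0
      (fun k => c `^ (- alpha) * t k) (fun k => [set y | B k (c * y)]) n
      (fun y => f (c * y)) M.
    rewrite t0 mulr0; move=> /(_ erefl) h.
    apply: etrans (h _ mBc _ _) _.
    + by move=> k; rewrite ler_wpM2l.
    + exact: measurableT_comp.
    + by move=> y; exact: fM.
    apply: eq_Rintegral => w _; rewrite -mulrBr.
    rewrite (semigroup_scale halpha pK c0 _ _ mf fM)// ?subr_ge0//.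
    by rewrite Y0// mulr_ge0.
  - exact: markov_process_along markovY _ cx0.
have levyX : levy_process P3 z X by case: stableX.
have mX := measurable_radial_part stableX.
have start0 : P3 [set w | radial_part z X 0 w = enorm z] = 1%E.
  rewrite (_ : [set w | _] = setT) ?probability_setT//.
  by apply/seteqP; split=> // w _; rewrite /= /radial_part subrr addr0.
move=> C pC.
have mn t : 0 <= t -> measurable_fun setT (fun w => enorm (X t w)).
  by move=> t0; apply: measurable_enorm; exact/measurable_vecP/(measurable_levy levyX).
have law_eq : eq_in_law P3 (radial_part z X) (P (enorm z)) Y.
  apply: (markov_eq_in_law (x := enorm z) smeas) => //.
  - by move=> t w _; exact: sqrtr_ge0.
  - by apply: startY; exact: sqrtr_ge0.
  - exact: (markov_radial_part halpha pK stableX).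
  - by apply: (markov_process_along markovY); exact: sqrtr_ge0.
rewrite -law_eq//.
have PX0 : P3 [set w | X 0 w = z] = 1%E by case: levyX.
apply: (probability_as (measurable_levy_start levyX) PX0).
- exact: measurable_path_event.
- exact: measurable_path_event.
apply/seteqP; split=> w [Cw Ew]; split => //; move: Cw; rewrite /=.
  rewrite (_ : (fun t => radial_part z X t w) = (fun t => enorm (X t w)))//.
  by apply/funext => t; rewrite /radial_part Ew addrC subrK.
rewrite (_ : (fun t => radial_part z X t w) = (fun t => enorm (X t w)))//.
by apply/funext => t; rewrite /radial_part Ew addrC subrK.
Qed.
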